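(* Let $\alpha>-2$ and let $\beta\le\beta_0$ (so $u_\beta$ is an entire radial solution of $\Delta^2u=|x|^\alpha e^u$ in $\mathbb{R}^N$). (i) If $N=3$ or $N=4$, then $u_\beta$ is unstable but stable at infinity for every $\beta\le\beta_0$. (ii) If $5\le N<N_\alpha$, then $u_\beta$ is stable at infinity for every $\beta<\beta_0$, while $u_{\beta_0}$ is not stable on $\mathbb{R}^N\setminus K$ for any compact set $K$. Moreover, there exists $\beta_1<\beta_0$ such that $u_\beta$ is stable if and only if $\beta\le\beta_1$. (iii) If $N\ge N_\alpha$, then $u_\beta$ is stable for every $\beta\le\beta_0$.
   Context: Fix an integer $N\ge3$ and $\alpha>-2$. For $\beta\in\mathbb{R}$, $u_\beta$ denotes the radial function $u_\beta(x)=u_\beta(r)$, $r=|x|$, solving the initial value problem $\Delta^2u=|x|^\alpha e^u$ for $r\in[0,R_\beta)$, $u'(0)=u'''(0)=0$, $u(0)=0$, $\Delta u(0)=\beta$, where $\Delta u=u''+\frac{N-1}{r}u'$ is the radial Laplacian in $\mathbb{R}^N$ and $[0,R_\beta)$ is the maximal interval of existence. $u_\beta$ is called an entire solution if $R_\beta=\infty$. $\beta_0:=\sup\{\beta\in\mathbb{R}:R_\beta=\infty\}$; it is known that $\beta_0$ is a finite negative number and that $R_\beta=\infty$ if and only if $\beta\le\beta_0$. A solution $u$ of $\Delta^2u=|x|^\alpha e^u$ is stable on a domain $\Omega\subset\mathbb{R}^N$ if $\int_\Omega|\Delta\phi|^2dx-\int_\Omega|x|^\alpha e^u\phi^2dx\ge0$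 for all $\phi\in C^2_c(\Omega)$; it is stable if stable on $\mathbb{R}^N$, and stable at infinity if stable on $\mathbb{R}^N\setminus K$ for some compact set $K$; unstable means not stable. $N_\alpha$ denotes the unique root in $(5,\infty)$ of the equation $\frac{N^2(N-4)^2}{16}=2(4+\alpha)(N-2)(N-4)$ (in the variable $N$). *)

(* Defs.v *)
From HB Require Import structures.
From mathcomp Require Import all_boot all_order all_algebra.
From mathcomp Require Import all_classical all_reals all_analysis.
Set Implicit Arguments. Unset Strict Implicit. Unset Printing Implicit Defensive.
Import Order.TTheory GRing.Theory Num.Theory.
Import numFieldNormedType.Exports.
Local Open Scope classical_set_scope.
Local Open Scope ring_scope.

Section Defs.
Variable R : realType.

Definition rlap (N : nat) (f : R -> R) (r : R) : R :=
  derive1n 2 f r + (N.-1)%:R / r * derive1 f r.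

(* u : [0,oo) -> R is an entire (R_beta = oo) radial solution of
   Delta^2 u = |x|^alpha e^u with u(0)=0, u'(0)=0, Delta u(0)=beta,
   (Delta u)'(0)=0 (the latter in the weak form r^(N-1) (Delta u)'(r) -> 0).  The ODE holds classically for r > 0; the initial
   conditions are one-sided limits at 0. *)
Definition entire_radial_sol (N : nat) (alpha beta : R) (u : R -> R) : Prop :=
  [/\ (forall r, 0 < r -> forall k, (k < 4)%N -> derivable (derive1n k u) r 1),
      (forall r, 0 < r -> rlap N (rlap N u) r = r `^ alpha * expR (u r)),
      u 0 = 0 /\ u r @[r --> 0^'+] --> 0,
      derive1 u r @[r --> 0^'+] --> 0 /\
      rlap N u r @[r --> 0^'+] --> beta &
      r ^+ N.-1 * derive1 (rlap N u) r @[r --> 0^'+] --> 0].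

Definition beta0 (N : nat) (alpha : R) : R :=
  sup [set b | exists u, entire_radial_sol N alpha b u].

(* N_alpha : the unique root in (5,oo) of N^2(N-4)^2/16 = 2(4+alpha)(N-2)(N-4) *)
Definition N_alpha (alpha : R) : R :=
  xget 0 [set n : R | 5 < n /\
     n ^+ 2 * (n - 4) ^+ 2 / 16 = 2 * (4 + alpha) * (n - 2) * (n - 4)].

Definition enorm (N : nat) (x : 'rV[R]_N) : R :=
  Num.sqrt (\sum_(i < N) x ord0 i ^+ 2).

(* iterated Lebesgue integral over R^n of a function of coordinates;
   for the nonnegative Borel integrands used below it equals the
   Lebesgue integral over R^n (Tonelli) *)
Fixpoint iint (n : nat) (f : (nat -> R) -> \bar R) (y : nat -> R) : \bar R :=
  match n with
  | 0 => f y
  | n'.+1 => (\int[@lebesgue_measure R]_(t in [set: R])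
                iint n' f (fun k => if k == n' then t else y k))%E
  end.

Definition integral_RN (N : nat) (g : 'rV[R]_N -> \bar R) : \bar R :=
  iint N (fun z => g (\row_(i < N) z (nat_of_ord i))) (fun _ => 0).

Definition evec (N : nat) (i : 'I_N) : 'rV[R]_N := delta_mx ord0 i.

Definition pderiv (N : nat) (i : 'I_N) (f : 'rV[R]_N -> R) : 'rV[R]_N -> R :=
  fun x => derive f x (evec i).

Definition laplacian (N : nat) (f : 'rV[R]_N -> R) : 'rV[R]_N -> R :=
  fun x => \sum_(i < N) pderiv i (pderiv i f) x.

Definition C2 (N : nat) (f : 'rV[R]_N -> R) : Prop :=
  [/\ continuous f,
      (forall i x, derivable f x (evec i)),
      (forall i, continuous (pderiv i f)),
      (forall i j x, derivable (pderiv i f) x (evec j)) &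
      (forall i j, continuous (pderiv j (pderiv i f)))].

Definition C2c (N : nat) (Omega : set 'rV[R]_N) (phi : 'rV[R]_N -> R) : Prop :=
  [/\ C2 phi, compact (closure [set x | phi x != 0])
    & closure [set x | phi x != 0] `<=` Omega].

Definition radial (N : nat) (u : R -> R) : 'rV[R]_N -> R := fun x => u (enorm x).

Definition stable_on (N : nat) (alpha : R) (U : 'rV[R]_N -> R)
    (Omega : set 'rV[R]_N) : Prop :=
  forall phi, C2c Omega phi ->
    (0 <= integral_RN (fun x => ((laplacian phi x) ^+ 2)%:E)
          - integral_RN (fun x => (enorm x `^ alpha * expR (U x) * phi x ^+ 2)%:E))%E.

Definition stable (N : nat) (alpha : R) (U : 'rV[R]_N -> R) : Prop :=
  stable_on alpha U [set: 'rV[R]_N].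

Definition stable_at_infinity (N : nat) (alpha : R) (U : 'rV[R]_N -> R) : Prop :=
  exists K : set 'rV[R]_N, compact K /\ stable_on alpha U (~` K).

End Defs.
Arguments radial {R} N u _.

(* Main.v *)
(* In the variable t = ln r the radial equation becomes an autonomous system for
   w = u + (4 + alpha) t, and the weight r^(4 + alpha) e^u is e^w. Its constant
   solution is e^w = Cs = 2 (4 + alpha)(N - 2)(N - 4), to be compared with the
   Rellich constant c^2 = N^2 (N - 4)^2 / 16; N_alpha is where they agree.

   Stability: if e^w <= c^2 everywhere, Rellich's inequality gives stability; if
   w <= C - k t near +oo, a Rellich inequality with a logarithmic remainder gives
   stability at infinity, also for N = 3, 4. Every entire solution has Delta u < 0
   (otherwise it blows up) and w bounded above. When Cs <= c^2 the linearization at the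
   constant solution has real roots, which forces e^w <= Cs. Solutions are ordered
   in beta with u_beta' - u_beta >= (beta' - beta) r^2 / (2 N), so below beta0 the
   solution decays like - r^2, while for N = 3, 4 all of them decay.

   Instability: for N = 3, 4 the constant 1, cut off at scale e^L, has energy
   O(1/L). For N >= 5 and beta = beta0, Delta u tends to 0, since otherwise monotone
   iteration yields an entire solution for a larger beta. Then e^w - Cs is the
   derivative of a bounded function, and r^(-(N-4)/2) psi((t - T)/L) is a
   destabilizing test function supported far away, because Cs > c^2.

   The set of beta with stable solutions is downward closed by the ordering and
   closed by continuous dependence; it contains very negative beta but not beta0,
   so beta1 is its maximum. *)
Require Import Defs.
From HB Require Import structures.
From mathcomp Require Import all_boot all_order all_algebra.
From mathcomp Require Import all_classical all_reals all_analysis.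
From mathcomp Require Import measurable_realfun ring lra.
Import Order.TTheory GRing.Theory Num.Theory.
Import numFieldNormedType.Exports.
Local Open Scope classical_set_scope.
Local Open Scope ring_scope.
Set Implicit Arguments. Unset Strict Implicit. Unset Printing Implicit Defensive.

(** The energies are iterated one-dimensional integrals, and for [alpha] < 0 the weight may be
    singular at the origin. Exact integrals [Iv] are therefore computed only for continuous
    compactly supported functions; the weight term is bounded from above by such a function or an
    increasing limit of them (stability), or from below by one of them (instability). Integration by
    parts has a single form, that a coordinate derivative has integral 0, so each Rellich inequality
    rests on a pointwise identity: the square of the Laplacian plus a divergence equals the weight
    term plus nonnegative terms. The sign of a radial integral is likewise found by comparison with
    a divergence, in place of polar coordinates.

    For the ODE all data sit at t = -oo. Solutions arise by monotone iteration: each iterate solves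
    a triangular linear system by four integrations from -oo, and pointwise monotone limits with
    local derivative bounds are again solutions. Solutions are ordered by a bootstrap from -oo for
    strictly different beta, so the set of stable parameters is defined by a condition on all
    solutions with that parameter. *)

Definition isd {R : realType} {V : normedModType R} (x v : V) (f : V -> R) (d : R) :=
  is_derive x v f d.

(** * Rules and tactics for directional derivatives and continuity *)

Section Derivation.
Context {R : realType} {V : normedModType R}.
Implicit Types (f g : V -> R) (x v : V) (d e : R).

Lemma isdE x v f d :
  isd x v f d <-> isd (0 : R) 1 (fun h : R => f (h *: v + x)) d.
Proof.
have E : (fun h : R => h^-1 *: ((f \o shift x) (h *: v) - f x)) =
  (fun h : R => h^-1 *: (((fun h : R => f (h *: v + x)) \o shift 0) (h *: 1)
                     - f (0 *: v + x))).
  by apply/funext => h /=; rewrite !addr0 scale0r add0r [h *: 1]mulr1.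
split=> -[D1 D2]; split.
- by rewrite /derivable -E.
- by rewrite -D2 /derive -E.
- by rewrite /derivable E.
- by rewrite -D2 /derive E.
Qed.

Lemma isd_eq x v f d e : isd x v f d -> d = e -> isd x v f e.
Proof. by move=> h <-. Qed.

Lemma isd_cst x v (c : R) : isd x v (fun _ => c) 0.
Proof. exact: is_derive_cst. Qed.

Lemma isdD x v f g d e : isd x v f d -> isd x v g e ->
  isd x v (fun y => f y + g y) (d + e).
Proof. exact: is_deriveD. Qed.

Lemma isdN x v f d : isd x v f d -> isd x v (fun y => - f y) (- d).
Proof. exact: is_deriveN. Qed.

Lemma isdM x v f g d e : isd x v f d -> isd x v g e ->
  isd x v (fun y => f y * g y) (f x * e + g x * d).
Proof. exact: is_deriveM. Qed.

Lemma isdX x v f n d : isd x v f d ->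
  isd x v (fun y => f y ^+ n) (n%:R * f x ^+ n.-1 * d).
Proof.
move=> h; have := is_deriveX n h.
by congr (is_derive _ _ _ _); apply/funext => y; rewrite exprfctE.
Qed.

Lemma isd_sum x v (n : nat) (F : 'I_n -> V -> R) (dF : 'I_n -> R) :
  (forall i, isd x v (F i) (dF i)) ->
  isd x v (fun y => \sum_(i < n) F i y) (\sum_(i < n) dF i).
Proof.
move=> h; have := is_derive_sum h.
by congr (is_derive _ _ _ _); apply/funext => y; rewrite fct_sumE.
Qed.

Lemma isd_outer x v (k : R -> R) f d e :
  isd (f x) 1 k e -> isd x v f d -> isd x v (fun y => k (f y)) (e * d).
Proof.
move=> hk /isdE hf; apply/isdE.
apply: (@is_derive1_comp R k (fun h : R => f (h *: v + x))) => //.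
by rewrite scale0r add0r.
Qed.

Lemma isd_near x v f g d : (\near x, f x = g x) -> isd x v f d -> isd x v g d.
Proof.
have [->|v0] := eqVneq v 0; last exact: near_eq_is_derive.
move=> _ [_ <-]; rewrite /isd.
have -> : 'D_0 f x = 0 by have [_ ->] := is_derive0 f x.
exact: is_derive0.
Qed.

Lemma isdV x v f d : f x != 0 -> isd x v f d ->
  isd x v (fun y => (f y)^-1) (- (f x) ^- 2 * d).
Proof.
move=> fx; apply: isd_outer.
have := @is_deriveV R id (f x) 1 1 fx (is_derive_id _ _).
by rewrite [_ *: 1]mulr1.
Qed.

Lemma isd_expR x v f d : isd x v f d ->
  isd x v (fun y => expR (f y)) (expR (f x) * d).
Proof. by apply: isd_outer; exact: is_derive_expR. Qed.

Lemma isd_ln x v f d : 0 < f x -> isd x v f d ->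
  isd x v (fun y => ln (f y)) ((f x)^-1 * d).
Proof. by move=> fx; apply: isd_outer; exact: is_derive1_ln. Qed.

Lemma isd_eta x v f d : isd x v f d -> isd x v (fun y => f y) d.
Proof. by []. Qed.

End Derivation.

Lemma isd_id {R : realType} (x : R) : isd x 1 (fun y => y) 1.
Proof. exact: is_derive_id. Qed.

Lemma isd_mull {R : realType} (c x : R) : isd x 1 ( *%R c) c.
Proof.
apply: isd_eq; first by apply: (isdM (isd_cst x 1 c) (isd_id x)).
by rewrite mulr1 mulr0 addr0.
Qed.

Lemma isd_addl {R : realType} (c x : R) : isd x 1 ( +%R c) 1.
Proof. by apply: isd_eq; [exact: (isdD (isd_cst x 1 c) (isd_id x))|rewrite add0r]. Qed.

Lemma isd_opp {R : realType} (x : R) : isd x 1 ( -%R) (-1).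
Proof. exact: isdN (isd_id x). Qed.

Definition hasd {R : realType} (F dF : R -> R) := forall t : R, isd t 1 F (dF t).

(** The rules for [isd] have explicit [fun y => ...] bodies, so that the shape of the function
    selects the rule. [der] leaves the side conditions of inverses and logarithms, then one goal:
    the computed derivative equals the announced one. *)
Ltac der_step :=
  match goal with
  | H : hasd ?u _ |- isd _ _ ?u _ => exact: (H _)
  | H : isd ?x _ ?u _ |- isd ?x _ ?u _ => exact: H
  | H : forall t, isd t _ ?u _ |- isd _ _ ?u _ => exact: (H _)
  | H : forall i t, isd t _ (?u i) _ |- isd _ _ (?u _) _ => exact: (H _ _)
  | |- isd _ _ (fun _ => ?c) _ => exact: isd_cst
  | |- isd _ _ (fun y => y) _ => exact: isd_id
  | |- isd _ _ (fun y => @?f y + @?g y) _ => apply: isdD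
  | |- isd _ _ (fun y => - @?f y) _ => apply: isdN
  | |- isd _ _ (fun y => @?f y * @?g y) _ => apply: isdM
  | |- isd _ _ (fun y => @?f y ^+ _) _ => apply: isdX
  | |- isd _ _ (fun y => (@?f y)^-1) _ => apply: isdV
  | |- isd _ _ (fun y => expR (@?f y)) _ => apply: isd_expR
  | |- isd _ _ (fun y => ln (@?f y)) _ => apply: isd_ln
  | |- isd _ _ (fun y => \sum_(i < _) @?F y i) _ => apply: isd_sum => ?
  | |- isd _ _ ( *%R _) _ => exact: isd_mull
  | |- isd _ _ ( +%R _) _ => exact: isd_addl
  | |- isd _ _ ( -%R) _ => exact: isd_opp
  | |- isd _ _ (fun y => ?u y) _ => apply: isd_eta
  end.
Ltac der := eapply isd_eq; [repeat der_step | cbv beta].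

Section Continuity.
Context {R : realType} {T : topologicalType}.
Implicit Types (f g : T -> R).

Lemma contD f g : continuous f -> continuous g -> continuous (fun x => f x + g x).
Proof. by move=> cf cg x; apply: cvgD; [exact: cf|exact: cg]. Qed.

Lemma contM f g : continuous f -> continuous g -> continuous (fun x => f x * g x).
Proof. by move=> cf cg x; apply: cvgM; [exact: cf|exact: cg]. Qed.

Lemma contN f : continuous f -> continuous (fun x => - f x).
Proof. by move=> cf x; apply: cvgN; exact: cf. Qed.

Lemma contV f : (forall x, f x != 0) -> continuous f -> continuous (fun x => (f x)^-1).
Proof. by move=> f0 cf x; apply: cvgV; [exact: f0|exact: cf]. Qed.

Lemma contX f n : continuous f -> continuous (fun x => f x ^+ n).
Proof.
move=> cf; elim: n => [|n IH].
  by under eq_fun do rewrite expr0; exact: cst_continuous.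
by under eq_fun do rewrite exprS; exact: contM.
Qed.

Lemma cont_comp f (k : R -> R) : continuous f -> continuous k -> continuous (fun x => k (f x)).
Proof. by move=> cf ck x; apply: continuous_comp; [exact: cf|exact: ck]. Qed.

Lemma cont_comp_at f (k : R -> R) : continuous f ->
  (forall x, {for f x, continuous k}) -> continuous (fun x => k (f x)).
Proof. by move=> cf ck x; apply: continuous_comp; [exact: cf|exact: ck]. Qed.

Lemma cont_sum (n : nat) (F : 'I_n -> T -> R) : (forall i, continuous (F i)) ->
  continuous (fun x => \sum_(i < n) F i x).
Proof.
elim: n F => [|n IH] F h.
  by under eq_fun do rewrite big_ord0; exact: cst_continuous.
by under eq_fun do rewrite big_ord_recr; apply: contD => //; exact: IH.
Qed.

Lemma cont_near f g x : nbhs x [set z | f z = g z] ->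
  {for x, continuous f} -> {for x, continuous g}.
Proof.
move=> fg cf; rewrite /prop_for /continuous_at -(nbhs_singleton fg).
by apply: cvg_trans cf; apply: near_eq_cvg.
Qed.

End Continuity.

Lemma id_cont {R : realType} : continuous (fun x : R => x).
Proof. by move=> x; exact: cvg_id. Qed.

Lemma mull_cont {R : realType} (c : R) : continuous ( *%R c).
Proof. exact: contM (@cst_continuous R R c) id_cont. Qed.

Lemma opp_cont {R : realType} : continuous ( -%R : R -> R).
Proof. exact: contN id_cont. Qed.

Lemma addl_cont {R : realType} (c : R) : continuous ( +%R c).
Proof. exact: contD (@cst_continuous R R c) id_cont. Qed.

Ltac cont_step :=
  match goal with
  | H : continuous ?f |- continuous ?f => exact: H
  | H : forall i, continuous (?f i) |- continuous (?f _) => exact: (H _)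
  | H : forall i j, continuous (?f i j) |- continuous (?f _ _) => exact: (H _ _)
  | |- continuous (fun _ => ?c) => exact: cst_continuous
  | |- continuous (fun x => x) => exact: id_cont
  | |- continuous ( *%R _) => exact: mull_cont
  | |- continuous ( -%R) => exact: opp_cont
  | |- continuous ( +%R _) => exact: addl_cont
  | |- continuous (fun x => @?f x + @?g x) => apply: contD
  | |- continuous (fun x => - @?f x) => apply: contN
  | |- continuous (fun x => @?f x * @?g x) => apply: contM
  | |- continuous (fun x => (@?f x)^-1) => apply: contV; [move=> ? | ]
  | |- continuous (fun x => @?f x ^+ _) => apply: contX
  | |- continuous (fun x => expR (@?f x)) => apply: cont_comp; [|exact: continuous_expR]
  | |- continuous (fun x => \sum_(i < _) @?F i x) => apply: cont_sum => ?
  | |- continuous (fun x => ?f x) => change (continuous f)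
  end.
Ltac cont := repeat cont_step.

(** * Monotonicity and limits at -oo for functions of one variable *)

Section OneVariable.
Context {R : realType}.
Implicit Types (f g F G u : R -> R) (t s l c : R).

Lemma der_cont F t d : isd t 1 F d -> {for t, continuous F}.
Proof. by move=> [h _]; apply/differentiable_continuous/derivable1_diffP. Qed.

Lemma hasd_cont F dF : hasd F dF -> continuous F.
Proof. by move=> h t; exact: der_cont (h t). Qed.

Lemma der_mvt F dF a b : hasd F dF -> a < b ->
  exists2 c, a < c < b & F b - F a = dF c * (b - a).
Proof.
move=> h ab; have cF : {within `[a, b], continuous F}.
  by apply: continuous_subspaceT => x; exact: der_cont (h x).
have [c cab E] := MVT ab (fun x _ => h x) cF.
by exists c => //; rewrite in_itv in cab.
Qed.

Lemma der_le F dF a b : hasd F dF ->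
  (forall t, a <= t -> t <= b -> 0 <= dF t) -> a <= b -> F a <= F b.
Proof.
move=> h p; rewrite le_eqVlt => /predU1P[->//|ab].
have [c /andP[ac cb] E] := der_mvt h ab.
by rewrite -subr_ge0 E mulr_ge0 ?subr_ge0 ?(ltW ab)// p ?ltW.
Qed.

Lemma der_le_nonneg F dF : hasd F dF ->
  (forall t, 0 <= dF t) -> {homo F : a b / a <= b}.
Proof. by move=> h p a b ab; apply: (der_le h). Qed.

(** Under t = ln r the data at r = 0 become limits at -oo. The epsilon form hands explicit
    thresholds to later estimates; [limNyP] converts it to filters for limit algebra. *)
Definition limNy F l := forall e, 0 < e -> exists T, forall t, t <= T -> `|F t - l| <= e.

Lemma limNyP F l : limNy F l <-> F t @[t --> -oo] --> l.
Proof.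
split=> [h|/cvgrPdist_le h e e0].
  apply/cvgrPdist_le => e e0; have [T hT] := h e e0.
  near=> t; rewrite distrC; apply: hT; near: t.
  exact: nbhs_ninfty_le (num_real T).
have [T [_ hT]] := h e e0.
by exists (T - 1) => t tT; rewrite distrC; apply: hT; lra.
Unshelve. all: by end_near. Qed.

Lemma limNy_cst c : limNy (fun _ => c) c.
Proof. by move=> e e0; exists 0 => t _; rewrite subrr normr0 ltW. Qed.

Lemma limNyD F G l c : limNy F l -> limNy G c -> limNy (fun t => F t + G t) (l + c).
Proof. by rewrite !limNyP => h k; apply: cvgD. Qed.
Lemma limNyN F l : limNy F l -> limNy (fun t => - F t) (- l).
Proof. by rewrite !limNyP => h; apply: cvgN. Qed.
Lemma limNyB F G l c : limNy F l -> limNy G c -> limNy (fun t => F t - G t) (l - c).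
Proof. by move=> h k; apply: limNyD => //; exact: limNyN. Qed.
Lemma limNyM F G l c : limNy F l -> limNy G c -> limNy (fun t => F t * G t) (l * c).
Proof. by rewrite !limNyP => h k; apply: cvgM. Qed.

Lemma limNy_ge F l c T : limNy F l -> (forall t, t <= T -> c <= F t) -> c <= l.
Proof.
move=> h p; apply/ler_addgt0Pr => e e0; have [S hS] := h e e0.
have := hS (Num.min S T); have := p (Num.min S T).
rewrite !ge_min !lexx ?orbT => /(_ isT) a /(_ isT).
rewrite ler_norml => /andP[_]; lra.
Qed.
Lemma limNy_le F l c T : limNy F l -> (forall t, t <= T -> F t <= c) -> l <= c.
Proof.
move=> /limNyN h p; rewrite -lerN2; apply: (limNy_ge (T := T) h) => t tT.
by rewrite lerN2 p.
Qed.

Lemma limNy_eq F l l' : limNy F l -> l = l' -> limNy F l'.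
Proof. by move=> h <-. Qed.

Lemma limNy_squeeze F G H l : limNy F l -> limNy H l ->
  (exists T, forall t, t <= T -> F t <= G t <= H t) -> limNy G l.
Proof.
move=> f h [T p] e e0; have [T1 h1] := f e e0; have [T2 h2] := h e e0.
exists (Num.min T (Num.min T1 T2)) => t; rewrite !le_min => /and3P[/p/andP[a b]].
move=> /h1 + /h2; rewrite !ler_norml => /andP[? ?] /andP[? ?].
by apply/andP; split; lra.
Qed.

Lemma limNy_expR c : 0 < c -> limNy (fun t => expR (c * t)) 0.
Proof.
move=> c0 e e0; exists (ln e / c) => t; rewrite ler_pdivlMr// mulrC => h.
by rewrite subr0 ger0_norm ?expR_ge0// -[leRHS]lnK ?posrE// ler_expR.
Qed.

(** Plays the role of integration from the origin in r: a nondecreasing function lies above its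
    limit at -oo. *)
Lemma der_ge_lim F dF l t : hasd F dF ->
  (forall s, s <= t -> 0 <= dF s) -> limNy F l -> l <= F t.
Proof.
move=> h p /limNy_le; apply => s; apply: (der_le h) => r _; exact: p.
Qed.

Lemma der_gt_lim F dF l t : hasd F dF ->
  (forall s, s <= t -> 0 < dF s) -> limNy F l -> l < F t.
Proof.
move=> h p k; have p' s : s <= t - 1 -> 0 <= dF s by move=> st; apply/ltW/p; lra.
(* Weak monotonicity up to t - 1, then strict increase over the last unit interval. *)
apply: le_lt_trans (der_ge_lim h p' k) _.
have [|c /andP[c1 c2] E] := der_mvt h (a := t - 1) (b := t); first by lra.
rewrite -subr_gt0 E mulr_gt0//; last by lra.
by apply: p; lra.
Qed.

Lemma der_le_lim F dF l t : hasd F dF ->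
  (forall s, s <= t -> dF s <= 0) -> limNy F l -> F t <= l.
Proof.
move=> h p k; rewrite -lerN2; apply: (@der_ge_lim (fun t => - F t) (fun t => - dF t)).
- by move=> s; der.
- by move=> s st; rewrite oppr_ge0 p.
- exact: limNyN.
Qed.

Lemma der_lt_lim F dF l t : hasd F dF ->
  (forall s, s <= t -> dF s < 0) -> limNy F l -> F t < l.
Proof.
move=> h p k; rewrite -ltrN2; apply: (@der_gt_lim (fun t => - F t) (fun t => - dF t)).
- by move=> s; der.
- by move=> s st; rewrite oppr_gt0 p.
- exact: limNyN.
Qed.

End OneVariable.

(** * Primitives on the whole line and primitives vanishing at -oo *)

Section Primitive.
Context {R : realType}.
Implicit Types (f h F G H : R -> R) (a b c t : R).

Lemma der_cst_itv F G h a b : hasd F h ->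
  (forall t, a < t -> t < b -> isd t 1 G (h t)) ->
  forall s t, a < s -> s < b -> a < t -> t < b -> G t - F t = G s - F s.
Proof.
move=> hF hG.
suff W s t : s < t -> a < s -> t < b -> G t - F t = G s - F s.
  move=> s t as_ sb at_ tb; have [st|ts|->//] := ltgtP s t; first exact: W.
  by symmetry; exact: W.
move=> st as_ tb.
pose D t := G t - F t.
have hD r : r \in `]s, t[ -> isd r 1 D 0.
  rewrite in_itv /= => /andP[sr rt].
  have hr : isd r 1 G (h r) by apply: hG; lra.
  by rewrite /D; der; rewrite subrr.
have cD : {within `[s, t], continuous D}.
  apply: derivable_within_continuous => r; rewrite in_itv /= => /andP[sr rt].
  have hr : isd r 1 G (h r) by apply: hG; lra.
  have : isd r 1 D (h r - h r) by rewrite /D; der.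
  by case.
by have [c _] := MVT st hD cD; rewrite mul0r => /eqP; rewrite subr_eq0 => /eqP.
Qed.

Lemma primitive_itv h a b : continuous h -> a < b -> exists F,
  forall t, a < t -> t < b -> isd t 1 F (h t).
Proof.
move=> ch ab.
have ih : (@lebesgue_measure R).-integrable `[a, b] (EFin \o h).
  apply: continuous_compact_integrable; first exact: segment_compact.
  exact: continuous_subspaceT.
exists (fun x => \int[@lebesgue_measure R]_(t in `[a, x]) h t).
move=> t at_ tb; have [d e] := continuous_FTC1_closed tb ih at_ (ch t).
by split; [exact: d | rewrite -derive1E; exact: e].
Qed.

(** The fundamental theorem gives a primitive on each bounded interval. Normalized at 0, the
    primitives on (-n-1, n+1) agree where they overlap, so taking n = trunc |t| at the point t glues
    them into a global one. *)
Lemma primitive h : continuous h -> exists2 F, hasd F h & F 0 = 0.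
Proof.
move=> ch.
have /choice[F hF] (n : nat) : exists F : R -> R, F 0 = 0 /\
    forall t, - n.+1%:R < t -> t < n.+1%:R -> isd t 1 F (h t).
  have [|F hF] := @primitive_itv h (- n.+1%:R) n.+1%:R ch.
    by have : 0 < n.+1%:R :> R by []; lra.
  exists (fun t => F t - F 0); split; first exact: subrr.
  by move=> t t1 t2; have ht := hF t t1 t2; der; rewrite ?oppr0 ?addr0 ?subr0.
pose N (t : R) := Num.trunc `|t|.
have Nlt t : `|t| < (N t).+1%:R.
  by have /andP[] := truncn_itv (normr_ge0 t).
have eqF n m t : (n <= m)%N -> `|t| < n.+1%:R -> F n t = F m t.
  move=> nm; rewrite ltr_norml => /andP[t1 t2].
  have nm' : n.+1%:R <= m.+1%:R :> R by rewrite ler_nat.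
  have n0 : 0 < n.+1%:R :> R by [].
  have [s0 s1] : - n.+1%:R < (0:R) /\ (0:R) < n.+1%:R by split; lra.
  pose D r := F n r - F m r.
  have hD (r : R) : - n.+1%:R < r -> r < n.+1%:R -> isd r 1 D 0.
    move=> r1 r2; have A := (hF n).2 r r1 r2.
    have B : isd r 1 (F m) (h r) by apply: (hF m).2; lra.
    by rewrite /D; der; rewrite subrr.
  have h0 : hasd (fun=> 0 : R) (fun=> 0) by move=> r; exact: isd_cst.
  have := der_cst_itv h0 hD s0 s1 t1 t2.
  by rewrite /D (hF n).1 (hF m).1 !subr0 => /eqP; rewrite subr_eq0 => /eqP.
exists (fun t => F (N t) t); last by rewrite (hF _).1.
(* One index above [N t], so that a whole neighborhood of t lies in the domain of [F n]. *)
move=> t; pose n := (N t).+1.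
have tn : `|t| + 1 < n.+1%:R by have := Nlt t; rewrite /n -[in ltRHS]addn1 natrD; lra.
have hn : isd t 1 (F n) (h t).
  by apply: (hF n).2; have := ler_norm t; have := ler_norm (- t); rewrite normrN; lra.
apply: isd_near hn.
near=> s.
have sn : `|s| < n.+1%:R.
  apply: le_lt_trans tn; rewrite -[s](subrK t) addrC (le_trans (ler_normD _ _))//.
  by rewrite lerD2l distrC; near: s; apply: cvgr_dist_le.
have [le|/ltnW le] := leqP n (N s); first by exact: eqF.
by symmetry; apply: eqF => //.
Unshelve. all: by end_near. Qed.

Lemma nondecreasing_limNy F T m : {in <= T &, {homo F : a b / a <= b}} ->
  (forall t, t <= T -> m <= F t) -> exists l, limNy F l.
Proof.
move=> ndF mF; pose A := [set F t | t in [set t | t <= T]].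
have lA : has_lbound A by exists m => _ [t tT <-]; exact: mF.
have iA : has_inf A by split => //; exists (F T); exists T => //=.
exists (inf A) => e e0; have [_ [t0 /= t0T <-] ht0] := inf_adherent e0 iA.
exists t0 => t tt0; have tT : t <= T := le_trans tt0 t0T.
have h1 : inf A <= F t by apply: ge_inf => //; exists t.
have h2 : F t <= F t0 by apply: ndF.
by rewrite ger0_norm; lra.
Qed.

(** The derivative of C/g e^(g t) dominates |h|, so adding it to a primitive gives an increasing
    function and subtracting it a decreasing one. This traps the primitive, which converges at -oo
    and is shifted to limit 0. *)
Lemma primitive_limNy h g C T : continuous h -> 0 < g ->
  (forall t, t <= T -> `|h t| <= C * expR (g * t)) ->
  exists2 F, hasd F h & limNy F 0.
Proof.
move=> ch g0 hb; have [F hF _] := primitive ch.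
have hE : hasd (fun t => C / g * expR (g * t)) (fun t => C * expR (g * t)).
  by move=> t; der; field; rewrite gt_eqF.
have lE : limNy (fun t => C / g * expR (g * t)) 0.
  rewrite -(mulr0 (C / g)); apply: limNyM; first exact: limNy_cst.
  exact: limNy_expR.
have hP : hasd (fun t => F t + C / g * expR (g * t)) (fun t => h t + C * expR (g * t)).
  by move=> t; der.
have hM : hasd (fun t => F t - C / g * expR (g * t)) (fun t => h t - C * expR (g * t)).
  by move=> t; der.
have C0 t : t <= T -> 0 <= C / g * expR (g * t).
  move=> /hb /(le_trans (normr_ge0 _)) h0.
  rewrite -(pmulr_rge0 _ g0); apply: le_trans h0 _; rewrite le_eqVlt; apply/orP; left.
  by apply/eqP; field; rewrite gt_eqF.
have [l hl] : exists l, limNy (fun t => F t + C / g * expR (g * t)) l.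
  apply: (@nondecreasing_limNy _ T (F T - C / g * expR (g * T))).
  - move=> a b aT bT ab; apply: (der_le hP) => // t _ tb.
    have := hb t (le_trans tb bT); rewrite ler_norml => /andP[]; lra.
  - move=> t tT; apply: (@le_trans _ _ (F t - C / g * expR (g * t))).
      rewrite -lerN2; apply: (@der_le _ (fun t => - (F t - C / g * expR (g * t)))
         (fun t => - (h t - C * expR (g * t))) t T) => //.
        by move=> s; have := hM s => hs; der.
      move=> s _ sT; have := hb s sT; rewrite ler_norml => /andP[]; lra.
    by have := C0 t tT; lra.
exists (fun t => F t - l).
  by move=> t; der; rewrite ?oppr0 ?addr0 ?subr0.
have -> : (fun t => F t - l) =
  (fun t => (F t + C / g * expR (g * t)) - C / g * expR (g * t) - l).
  by apply/funext => t; rewrite addrK.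
apply: limNy_eq; first by apply: limNyB; [apply: limNyB hl lE | exact: limNy_cst].
by rewrite subr0 subrr.
Qed.

End Primitive.

(** * Iterated integrals of compactly supported functions *)

Section IteratedIntegral.
Context {R : realType}.
Notation leb := (@lebesgue_measure R).
Implicit Types (f g : (nat -> R) -> R) (y z : nat -> R) (h H : R -> R) (M e : R).

(** The integral of a nonnegative function is a supremum over the simple functions below it, hence
    monotone for arbitrary functions. This is what permits comparisons with the weight term. *)
Lemma ge0_le_integralT (f1 f2 : R -> \bar R) : (forall x, 0 <= f1 x)%E ->
  (forall x, f1 x <= f2 x)%E ->
  (\int[leb]_(x in [set: R]) f1 x <= \int[leb]_(x in [set: R]) f2 x)%E.
Proof.
move=> f0 f12; rewrite !ge0_integralTE//; last by move=> x; apply: le_trans (f12 x).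
apply: le_ereal_sup => _ [k /= kf <-]; exists k => //= x.
exact: le_trans (f12 x).
Qed.

Lemma integral_csupp h H a b : continuous h -> hasd H h -> a < b ->
  (forall t, t < a \/ b < t -> h t = 0) ->
  (\int[leb]_(t in [set: R]) (h t)%:E = (H b - H a)%:E)%E.
Proof.
move=> ch hH ab h0.
have cH x : {for x, continuous H} by exact: der_cont (hH x).
rewrite EFinB -(@continuous_FTC2 _ h H a b ab).
- rewrite [RHS]integral_mkcond; apply: eq_integral => t _.
  rewrite patchE; case: ifPn => // /negP tab; rewrite h0//.
  have [ta|ta] := ltP t a; first by left.
  right; rewrite ltNge; apply/negP => tb; apply: tab.
  by rewrite inE /= in_itv /= ta tb.
- exact: continuous_subspaceT.
- split; first by move=> x _; case: (hH x).
  + exact/cvg_at_right_filter/cH.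
  + exact/cvg_at_left_filter/cH.
- by move=> x _; rewrite derive1E; case: (hH x).
Qed.

Definition upd y (i : nat) (t : R) : nat -> R := fun k => if k == i then t else y k.

Lemma upd_id y i t s : upd (upd y i t) i s = upd y i s.
Proof. by apply/funext => k; rewrite /upd; case: eqP. Qed.

Lemma updC y i j t s : i != j -> upd (upd y i t) j s = upd (upd y j s) i t.
Proof.
move=> ij; apply/funext => k; rewrite /upd; case: eqP => // ->.
by rewrite eq_sym (negbTE ij).
Qed.

(** Real-valued counterpart of one layer of [iint]. On the class [ucs] the layer is finite, so
    [fine] loses nothing ([iint_RI]). *)
Definition stepint (i : nat) f y : R := fine (\int[leb]_(t in [set: R]) (f (upd y i t))%:E)%E.

Fixpoint RI (k : nat) f : (nat -> R) -> R :=
  if k is j.+1 then stepint j (RI j f) else f.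

Variable N : nat.

(** A point of R^N is carried by a sequence; continuity is measured in the entries below [N], the
    only ones that represent coordinates. *)
Definition ucont f := forall e, 0 < e -> exists2 d, 0 < d &
  forall y z, (forall k, (k < N)%N -> `|y k - z k| <= d) -> `|f y - f z| <= e.

(** The index [j] counts the coordinates already integrated out; the support condition can only
    concern the remaining ones. *)
Definition bsupp (j : nat) (M : R) f :=
  forall y k, (j <= k < N)%N -> M < `|y k| -> f y = 0.

Definition ucs j M f := ucont f /\ bsupp j M f.

Lemma ucs_slice j M f i y : ucs j M f -> (j <= i < N)%N ->
  continuous (fun t => f (upd y i t)) /\
  forall t, t < - M \/ M < t -> f (upd y i t) = 0.
Proof.
move=> [uf bf] ji; split.
  move=> t; apply/cvgrPdist_le => e e0; have [d d0 hd] := uf e e0.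
  near=> s; apply: hd => k kN; rewrite /upd; case: eqP => _.
    near: s; exact: cvgr_dist_le.
  by rewrite subrr normr0 ltW.
move=> t tM; apply: (bf _ i) => //; rewrite /upd eqxx.
by rewrite ltr_normr; case: tM => ?; apply/orP; [right|left]; lra.
Unshelve. all: by end_near. Qed.

Lemma stepint_spec j M f i y : 0 < M -> ucs j M f -> (j <= i < N)%N ->
  exists2 H, hasd H (fun t => f (upd y i t)) &
    (\int[leb]_(t in [set: R]) (f (upd y i t))%:E = (H M - H (- M))%:E)%E /\
    stepint i f y = H M - H (- M).
Proof.
move=> M0 uf ji; have [cf sf] := ucs_slice y uf ji.
have [H hH _] := primitive cf; exists H => //.
have E : (\int[leb]_(t in [set: R]) (f (upd y i t))%:E = (H M - H (- M))%:E)%E.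
  by apply: (integral_csupp cf hH) => //; lra.
by split=> //; rewrite /stepint E.
Qed.

(* The three inputs are combined so that linearity, monotonicity and all
   perturbation bounds of the inner integral are instances of one estimate. *)
Lemma stepint_comb j M f1 f2 f3 i y1 y2 y3 c2 c3 e : 0 < M ->
  ucs j M f1 -> ucs j M f2 -> ucs j M f3 -> (j <= i < N)%N ->
  (forall t, f1 (upd y1 i t) + c2 * f2 (upd y2 i t) + c3 * f3 (upd y3 i t) <= e) ->
  stepint i f1 y1 + c2 * stepint i f2 y2 + c3 * stepint i f3 y3 <= 2 * M * e.
Proof.
move=> M0 u1 u2 u3 ji le.
have [H1 h1 [_ ->]] := stepint_spec y1 M0 u1 ji.
have [H2 h2 [_ ->]] := stepint_spec y2 M0 u2 ji.
have [H3 h3 [_ ->]] := stepint_spec y3 M0 u3 ji.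
pose D t := e * t - (H1 t + c2 * H2 t + c3 * H3 t).
have hD : hasd D (fun t => e - (f1 (upd y1 i t) + c2 * f2 (upd y2 i t) + c3 * f3 (upd y3 i t))).
  by move=> t; rewrite /D; der; ring.
have := @der_le_nonneg _ _ _ hD _ (- M) M; rewrite /D.
have W : forall t, 0 <= e - (f1 (upd y1 i t) + c2 * f2 (upd y2 i t) + c3 * f3 (upd y3 i t)).
  by move=> t; rewrite subr_ge0.
have MM : - M <= M by lra.
by move=> /(_ W MM); lra.
Qed.

Lemma ucs0 j M : ucs j M (fun _ => 0).
Proof. by split=> // e e0; exists 1 => // y z _; rewrite subrr normr0 ltW. Qed.

Lemma ucsD j M f g c : ucs j M f -> ucs j M g -> ucs j M (fun y => f y + c * g y).
Proof.
move=> [uf bf] [ug bg]; split=> [e e0|y k jk yk]; last first.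
  by rewrite (bf y k) ?(bg y k)// mulr0 addr0.
have c1 : 0 < `|c| + 1 by rewrite ltr_wpDl.
have [d d0 hd] := uf (e / 2) ltac:(lra).
have [d' d'0 hd'] := ug (e / 2 / (`|c| + 1)) ltac:(by rewrite divr_gt0//; lra).
exists (Num.min d d'); first by rewrite lt_min d0.
move=> y z h; have A : `|f y - f z| <= e / 2.
  by apply: hd => k /h; rewrite le_min => /andP[].
have B : `|g y - g z| <= e / 2 / (`|c| + 1).
  by apply: hd' => k /h; rewrite le_min => /andP[].
have -> : f y + c * g y - (f z + c * g z) = (f y - f z) + c * (g y - g z) by ring.
apply: le_trans (ler_normD _ _) _; rewrite normrM.
have C : `|c| * `|g y - g z| <= e / 2.
  apply: le_trans (ler_wpM2l (normr_ge0 _) B) _.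
  by rewrite mulrCA ger_pMr ?ltr_pdivrMr//; [rewrite ler_pdivrMr//; lra | lra].
lra.
Qed.

Lemma stepint_bound j M f g i y z e : 0 < M -> ucs j M f -> ucs j M g ->
  (j <= i < N)%N -> (forall t, `|f (upd y i t) - g (upd z i t)| <= e) ->
  `|stepint i f y - stepint i g z| <= 2 * M * e.
Proof.
move=> M0 uf ug ji le; rewrite ler_norml; apply/andP; split.
  have := @stepint_comb j M g f (fun=> 0) i z y y (-1) 0 e M0 ug uf (ucs0 _ _) ji.
  rewrite !mul0r !mulN1r !addr0 => H; rewrite lerNl opprB; apply: H => t.
  by rewrite ?mul0r ?mulN1r ?addr0; have := le t; rewrite ler_norml => /andP[]; lra.
have := @stepint_comb j M f g (fun=> 0) i y z y (-1) 0 e M0 uf ug (ucs0 _ _) ji.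
rewrite !mul0r !mulN1r !addr0; apply => t.
by rewrite ?mul0r ?mulN1r ?addr0; have := le t; rewrite ler_norml => /andP[]; lra.
Qed.

Lemma ucs_stepint M f i : 0 < M -> (i < N)%N -> ucs i M f -> ucs i.+1 M (stepint i f).
Proof.
move=> M0 iN uf; have ii : (i <= i < N)%N by rewrite leqnn.
split=> [e e0|y k /andP[ik kN] yk].
  have [d d0 hd] := uf.1 (e / (2 * M)) ltac:(by rewrite divr_gt0//; lra).
  exists d => // y z h.
  have -> : e = 2 * M * (e / (2 * M)) by field; lra.
  apply: (stepint_bound M0 uf uf ii) => t; apply: hd => k kN.
  rewrite /upd; case: eqP => _; last exact: h.
  by rewrite subrr normr0 ltW.
rewrite /stepint (_ : (fun t => _) = cst 0%E) ?integral0//.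
apply/funext => t; congr EFin; apply: (uf.2 _ k).
  by rewrite kN (ltnW ik).
by rewrite /upd gtn_eqF.
Qed.

Lemma ucs_RI M f k : 0 < M -> (k <= N)%N -> ucs 0 M f -> ucs k M (RI k f).
Proof.
move=> M0; elim: k => //= k IH kN uf.
by apply: ucs_stepint => //; apply: IH => //; exact: ltnW.
Qed.

Lemma iint_RI M f k y : 0 < M -> (k <= N)%N -> ucs 0 M f ->
  iint k (fun z => (f z)%:E) y = (RI k f y)%:E.
Proof.
move=> M0; elim: k y => //= k IH y kN uf.
have uk : ucs k M (RI k f) by apply: ucs_RI => //; exact: ltnW.
have kk : (k <= k < N)%N by rewrite leqnn.
have [H _ [E1 E2]] := stepint_spec y M0 uk kk.
rewrite E2 -E1; apply: eq_integral => t _.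
by rewrite (IH (upd y k t)) //; exact: ltnW.
Qed.

Lemma RI_lin M f g c k y : 0 < M -> (k <= N)%N -> ucs 0 M f -> ucs 0 M g ->
  RI k (fun z => f z + c * g z) y = RI k f y + c * RI k g y.
Proof.
move=> M0; elim: k y => //= k IH y kN uf ug.
have kN' : (k <= N)%N by exact: ltnW.
have kk : (k <= k < N)%N by rewrite leqnn.
have uk := ucs_RI M0 kN' uf; have vk := ucs_RI M0 kN' ug.
have wk := ucs_RI M0 kN' (ucsD c uf ug).
apply/eqP; rewrite eq_le; apply/andP; split; rewrite -subr_le0.
  have := stepint_comb (y1 := y) (y2 := y) (y3 := y) (c2 := -1) (c3 := -c) (e := 0) M0 wk uk vk kk.
  rewrite mulr0 mulN1r mulNr opprD addrA; apply => t.
  by rewrite IH//; lra.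
have := stepint_comb (y1 := y) (y2 := y) (y3 := y) (c2 := c) (c3 := -1) (e := 0) M0 uk vk wk kk.
rewrite mulr0 mulN1r; apply => t.
by rewrite IH//; lra.
Qed.

Lemma RI_ge0 M f k y : 0 < M -> (k <= N)%N -> ucs 0 M f ->
  (forall z, 0 <= f z) -> 0 <= RI k f y.
Proof.
move=> M0; elim: k y => //= k IH y kN uf f0.
have kN' : (k <= N)%N by exact: ltnW.
have kk : (k <= k < N)%N by rewrite leqnn.
have uk := ucs_RI M0 kN' uf.
have := stepint_comb (y1 := y) (y2 := y) (y3 := y) (c2 := -1) (c3 := 0) (e := 0) M0 (ucs0 _ _) uk (ucs0 _ _) kk.
rewrite {1 3}/stepint (_ : (fun t => _) = cst 0%E) ?integral0//=.
rewrite mul0r mulr0 add0r addr0 mulN1r oppr_le0; apply => t.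
by rewrite ?add0r ?mul0r ?addr0 ?mulN1r oppr_le0 IH.
Qed.

(** Positivity at one point climbs through the layers: by uniform continuity the inner integral
    keeps half of its value on a short interval next to [z k], and integration over that interval is
    positive. *)
Lemma RI_gt0 M f k y z : 0 < M -> (k <= N)%N -> ucs 0 M f ->
  (forall z, 0 <= f z) -> (forall j, (k <= j)%N -> z j = y j) -> 0 < f z ->
  0 < RI k f y.
Proof.
move=> M0; elim: k y => [|k IH] y kN uf f0 zy fz /=.
  by have -> : y = z; [apply/funext => j; rewrite zy|].
have kN' : (k <= N)%N by exact: ltnW.
have kk : (k <= k < N)%N by rewrite leqnn.
have uk := ucs_RI M0 kN' uf.
have [H hH [_ ->]] := stepint_spec y M0 uk kk.
have [cs ss] := ucs_slice y uk kk.
have pos : 0 < RI k f (upd y k (z k)).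
  apply: IH => // j kj; rewrite /upd; case: eqP => [->//|/eqP jk].
  by rewrite zy// ltn_neqAle eq_sym jk.
have yM : - M <= z k <= M.
  rewrite leNgt [X in _ && X]leNgt -negb_or; apply/negP => /orP yM.
  by move: pos; rewrite ss ?ltxx.
have ge0 t : 0 <= RI k f (upd y k t) by exact: (RI_ge0 _ M0).
set c := RI k f _ in pos.
have [d d0 hd] : exists2 d, 0 < d & forall t, `|t - z k| <= d -> c / 2 <= RI k f (upd y k t).
  have c20 : 0 < c / 2 by lra.
  have [d d0 hd] := uk.1 _ c20; exists d => // t td.
  have : `|c - RI k f (upd y k t)| <= c / 2.
    by apply: hd => j _; rewrite /upd; case: eqP => [_|_]; rewrite 1?distrC// subrr normr0 ltW.
  by rewrite ler_norml => /andP[]; lra.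
have mono := der_le_nonneg hH ge0.
(* The interval points from [z k] towards 0, so that it stays inside [-M, M]. *)
have [a [b [Ma ab bM near]]] : exists a b, [/\ - M <= a, a < b, b <= M &
    forall t, a <= t -> t <= b -> `|t - z k| <= d].
  case/andP: yM => y1 y2; have [y3|y3] := leP (z k) 0.
    exists (z k), (Num.min (z k + d) M); split => //.
    - by rewrite lt_min; apply/andP; split; lra.
    - by rewrite ge_min lexx orbT.
    - by move=> t t1; rewrite le_min => /andP[t2 _]; rewrite ger0_norm; lra.
  exists (Num.max (z k - d) (- M)), (z k); split => //.
  - by rewrite le_max lexx orbT.
  - by rewrite gt_max; apply/andP; split; lra.
  - by move=> t; rewrite ge_max => /andP[t1 _] t2; rewrite ler0_norm; lra.
have [r /andP[ar rb] E] := der_mvt hH ab.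
have := hd r (near r (ltW ar) (ltW rb)).
have := mono _ _ Ma; have := mono _ _ bM.
suff : 0 < H b - H a by lra.
by rewrite E mulr_gt0//; [have := hd r (near r (ltW ar) (ltW rb)); lra | lra].
Qed.

Lemma iint_le (f g : (nat -> R) -> \bar R) k y :
  (forall z, 0 <= f z)%E -> (forall z, f z <= g z)%E ->
  (0 <= iint k f y /\ iint k f y <= iint k g y)%E.
Proof.
move=> f0 fg; elim: k y => [|k IH] y /=; first by split.
split; first by apply: integral_ge0 => t _; case: (IH (upd y k t)).
by apply: ge0_le_integralT => t; case: (IH (upd y k t)).
Qed.

(** Monotone convergence, layer by layer. The limit may be infinite at some points, which is how a
    weight singular at the origin is reached. *)
Lemma iint_limn M (f : nat -> (nat -> R) -> R) k y : 0 < M -> (k <= N)%N ->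
  (forall n, ucs 0 M (f n)) -> (forall n z, 0 <= f n z) ->
  (forall z, {homo f ^~ z : n m / (n <= m)%N >-> n <= m}) ->
  iint k (fun z => limn (fun n => (f n z)%:E)) y = limn (fun n => (RI k (f n) y)%:E).
Proof.
move=> M0; elim: k y => //= k IH y kN uf f0 nd.
have kN' : (k <= N)%N by exact: ltnW.
have kk : (k <= k < N)%N by rewrite leqnn.
have uk n : ucs k M (RI k (f n)) := ucs_RI M0 kN' (uf n).
under eq_integral => t _ do rewrite (IH (upd y k t) kN' uf f0 nd).
rewrite monotone_convergence//.
- congr (limn _); apply/funext => n.
  by have [H _ [-> ->]] := stepint_spec y M0 (uk n) kk.
- move=> n; have [cn _] := ucs_slice y (uk n) kk.
  have mn := continuous_measurable_fun cn.
  have mE := (measurable_EFinP setT (fun t => RI k (f n) (upd y k t))).2 mn.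
  exact: mE.
- by move=> n t _; rewrite lee_fin; apply: (RI_ge0 _ M0).
- move=> t _ n m nm; rewrite lee_fin -subr_ge0 -mulN1r -(RI_lin _ _ M0)//.
  apply: (RI_ge0 _ M0) => //; first exact: ucsD.
  by move=> z; rewrite mulN1r subr_ge0 nd.
Qed.

(* Uniform differentiability in the i-th coordinate survives integration over
   the other coordinates, which replaces differentiation under the integral. *)
Definition udiff (i : nat) f g := forall e, 0 < e -> exists2 d, 0 < d &
  forall y (h : R), `|h| <= d -> `|f (upd y i (y i + h)) - f y - h * g y| <= e * `|h|.

Lemma udiff_stepint M f g i j : 0 < M -> ucs j M f -> ucs j M g ->
  (j < N)%N -> i != j -> udiff i f g -> udiff i (stepint j f) (stepint j g).
Proof.
move=> M0 uf ug jN ij ud e e0; have jj : (j <= j < N)%N by rewrite leqnn.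
have [d d0 hd] := ud (e / (2 * M)) ltac:(by rewrite divr_gt0//; lra).
exists d => // y h hh.
have -> : e * `|h| = 2 * M * (e / (2 * M) * `|h|) by field; lra.
have K t : `|f (upd (upd y i (y i + h)) j t) - f (upd y j t) - h * g (upd y j t)| <=
      e / (2 * M) * `|h|.
  have := hd (upd y j t) h hh.
  have E : upd y j t i = y i by rewrite /upd (negbTE ij).
  by rewrite E (updC y t _ (_ : j != i)) 1?eq_sym.
rewrite ler_norml; apply/andP; split.
  have := stepint_comb (y1 := y) (y2 := upd y i (y i + h)) (y3 := y) (c2 := -1) (c3 := h)
    (e := e / (2 * M) * `|h|) M0 uf uf ug jj.
  rewrite mulN1r => H; suff : stepint j f y - stepint j f (upd y i (y i + h)) +
    h * stepint j g y <= 2 * M * (e / (2 * M) * `|h|) by lra.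
  by apply: H => t; rewrite mulN1r; have := K t; rewrite ler_norml => /andP[]; lra.
have := stepint_comb (y1 := upd y i (y i + h)) (y2 := y) (y3 := y) (c2 := -1) (c3 := -h)
    (e := e / (2 * M) * `|h|) M0 uf uf ug jj.
rewrite mulN1r mulNr; apply => t.
by rewrite mulN1r mulNr; have := K t; rewrite ler_norml => /andP[]; lra.
Qed.

Lemma udiff_slice i f g y : udiff i f g ->
  hasd (fun t => f (upd y i t)) (fun t => g (upd y i t)).
Proof.
move=> ud t; have L : (fun h : R => h^-1 *: (((fun t => f (upd y i t)) \o shift t) (h *: 1) -
    f (upd y i t))) @ 0^' --> g (upd y i t).
  apply/cvgrPdist_le => e e0; have [d d0 hd] := ud e e0.
  near=> h; have h0 : h != 0 by near: h; exact: nbhs_dnbhs_neq.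
  have hd' : `|h| <= d by near: h; exact: dnbhs0_le.
  have := hd (upd y i t) h hd'; rewrite upd_id {2}/upd eqxx.
  rewrite /= [h *: 1]mulr1 [h + t]addrC [_ *: _]mulrC => H.
  rewrite -(@ler_pM2r _ `|h|) ?normr_gt0// -normrM.
  apply: le_trans H; rewrite le_eqVlt; apply/orP; left; apply/eqP.
  by rewrite -normrN; congr `|_|; field.
split; first by apply/cvg_ex; eexists; exact: L.
exact/cvg_lim.
Unshelve. all: by end_near. Qed.

(** The layers below [i] preserve the derivative relation, the layer [i] integrates a derivative
    with vanishing end values, and the layers above integrate 0. *)
Lemma RI_udiff M f g i : 0 < M -> (i < N)%N -> ucs 0 M f -> ucs 0 M g ->
  udiff i f g -> forall y, RI N g y = 0.
Proof.
move=> M0 iN uf ug ud.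
have K k : (k <= i)%N -> udiff i (RI k f) (RI k g).
  elim: k => //= k IH ki; have kN : (k <= N)%N := ltnW (leq_trans ki (ltnW iN)).
  apply: (udiff_stepint M0); [exact: ucs_RI|exact: ucs_RI| | | ].
  - exact: leq_trans ki (ltnW iN).
  - by rewrite gtn_eqF.
  - by apply: IH; exact: ltnW.
have Z y : RI i.+1 g y = 0.
  (* The larger radius puts the end points strictly outside the support, where the slice of the
     primitive is 0. *)
  have M1 : 0 < M + 1 by lra.
  have wk (F : (nat -> R) -> R) k : ucs k M F -> ucs k (M + 1) F.
    by move=> [u s]; split=> // z l kl zl; apply: (s z l kl); lra.
  have uk := wk _ _ (ucs_RI M0 (ltnW iN) ug).
  have ii : (i <= i < N)%N by rewrite leqnn.
  rewrite /=; have hd := udiff_slice y (K i (leqnn _)).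
  have [cg sg] := ucs_slice y uk ii.
  rewrite /stepint (integral_csupp cg hd _ sg)/=; last lra.
  have [_ s] := ucs_slice y (ucs_RI M0 (ltnW iN) uf) ii.
  by rewrite !s ?subrr//; [left; lra|right; lra].
have : forall d y, RI (i.+1 + d) g y = 0.
  elim=> [|d IH] y; first by rewrite addn0.
  rewrite addnS -[RI _ g]/(stepint _ (RI (i.+1 + d) g)) /stepint (_ : (fun t => _) = cst 0%E) ?integral0//.
  by apply/funext => t; rewrite IH.
by move=> h y; rewrite -(subnKC iN) h.
Qed.

End IteratedIntegral.

(** * Continuous compactly supported functions on R^N and their integral [Iv] *)

Section CompactSupport.
Context {R : realType} {N : nat}.
Notation V := 'rV[R]_N.
Implicit Types (f g : V -> R) (x z : V).

Definition rvec (y : nat -> R) : V := \row_(i < N) y (nat_of_ord i).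
Definition coords x : nat -> R := fun k => if insub k is Some i then x ord0 i else 0.

Lemma coordsK : cancel coords rvec.
Proof.
by move=> x; apply/rowP => i; rewrite mxE /coords insubT //= => ?; congr (x _ _); apply/val_inj.
Qed.

Lemma rvnorm_le x (d : R) : 0 <= d -> (forall i, `|x ord0 i| <= d) -> `|x| <= d.
Proof.
move=> d0 h; rewrite [leLHS]/Num.norm /= mx_normrE; apply/bigmax_leP; split => // -[i j] _ /=.
by rewrite (ord1 i).
Qed.

Lemma rvnorm_ge x i : `|x ord0 i| <= `|x|.
Proof.
rewrite [leRHS]/Num.norm /= mx_normrE.
by apply/bigmax_geP; right => /=; exists (ord0, i).
Qed.

Lemma rvcoord_continuous i : continuous (fun x : V => x ord0 i).
Proof. exact: coord_continuous. Qed.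

(** Compact support is expressed coordinatewise, which matches the cubes on which the iterated
    integral lives. *)
Definition Cc f := continuous f /\
  exists M : R, forall x i, M < `|x ord0 i| -> f x = 0.

Definition bump_radius f M := 0 < M /\ forall x i, M < `|x ord0 i| -> f x = 0.

Lemma Cc_radius f : Cc f -> exists M, bump_radius f M.
Proof.
move=> [_ [M h]]; exists (Num.max M 1); split; first by rewrite lt_max ltr01 orbT.
by move=> x i; rewrite gt_max => /andP[/h].
Qed.

Lemma bump_radius_le f M M' : M <= M' -> bump_radius f M -> bump_radius f M'.
Proof.
move=> MM [M0 h]; split; first exact: lt_le_trans MM.
by move=> x i hx; apply: (h x i); exact: le_lt_trans hx.
Qed.

(* Heine-Cantor on the closed cube of radius M + 1. *)
Lemma Cc_ucont f M : continuous f -> bump_radius f M ->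
  ucs N 0 M (fun y => f (rvec y)).
Proof.
move=> cf [M0 sf]; split; last first.
  move=> y k /andP[_ kN] yk; apply: (sf _ (Ordinal kN)).
  by rewrite mxE.
move=> e e0.
pose A : set V := [set v : V | forall i, v ord0 i \in `[(- (M + 1)), (M + 1)]].
have cA : compact A.
  apply: (@rV_compact R N (fun=> `[(- (M + 1)), (M + 1)]%classic)) => _.
  exact: segment_compact.
have : \forall d \near (0:R)^'+, A `<=` (fun x => forall z, `|x - z| <= d -> `|f x - f z| <= e).
  apply: (compact_near_coveringP A).1 => // x _.
  have e20 : 0 < e / 2 by lra.
  have /cvgrPdist_le/(_ _ e20)/nbhs_normP[r /= r0 hr] := cf x.
  exists (ball x (r / 2), [set d | d < r / 2]); first split => /=.
  - by apply: nbhsx_ballx; lra.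
  - by apply: nbhs_right_lt; lra.
  - move=> [x' d] [/= xx' dr] z x'z; move: xx'; rewrite -ball_normE /= => xx'.
    have h1 : `|f x - f x'| <= e / 2 by apply: hr => /=; lra.
    have h2 : `|f x - f z| <= e / 2.
      apply: hr => /=; have := ler_normD (x - x') (x' - z); rewrite subrKA; lra.
    have := ler_normB (f x - f z) (f x - f x').
    have -> : f x - f z - (f x - f x') = f x' - f z by ring.
    lra.
move=> [r /= r0 hr].
(* The bound d <= 1 serves the points outside the cube: then both arguments have a coordinate beyond
   M and both values are 0. *)
pose d := Num.min (r / 2) 1.
have d0 : 0 < d by rewrite lt_min ltr01 andbT; lra.
exists d => // y z yz.
have dr : d < r by rewrite /d gt_min; apply/orP; left; lra.
have d1 : d <= 1 by rewrite /d ge_min lexx orbT.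
have dist : `|rvec y - rvec z| <= d.
  by apply: rvnorm_le; [exact: ltW | move=> i; rewrite !mxE; exact: yz].
have hA : A `<=` (fun x => forall z, `|x - z| <= d -> `|f x - f z| <= e).
  by apply: hr => //=; rewrite sub0r normrN gtr0_norm.
have [/hA H|] := pselect (A (rvec y)); first exact: H dist.
move=> /existsNP[i]; rewrite in_itv /= => /negP; rewrite -ler_norml -ltNge => yi.
have zi : M < `|rvec z ord0 i|.
  have := rvnorm_ge (rvec y - rvec z) i; rewrite [X in `|X|]mxE [X in _ + X]mxE => H.
  have := ler_normD (rvec y ord0 i - rvec z ord0 i) (rvec z ord0 i); rewrite subrK.
  by lra.
by rewrite /= (sf (rvec y) i) 1?(sf (rvec z) i)// ?subrr ?normr0 ?ltW//; lra.
Unshelve. all: by end_near. Qed.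

Definition Iv f : R := RI N (fun y => f (rvec y)) (fun=> 0).

Lemma integral_RNE f : Cc f -> integral_RN (fun x => (f x)%:E) = (Iv f)%:E.
Proof.
move=> cf; have [M hM] := Cc_radius cf.
by rewrite /integral_RN (iint_RI _ hM.1 (leqnn N) (Cc_ucont cf.1 hM)).
Qed.

Lemma Cc_cst0 : Cc (fun _ => 0).
Proof. by split; [exact: cst_continuous|exists 0]. Qed.

Lemma CcM f g : continuous f -> Cc g -> Cc (fun x => f x * g x).
Proof.
move=> cf [cg [M hM]]; split; first exact: contM.
by exists M => x i xi; rewrite (hM x i xi) mulr0.
Qed.

Lemma CcZ (c : R) g : Cc g -> Cc (fun x => c * g x).
Proof. by apply: CcM; exact: cst_continuous. Qed.

Lemma CcD f g : Cc f -> Cc g -> Cc (fun x => f x + g x).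
Proof.
move=> [cf [M hM]] [cg [M' hM']]; split.
  exact: contD.
exists (Num.max M M') => x i; rewrite gt_max => /andP[xM xM'].
by rewrite (hM x i xM) (hM' x i xM') addr0.
Qed.

Lemma Cc_sum (n : nat) (F : 'I_n -> V -> R) : (forall i, Cc (F i)) ->
  Cc (fun x => \sum_(i < n) F i x).
Proof.
elim: n F => [|n IH] F h.
  by have := Cc_cst0; congr Cc; apply/funext => x; rewrite big_ord0.
have := CcD (IH (fun i => F (widen_ord (leqnSn n) i)) (fun i => h _)) (h ord_max).
by congr Cc; apply/funext => x; rewrite big_ord_recr.
Qed.

Lemma Iv_lin f g c : Cc f -> Cc g -> Iv (fun x => f x + c * g x) = Iv f + c * Iv g.
Proof.
move=> cf cg; have [M hM] := Cc_radius cf; have [M' hM'] := Cc_radius cg.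
have hf := bump_radius_le (_ : M <= Num.max M M') hM.
have hg := bump_radius_le (_ : M' <= Num.max M M') hM'.
have {}hf := Cc_ucont cf.1 (hf ltac:(by rewrite le_max lexx)).
have {}hg := Cc_ucont cg.1 (hg ltac:(by rewrite le_max lexx orbT)).
rewrite /Iv (RI_lin _ _ _ (leqnn N) hf hg)//.
by rewrite lt_max hM.1.
Qed.

Lemma Iv0 : Iv (fun=> 0) = 0.
Proof.
have E := Iv_lin (-1) Cc_cst0 Cc_cst0.
have Z : (fun _ : V => 0 + -1 * 0) = (fun=> 0 : R).
  by apply/funext => x; rewrite mulr0 addr0.
by rewrite Z in E; lra.
Qed.

Lemma IvZ f c : Cc f -> Iv (fun x => c * f x) = c * Iv f.
Proof.
move=> cf; have := Iv_lin c Cc_cst0 cf.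
rewrite Iv0 add0r => <-; congr Iv; apply/funext => x.
by rewrite add0r.
Qed.

Lemma IvD f g : Cc f -> Cc g -> Iv (fun x => f x + g x) = Iv f + Iv g.
Proof.
move=> cf cg; have := Iv_lin 1 cf cg; rewrite mul1r => <-.
by congr Iv; apply/funext => x; rewrite mul1r.
Qed.

Lemma Iv_sum (n : nat) (F : 'I_n -> V -> R) : (forall i, Cc (F i)) ->
  Iv (fun x => \sum_(i < n) F i x) = \sum_(i < n) Iv (F i).
Proof.
elim: n F => [|n IH] F h.
  rewrite big_ord0; apply: (etrans _ Iv0); congr Iv; apply/funext => x.
  by rewrite big_ord0.
rewrite big_ord_recr /= -IH// -IvD//; last exact: Cc_sum.
by congr Iv; apply/funext => x; rewrite big_ord_recr.
Qed.

Lemma Iv_ge0 f : Cc f -> (forall x, 0 <= f x) -> 0 <= Iv f.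
Proof.
move=> cf f0; have [M hM] := Cc_radius cf.
by apply: (RI_ge0 _ hM.1 (leqnn N) (Cc_ucont cf.1 hM)).
Qed.

Lemma Iv_le f g : Cc f -> Cc g -> (forall x, f x <= g x) -> Iv f <= Iv g.
Proof.
move=> cf cg fg; rewrite -subr_ge0 -mulN1r -Iv_lin//.
apply: Iv_ge0; first by apply: CcD => //; exact: CcZ.
by move=> x; rewrite mulN1r subr_ge0.
Qed.

Lemma Iv_gt0 f x : Cc f -> (forall x, 0 <= f x) -> 0 < f x -> 0 < Iv f.
Proof.
move=> cf f0 fx; have [M hM] := Cc_radius cf.
have uf := Cc_ucont cf.1 hM.
apply: (RI_gt0 (z := coords x) hM.1 (leqnn N) uf) => //; last by rewrite coordsK.
by move=> j Nj; rewrite /coords insubN// -leqNgt.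
Qed.

Lemma rvec_upd (y : nat -> R) (i : 'I_N) (h : R) :
  rvec (upd y i (y i + h)) = h *: evec R i + rvec y.
Proof.
apply/rowP => j; rewrite !mxE /upd eqxx /=.
have [->|ij] := eqVneq j i; first by rewrite eqxx mulr1 addrC.
have -> : (nat_of_ord j == i) = false by apply/negbTE.
by rewrite mulr0 add0r.
Qed.

(** The mean value theorem along the i-th axis and the uniform continuity of [g] give [udiff], the
    uniform first-order expansion that survives integration. *)
Lemma Iv_pderiv f g (i : 'I_N) : Cc f -> Cc g ->
  (forall x, isd x (evec R i) f (g x)) -> Iv g = 0.
Proof.
move=> cf cg hfg; have [M hM] := Cc_radius cf; have [M' hM'] := Cc_radius cg.
have hf := bump_radius_le (_ : M <= Num.max M M') hM.
have hg := bump_radius_le (_ : M' <= Num.max M M') hM'.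
have {}hf := Cc_ucont cf.1 (hf ltac:(by rewrite le_max lexx)).
have {}hg := Cc_ucont cg.1 (hg ltac:(by rewrite le_max lexx orbT)).
have m0 : 0 < Num.max M M' by rewrite lt_max hM.1.
apply: (RI_udiff m0 (ltn_ord i) hf hg) => e e0.
have [d d0 hd] := hg.1 e e0; exists d => // y h hh.
rewrite rvec_upd.
have line : hasd (fun s : R => f (s *: evec R i + rvec y))
                 (fun s : R => g (s *: evec R i + rvec y)).
  move=> s; have := (isdE _ _ _ _).1 (hfg (s *: evec R i + rvec y)) => H.
  have -> : (fun s : R => f (s *: evec R i + rvec y)) =
    (fun r : R => f ((r - s) *: evec R i + (s *: evec R i + rvec y))).
    by apply/funext => r; rewrite addrA -scalerDl subrK.
  apply: isd_eq; first apply: (@isd_outer _ _ s 1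
      (fun h : R => f (h *: evec R i + (s *: evec R i + rvec y))) (fun r => r - s)).
  - by rewrite subrr; exact: H.
  - by der.
  - by rewrite addr0 mulr1.
have bound s : `|s| <= d -> `|g (s *: evec R i + rvec y) - g (rvec y)| <= e.
  move=> sd; have := hd (upd y i (y i + s)) y; rewrite rvec_upd; apply => k kN.
  rewrite /upd; case: eqP => [->|_]; first by rewrite addrAC subrr add0r.
  by rewrite subrr normr0 ltW.
have fE : f (rvec y) = f (0 *: evec R i + rvec y) by rewrite scale0r add0r.
have fin c : `|c| <= d ->
    f (h *: evec R i + rvec y) - f (0 *: evec R i + rvec y) =
    g (c *: evec R i + rvec y) * h ->
    `|f (h *: evec R i + rvec y) - f (rvec y) - h * g (rvec y)| <= e * `|h|.
  move=> cd E; rewrite fE E.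
  have -> : g (c *: evec R i + rvec y) * h - h * g (rvec y) =
    h * (g (c *: evec R i + rvec y) - g (rvec y)) by ring.
  by rewrite normrM mulrC ler_wpM2r//; exact: bound.
have [h0|h0|->] := ltgtP h 0; last by rewrite scale0r add0r subrr mul0r subrr normr0 mulr0.
- have [c /andP[c1 c2] E] := der_mvt line h0.
  apply: (fin c); last by lra.
  by apply: le_trans hh; rewrite !ltr0_norm; lra.
have [c /andP[c1 c2] E] := der_mvt line h0.
apply: (fin c); last by lra.
by apply: le_trans hh; rewrite !gtr0_norm; lra.
Qed.

Lemma integral_RN_le (f g : V -> \bar R) :
  (forall x, 0 <= f x)%E -> (forall x, f x <= g x)%E ->
  (0 <= integral_RN f /\ integral_RN f <= integral_RN g)%E.
Proof.
by move=> f0 fg; apply: iint_le => z; [exact: f0|exact: fg].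
Qed.

(** The function [g] is only dominated by an increasing limit of regular functions with controlled
    integrals. In this form the Rellich inequality reaches a singular weight. *)
Lemma integral_RN_limn_le (f : nat -> V -> R) (g : V -> \bar R) (C M : R) :
  (forall n, continuous (f n)) -> (forall n, bump_radius (f n) M) ->
  (forall n x, 0 <= f n x) ->
  (forall x, {homo f ^~ x : n m / (n <= m)%N >-> n <= m}) ->
  (forall n, Iv (f n) <= C) -> (forall x, 0 <= g x)%E ->
  (forall x, g x <= limn (fun n => (f n x)%:E))%E ->
  (integral_RN g <= C%:E)%E.
Proof.
move=> cf bf f0 nd IC g0 gf; have [_ H] := integral_RN_le g0 gf.
apply: le_trans H _; rewrite /integral_RN.
have uf n := Cc_ucont (cf n) (bf n).
have M0 := (bf 0%N).1.
have -> := @iint_limn _ N M (fun n y => f n (rvec y)) N (fun=> 0) M0 (leqnn N) uf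
  (fun n y => f0 n _) (fun y => nd _).
apply: lime_le; last by near=> n; rewrite lee_fin; exact: IC.
apply: ereal_nondecreasing_is_cvgn => n m nm; rewrite lee_fin.
have cc k : Cc (f k) by split => //; exists M; exact: (bf k).2.
by apply: (Iv_le (cc n) (cc m)) => x; exact: nd.
Unshelve. all: by end_near. Qed.

End CompactSupport.

(** * Rellich inequalities *)

Section Schwarz.
Context {R : realType} {N : nat}.
Notation V := 'rV[R]_N.
Implicit Types (f : V -> R) (x v w : V).

Lemma hasd_line f g v x : (forall z, isd z v f (g z)) ->
  hasd (fun s : R => f (s *: v + x)) (fun s : R => g (s *: v + x)).
Proof.
move=> H s; have /isdE K := H (s *: v + x).
have -> : (fun s : R => f (s *: v + x)) =
    (fun r : R => f ((r - s) *: v + (s *: v + x))).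
  by apply/funext => r; rewrite addrA -scalerDl subrK.
apply: isd_eq; first apply: (@isd_outer _ _ s 1
      (fun h : R => f (h *: v + (s *: v + x))) (fun r => r - s)).
- by rewrite subrr; exact: K.
- by der.
- by rewrite addr0 mulr1.
Qed.

Lemma second_difference f fv fvw v w x (h : R) : 0 < h ->
  (forall z, isd z v f (fv z)) -> (forall z, isd z w fv (fvw z)) ->
  exists p q : R, [/\ 0 < p < h, 0 < q < h &
    f (h *: v + (h *: w + x)) - f (h *: v + x) - f (h *: w + x) + f x =
    h * h * fvw (q *: w + (p *: v + x))].
Proof.
move=> h0 dv dw.
pose A s := f (s *: v + (h *: w + x)) - f (s *: v + x).
have hA : hasd A (fun s => fv (s *: v + (h *: w + x)) - fv (s *: v + x)).
  have h1 := hasd_line (h *: w + x) dv; have h2 := hasd_line x dv.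
  by move=> s; rewrite /A; apply: isdD; [exact: h1|apply: isdN; exact: h2].
have [p ph Ep] := der_mvt hA h0.
have [q qh Eq] := der_mvt (hasd_line (p *: v + x) dw) h0.
exists p, q; split => //.
have -> : h * h * fvw (q *: w + (p *: v + x)) = fvw (q *: w + (p *: v + x)) * (h - 0) * (h - 0).
  by ring.
rewrite -Eq [h *: w + (p *: v + x)]addrCA scale0r add0r -Ep /A !scale0r !add0r; ring.
Qed.

(** The second difference along h v and h w is symmetric, and two applications of the mean value
    theorem, in either order, make it h^2 times a mixed derivative at a point close to x. *)
Lemma schwarz f fv fw fvw fwv v w x :
  (forall z, isd z v f (fv z)) -> (forall z, isd z w fv (fvw z)) ->
  (forall z, isd z w f (fw z)) -> (forall z, isd z v fw (fwv z)) ->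
  continuous fvw -> continuous fwv -> fvw x = fwv x.
Proof.
move=> dv dvw dw dwv c1 c2; apply/eqP; rewrite -subr_eq0 -normr_le0.
apply/ler_addgt0Pr => e e0; rewrite add0r.
have e20 : 0 < e / 2 by lra.
have /cvgrPdist_le/(_ _ e20)/nbhs_normP[r1 /= r10 hr1] := c1 x.
have /cvgrPdist_le/(_ _ e20)/nbhs_normP[r2 /= r20 hr2] := c2 x.
pose r := Num.min r1 r2; have r0 : 0 < r by rewrite lt_min r10.
(* Keeps every intermediate point within distance r of x. *)
pose h := r / (`|v| + `|w| + 1).
have k0 : 0 < `|v| + `|w| + 1 by rewrite ltr_wpDl// addr_ge0.
have h0 : 0 < h by rewrite divr_gt0.
have hk : h * (`|v| + `|w| + 1) = r by rewrite /h mulrAC mulfK// gt_eqF.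
have near p q u u' : 0 < p < h -> 0 < q < h -> `|u| + `|u'| = `|v| + `|w| ->
    `|x - (q *: u + (p *: u' + x))| < r.
  move=> /andP[p0 ph] /andP[q0 qh] uu.
  rewrite addrA opprD addrCA subrr addr0 normrN.
  apply: le_lt_trans (ler_normD _ _) _; rewrite !normrZ !gtr0_norm// -hk -uu.
  have := normr_ge0 u; have := normr_ge0 u'; nra.
have [p [q [ph qh E1]]] := second_difference x h0 dv dvw.
have [p' [q' [ph' qh' E2]]] := second_difference x h0 dw dwv.
have E : fvw (q *: w + (p *: v + x)) = fwv (q' *: v + (p' *: w + x)).
  have hh : h * h != 0 by rewrite mulf_neq0// gt_eqF.
  apply: (mulfI hh); rewrite -E1 -E2 [h *: v + (h *: w + x)]addrCA; ring.
have a1 : `|fvw x - fvw (q *: w + (p *: v + x))| <= e / 2.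
  apply: hr1 => /=; apply: lt_le_trans (near p q w v ph qh _) _; first by rewrite addrC.
  by rewrite /r ge_min lexx.
have a2 : `|fwv x - fwv (q' *: v + (p' *: w + x))| <= e / 2.
  apply: hr2 => /=; apply: lt_le_trans (near p' q' v w ph' qh' _) _ => //.
  by rewrite /r ge_min lexx orbT.
move: a1 a2; rewrite E !ler_norml => /andP[? ?] /andP[? ?].
by apply/andP; split; lra.
Qed.

End Schwarz.

Section Inequalities.
Context {R : realType} {N : nat}.
Notation V := 'rV[R]_N.
Implicit Types (f : V -> R) (x : V).

Definition sq x : R := \sum_(i < N) x ord0 i ^+ 2.

Lemma sq_ge0 x : 0 <= sq x.
Proof. by apply: sumr_ge0 => i _; exact: sqr_ge0. Qed.

Lemma sq_continuous : continuous sq.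
Proof.
rewrite /sq; apply: cont_sum => i; apply: contX; exact: rvcoord_continuous.
Qed.

Lemma isd_coord x (i j : 'I_N) : isd x (evec R j) (fun x => x ord0 i) (i == j)%:R.
Proof.
apply/isdE; have -> : (fun h : R => (h *: evec R j + x) ord0 i) =
    (fun h : R => h * (i == j)%:R + x ord0 i).
  by apply/funext => h; rewrite !mxE eqxx.
by der; ring.
Qed.

Lemma isd_sq x (j : 'I_N) : isd x (evec R j) sq (2 * x ord0 j).
Proof.
apply: isd_eq; first apply: isd_sum => i; first apply: isdX; first exact: isd_coord.
rewrite (bigD1 j)//= eqxx big1 ?addr0 ?expr1 ?mulr1// => i /negbTE ->.
by rewrite mulr0.
Qed.

Section TestFunction.
Variable phi : V -> R.
Hypothesis C2phi : C2 phi.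
Variable M : R.
Hypothesis supp : forall x i, M < `|x ord0 i| -> phi x = 0.

Notation d i := (pderiv i phi).
Notation dd i j := (pderiv j (pderiv i phi)).

Lemma isd_phi i x : isd x (evec R i) phi (d i x).
Proof. by case: C2phi => _ h _ _ _; split=> //; exact: h. Qed.

Lemma isd_dphi i j x : isd x (evec R j) (d i) (dd i j x).
Proof. by case: C2phi => _ _ _ h _; split=> //; exact: h. Qed.

Ltac dphi_step := first [der_step | match goal with
  | |- isd _ _ phi _ => exact: isd_phi
  | |- isd _ _ (pderiv _ phi) _ => exact: isd_dphi
  | |- isd _ _ sq _ => exact: isd_sq
  | |- isd _ _ (fun y => fun_of_matrix y _ _) _ => exact: isd_coord
  | H : forall i x, isd x _ ?u _ |- isd _ _ ?u _ => exact: (H _ _)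
  end].
Ltac dphi := eapply isd_eq; [repeat dphi_step | cbv beta].

Lemma ddC i j x : dd i j x = dd j i x.
Proof.
case: C2phi => _ _ _ _ c.
exact: (schwarz x (isd_phi i) (isd_dphi i j) (isd_phi j) (isd_dphi j i) (c i j) (c j i)).
Qed.

Lemma near_supp x i : M < `|x ord0 i| -> nbhs x [set z : V | M < `|z ord0 i|].
Proof.
move=> xi; near=> z; near: z.
have c : continuous (fun z : V => `|z ord0 i|).
  apply: cont_comp_at => [|t]; [exact: rvcoord_continuous|exact: norm_continuous].
exact: (cvgr_gt _ (c x)).
Unshelve. all: by end_near. Qed.

Lemma pderiv_supp f i : (forall x i, M < `|x ord0 i| -> f x = 0) ->
  forall x k, M < `|x ord0 k| -> pderiv i f x = 0.
Proof.
move=> sf x k xk.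
have [_ <-] : isd x (evec R i) f 0.
  apply: (isd_near _ (isd_cst x (evec R i) 0)).
  have := near_supp xk; apply: filterS => z zk.
  by rewrite (sf z k).
by [].
Qed.

(** The 2-jet of [phi] vanishes beyond the radius M, so a continuous expression that is 0 on zero
    jets is compactly supported. This settles the support conditions of all vector fields below. *)
Definition jet0 x := [/\ phi x = 0, forall i, d i x = 0 & forall i j, dd i j x = 0].

Lemma jet_Cc f : continuous f -> (forall x, jet0 x -> f x = 0) -> Cc f.
Proof.
move=> cf jf; split=> //; exists M => x k xk; apply: jf; split.
- exact: (supp xk).
- by move=> i; exact: (pderiv_supp i supp xk).
- by move=> i j; exact: (pderiv_supp j (pderiv_supp i supp) xk).
Qed.

Lemma lap_Cc : Cc (fun x => laplacian phi x ^+ 2).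
Proof.
case: C2phi => _ _ _ _ c; apply: jet_Cc.
  by apply: contX; apply: cont_sum => i; exact: c.
by move=> x [_ _ h]; rewrite /laplacian big1 ?expr0n.
Qed.

Lemma Iv_div (X dX : 'I_N -> V -> R) :
  (forall i, continuous (X i)) -> (forall i, continuous (dX i)) ->
  (forall i x, jet0 x -> X i x = 0) -> (forall i x, jet0 x -> dX i x = 0) ->
  (forall i x, isd x (evec R i) (X i) (dX i x)) ->
  Cc (fun x => \sum_(i < N) dX i x) /\ Iv (fun x => \sum_(i < N) dX i x) = 0.
Proof.
move=> cX cdX jX jdX h.
have c1 i : Cc (X i) by apply: jet_Cc => //; exact: jX.
have c2 i : Cc (dX i) by apply: jet_Cc => //; exact: jdX.
split; first exact: Cc_sum.
by rewrite Iv_sum// big1// => i _; exact: (Iv_pderiv (c1 i) (c2 i) (h i)).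
Qed.

(* How every inequality below is obtained: a pointwise lower bound for the
   square of the Laplacian up to a divergence. *)
Lemma Iv_le_lap (X dX : 'I_N -> V -> R) (W : V -> R) :
  (forall i, continuous (X i)) -> (forall i, continuous (dX i)) ->
  (forall i x, jet0 x -> X i x = 0) -> (forall i x, jet0 x -> dX i x = 0) ->
  (forall i x, isd x (evec R i) (X i) (dX i x)) -> Cc W ->
  (forall x, W x <= laplacian phi x ^+ 2 + \sum_(i < N) dX i x) ->
  Iv W <= Iv (fun x => laplacian phi x ^+ 2).
Proof.
move=> cX cdX jX jdX h cW le; have [c0 E] := Iv_div cX cdX jX jdX h.
rewrite -[leRHS]addr0 -E -IvD//; last exact: lap_Cc.
by apply: Iv_le => //; apply: CcD => //; exact: lap_Cc.
Qed.

(** Here c = a (a + 2) = N (N - 4) / 4. With sigma = |x|^2 + eps the field is 2 c phi grad phi /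
    sigma + 2 c (1 + a) phi^2 x / sigma^2. The difference of the two sides becomes (Delta phi + c
    phi / sigma)^2 + (2 c / sigma) |grad phi + a phi x / sigma|^2 plus a nonnegative error carrying
    a factor eps. The shift by eps keeps the field regular at the origin. *)
Lemma rellich_reg (a eps : R) : 0 <= a -> N%:R = 4 + 2 * a -> 0 < eps ->
  Iv (fun x => (a * (a + 2)) ^+ 2 * phi x ^+ 2 * ((sq x + eps)^-1) ^+ 2) <=
  Iv (fun x => laplacian phi x ^+ 2).
Proof.
move=> a0 Na e0; set c := a * (a + 2).
have [cp _ cd _ cdd] := C2phi; have cq := sq_continuous.
have cx := @rvcoord_continuous R N.
have sg x : sq x + eps != 0 by rewrite gt_eqF// ltr_wpDl// sq_ge0.
pose t x := (sq x + eps)^-1.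
have ct : continuous t by rewrite /t; cont; exact: sg.
have dt i x : isd x (evec R i) t (- 2 * x ord0 i * t x ^+ 2).
  by rewrite /t; dphi; [exact: sg|rewrite -exprVn addr0; ring].
apply: (@Iv_le_lap
  (fun i x => 2 * c * (phi x * d i x * t x) + 2 * c * (1 + a) * (phi x ^+ 2 * x ord0 i * t x ^+ 2))
  (fun i x => 2 * c * t x * (phi x * dd i i x) + 2 * c * t x * (d i x ^+ 2) +
     4 * c * a * phi x * t x ^+ 2 * (x ord0 i * d i x)
     - 8 * c * (1 + a) * phi x ^+ 2 * t x ^+ 3 * (x ord0 i ^+ 2)
     + 2 * c * (1 + a) * phi x ^+ 2 * t x ^+ 2)).
- by move=> i; cont.
- by move=> i; cont.
- by move=> i x [-> -> _]; ring.
- by move=> i x [-> -> ->]; ring.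
- by move=> i x; dphi; rewrite /= eqxx /= mulr1n; ring.
- apply: jet_Cc; first by cont.
  by move=> x [-> _ _]; ring.
move=> x.
rewrite !big_split/= sumrN -!mulr_sumr sumr_const card_ord -(mulr_natr _ N) Na.
set D := laplacian phi x.
have -> : \sum_(i < N) dd i i x = D by [].
set Q := \sum_(i < N) d i x ^+ 2.
set E := \sum_(i < N) x ord0 i * d i x.
rewrite -/(sq x); set s := sq x; set T := t x; set p := phi x.
have T0 : 0 < T by rewrite invr_gt0 ltr_wpDl// sq_ge0.
have sT : s * T = 1 - eps * T.
  have H : (s + eps) * T = 1 by rewrite /T /t mulfV//; exact: sg.
  by lra.
have SQ : 0 <= Q + 2 * a * p * T * E + a ^+ 2 * p ^+ 2 * T ^+ 2 * s.
  have -> : Q + 2 * a * p * T * E + a ^+ 2 * p ^+ 2 * T ^+ 2 * s =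
    \sum_(i < N) (d i x + a * p * T * x ord0 i) ^+ 2.
    rewrite /Q /E /s /sq !mulr_sumr -!big_split; apply: eq_bigr => i _ /=; ring.
  by apply: sumr_ge0 => i _; exact: sqr_ge0.
have c0 : 0 <= c by rewrite /c mulr_ge0//; lra.
rewrite -subr_ge0 [X in 0 <= X](_ : _ =
   (D + c * p * T) ^+ 2 + 2 * c * T * (Q + 2 * a * p * T * E + a ^+ 2 * p ^+ 2 * T ^+ 2 * s)
   + p ^+ 2 * T ^+ 2 * (eps * T) * (2 * c * a ^+ 2 + 8 * c * (1 + a))); last first.
  by rewrite -/p -/T -[(s + eps)^-1]/T /c; ring: sT.
have T0' := ltW T0.
have A0 : 0 <= 2 * c * T by apply: mulr_ge0 => //; exact: mulr_ge0.
have A1 : 0 <= p ^+ 2 * T ^+ 2 * (eps * T).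
  apply: mulr_ge0; last by apply: mulr_ge0 => //; exact: ltW.
  by apply: mulr_ge0; exact: sqr_ge0.
have A2 : 0 <= 2 * c * a ^+ 2 + 8 * c * (1 + a).
  have a1 : 0 <= 1 + a by lra.
  by apply: addr_ge0; apply: mulr_ge0 => //; [exact: mulr_ge0|exact: sqr_ge0|exact: mulr_ge0].
apply: addr_ge0; last exact: mulr_ge0.
by apply: addr_ge0; [exact: sqr_ge0|exact: mulr_ge0].
Qed.

Lemma sum_lincomb (c1 c2 c3 c4 c5 c6 c7 : R) (F1 F2 F3 F4 F5 F6 : 'I_N -> R) :
  \sum_(i < N) (c1 * F1 i - c2 * F2 i + c3 * F3 i - c4 * F4 i + c5 * F5 i + c6 * F6 i + c7) =
  c1 * \sum_(i < N) F1 i - c2 * \sum_(i < N) F2 i + c3 * \sum_(i < N) F3 i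
  - c4 * \sum_(i < N) F4 i + c5 * \sum_(i < N) F5 i + c6 * \sum_(i < N) F6 i + c7 * N%:R.
Proof.
have -> : c7 * N%:R = \sum_(i < N) c7 by rewrite sumr_const card_ord mulr_natr.
by rewrite !mulr_sumr -!sumrN -!big_split.
Qed.

(* The multiplier 2 (x . grad phi + a phi) / sigma, sigma = |x|^2 + 1, tests the
   Laplacian only in the radial direction; it costs nothing in the angular ones
   and leaves a one-dimensional Hardy weight with the critical logarithm. *)
Lemma log_rellich (a : R) (W : V -> R) : - (2^-1) <= a -> N%:R = 4 + 2 * a -> Cc W ->
  (forall x, W x <= phi x ^+ 2 * ((sq x + 1)^-1) ^+ 2 *
     (4 * ((1 + ln (sq x + 1))^-1) ^+ 2 - 32 * (sq x + 1)^-1)) ->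
  Iv W <= Iv (fun x => laplacian phi x ^+ 2).
Proof.
move=> a0 Na cW leW.
have [cp _ cd _ cdd] := C2phi; have cq := sq_continuous.
have cx := @rvcoord_continuous R N.
have sp x : 0 < sq x + 1 by rewrite ltr_wpDl// sq_ge0.
have sg x : sq x + 1 != 0 by rewrite gt_eqF.
have s1 x : 1 <= sq x + 1 by rewrite lerDr sq_ge0.
have l1 x : 1 <= 1 + ln (sq x + 1) by rewrite lerDl ln_ge0.
have lg x : 1 + ln (sq x + 1) != 0 by rewrite gt_eqF// (lt_le_trans ltr01).
pose t x := (sq x + 1)^-1.
pose eta x := (1 + ln (sq x + 1))^-1.
have ct : continuous t by rewrite /t; cont; exact: sg.
have ce : continuous eta.
  rewrite /eta; apply: contV => //; apply: contD; first exact: cst_continuous.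
  apply: cont_comp_at => [|x]; first by cont.
  exact: continuous_ln.
have dt i x : isd x (evec R i) t (- 2 * x ord0 i * t x ^+ 2).
  by rewrite /t; dphi; [exact: sg|rewrite -exprVn addr0; ring].
have de i x : isd x (evec R i) eta (- 2 * x ord0 i * t x * eta x ^+ 2).
  by rewrite /eta; dphi; [exact: lg|exact: sp|rewrite -exprVn addr0 /t; ring].
pose Q x := \sum_(k < N) d k x ^+ 2.
pose E x := \sum_(k < N) x ord0 k * d k x.
pose dQ i x := \sum_(k < N) 2 * d k x * dd k i x.
pose dE i x := d i x + \sum_(k < N) x ord0 k * dd k i x.
have cQ : continuous Q by rewrite /Q; cont.
have cE : continuous E by rewrite /E; cont.
have cdQ i : continuous (dQ i) by rewrite /dQ; cont.
have cdE i : continuous (dE i) by rewrite /dE; cont.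
have hQ i x : isd x (evec R i) Q (dQ i x).
  by rewrite /Q; dphi; apply: eq_bigr => k _; rewrite /= expr1; ring.
have hE i x : isd x (evec R i) E (dE i x).
  rewrite /E; dphi; rewrite /dE big_split /= addrC; congr (_ + _).
  rewrite (bigD1 i)//= eqxx mulr1 big1 ?addr0// => k /negbTE ->; exact: mulr0.
have jQ x : jet0 x -> Q x = 0.
  by move=> [_ h _]; rewrite /Q big1// => k _; rewrite h expr0n.
have jE x : jet0 x -> E x = 0.
  by move=> [_ h _]; rewrite /E big1// => k _; rewrite h mulr0.
have jdQ i x : jet0 x -> dQ i x = 0.
  by move=> [_ h _]; rewrite /dQ big1// => k _; rewrite h mulr0 mul0r.
have jdE i x : jet0 x -> dE i x = 0.
  by move=> [_ h h']; rewrite /dE h big1 ?addr0// => k _; rewrite h' mulr0.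
apply: (@Iv_le_lap
  (fun i x => 2 * Q x * x ord0 i * t x - 4 * (d i x * E x * t x)
     - 4 * a * (phi x * d i x * t x) + 4 * (phi x ^+ 2 * x ord0 i * (a - eta x) * t x ^+ 2))
  (fun i x => (- 4 * E x * t x - 4 * a * phi x * t x) * dd i i x
     - 4 * t x * (d i x * (\sum_(k < N) x ord0 k * dd k i x))
     + 4 * t x * (x ord0 i * \sum_(k < N) d k x * dd k i x)
     - (4 + 4 * a) * t x * (d i x ^+ 2)
     + (8 * E x * t x ^+ 2 + 8 * a * phi x * t x ^+ 2
          + 8 * phi x * (a - eta x) * t x ^+ 2) * (x ord0 i * d i x)
     + (- 4 * Q x * t x ^+ 2 + 8 * phi x ^+ 2 * t x ^+ 3 * eta x ^+ 2
          - 16 * phi x ^+ 2 * (a - eta x) * t x ^+ 3) * x ord0 i ^+ 2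
     + (2 * Q x * t x + 4 * phi x ^+ 2 * (a - eta x) * t x ^+ 2))).
- by move=> i; cont.
- by move=> i; cont.
- by move=> i x j; rewrite (jQ x j) (jE x j); case: j => -> -> _; ring.
- move=> i x j; rewrite (jQ x j) (jE x j); case: j => -> h h'; rewrite h h'.
  have -> : \sum_(k < N) d k x * dd k i x = 0 by rewrite big1// => k _; rewrite h mul0r.
  by ring.
- move=> i x; dphi; rewrite /= eqxx /= mulr1n /dE /dQ.
  have -> : \sum_(k < N) 2 * d k x * dd k i x = 2 * \sum_(k < N) d k x * dd k i x.
    by rewrite mulr_sumr; apply: eq_bigr => k _; rewrite mulrA.
  by ring.
- exact: cW.
move=> x; apply: le_trans (leW x) _.
rewrite sum_lincomb Na.
set D := laplacian phi x.
have -> : \sum_(i < N) dd i i x = D by [].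
(* Symmetry of the second derivatives identifies the two mixed sums, which have opposite
   coefficients and cancel: second derivatives survive only through the Laplacian. *)
have -> : \sum_(i < N) x ord0 i * (\sum_(k < N) d k x * dd k i x) =
   \sum_(i < N) d i x * (\sum_(k < N) x ord0 k * dd k i x).
  under eq_bigr => i _ do rewrite mulr_sumr.
  rewrite exchange_big /=; apply: eq_bigr => i _; rewrite mulr_sumr.
  by apply: eq_bigr => k _; rewrite ddC; ring.
set S := \sum_(i < N) d i x * _.
rewrite -/(Q x) -/(E x) -/(sq x) -/(t x) -/(eta x).
have sT : sq x * t x = 1 - t x.
  have H : (sq x + 1) * t x = 1 by rewrite /t mulfV.
  by lra.
have T0 : 0 < t x by rewrite invr_gt0.
have e0 : 0 < eta x by rewrite invr_gt0 (lt_le_trans ltr01).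
have e1 : eta x <= 1 by rewrite invf_le1// (lt_le_trans ltr01).
have Q0 : 0 <= Q x by apply: sumr_ge0 => i _; exact: sqr_ge0.
move: (E x) (Q x) (t x) (eta x) (phi x) (sq x) sT T0 e0 e1 Q0 => e q T l p s.
move=> sT T0 l0 l1' q0.
(* The constant 32 in the weight is fixed by the last bracket: for a >= -1/2 and 0 < l <= 1 its
   minimum, at a = -1/2 (dimension 3) and l = 1, is exactly 0. *)
rewrite -subr_ge0 [X in 0 <= X](_ : _ = (D - 2 * (e + a * p) * T) ^+ 2
   + 4 * T ^+ 2 * (e + a * p - l * p) ^+ 2 + 4 * q * T ^+ 2
   + p ^+ 2 * T ^+ 3 * (32 - 8 * l ^+ 2 + 16 * (a - l))); last first.
  by ring: sT.
have T0' := ltW T0.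
apply: addr_ge0; first apply: addr_ge0; first apply: addr_ge0.
- exact: sqr_ge0.
- by apply: mulr_ge0; [apply: mulr_ge0 => //; exact: sqr_ge0|exact: sqr_ge0].
- by apply: mulr_ge0; [apply: mulr_ge0|exact: sqr_ge0].
- apply: mulr_ge0; last by nra.
  by apply: mulr_ge0; [exact: sqr_ge0|exact: exprn_ge0].
Qed.

End TestFunction.
End Inequalities.

(** * From Rellich inequalities to stability criteria *)

Section StabilityCriteria.
Context {R : realType} {N : nat}.
Notation V := 'rV[R]_N.
Implicit Types (phi : V -> R) (U : V -> R) (x : V) (Omega K : set V) (alpha : R).

Lemma C2c_supp Omega phi : C2c Omega phi ->
  exists2 M : R, (forall x i, M < `|x ord0 i| -> phi x = 0) & forall x, phi x != 0 -> Omega x.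
Proof.
move=> [_ cA AO]; have [M0 [_ hM]] := compact_bounded cA.
have sA x : phi x != 0 -> closure [set x | phi x != 0] x by move=> h; exact: (@subset_closure V [set x | phi x != 0] x h).
exists (M0 + 1) => [x i xi|x /sA /AO//].
apply/eqP; apply: contraTT xi => /sA xA; rewrite -leNgt.
by apply: le_trans (rvnorm_ge x i) _; apply: (hM (M0 + 1)) => //; rewrite ltrDl.
Qed.

Definition weight alpha U x := enorm x `^ alpha * expR (U x).

Lemma weight_ge0 alpha U x phi : 0 <= weight alpha U x * phi x ^+ 2.
Proof.
apply: mulr_ge0; last exact: sqr_ge0.
by apply: mulr_ge0; [exact: powR_ge0|exact: expR_ge0].
Qed.

(** The Laplacian term is a finite number, so the extended difference is nonnegative exactly when
    the weight term does not exceed it; stability thus includes finiteness of the weight term. *)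
Lemma stable_onP alpha U Omega : stable_on alpha U Omega <->
  forall phi, C2c Omega phi ->
    (integral_RN (fun x => (weight alpha U x * phi x ^+ 2)%:E) <=
       (Iv (fun x => laplacian phi x ^+ 2))%:E)%E.
Proof.
split=> h phi cphi; have [M sM _] := C2c_supp cphi; have [C2p _ _] := cphi.
- have := h phi cphi; rewrite (integral_RNE (lap_Cc C2p sM)).
  by rewrite subre_ge0.
- rewrite (integral_RNE (lap_Cc C2p sM)).
  by rewrite subre_ge0//; exact: h.
Qed.

Lemma stable_on_le alpha U U' Omega : (forall x, U x <= U' x) ->
  stable_on alpha U' Omega -> stable_on alpha U Omega.
Proof.
move=> UU /stable_onP h; apply/stable_onP => phi cphi; apply: le_trans (h phi cphi).
have [] // := @integral_RN_le R N (fun x => (weight alpha U x * phi x ^+ 2)%:E)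
  (fun x => (weight alpha U' x * phi x ^+ 2)%:E).
  by move=> x; rewrite lee_fin weight_ge0.
move=> x; rewrite lee_fin ler_wpM2r ?sqr_ge0// ler_wpM2l ?powR_ge0//.
by rewrite ler_expR.
Qed.

Lemma le_limn_nondecreasing (u : nat -> R) (r : R) :
  {homo u : n m / (n <= m)%N >-> n <= m} ->
  (forall s, s < r -> exists n, s <= u n) -> (r%:E <= limn (fun n => (u n)%:E))%E.
Proof.
move=> nd h; apply/lee_subgt0Pr => e e0.
have [n hn] := h (r - e) ltac:(lra).
apply: (@le_trans _ _ (u n)%:E); first by rewrite -EFinB lee_fin.
have nd' : {homo (fun n => (u n)%:E) : k m / (k <= m)%N >-> (k <= m)%E}.
  by move=> k m km; rewrite lee_fin nd.
rewrite (cvg_lim _ (ereal_nondecreasing_cvgn nd'))//.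
by apply: ereal_sup_ubound; exists n.
Qed.

(** The regularized inequality is taken with eps = 1/(n+1); its left sides increase to c^2 phi^2 /
    |x|^4. At the origin, where the hypothesis is silent, this limit is +oo as soon as phi is
    nonzero. *)
Lemma rellich_stable alpha U Omega (a : R) : 0 < a -> N%:R = 4 + 2 * a ->
  (forall x, 0 < sq x -> sq x ^+ 2 * weight alpha U x <= (a * (a + 2)) ^+ 2) ->
  stable_on alpha U Omega.
Proof.
move=> a0 Na h; apply/stable_onP => phi cphi.
have [M sM _] := C2c_supp cphi; have [C2p _ _] := cphi.
set c2 := (a * (a + 2)) ^+ 2 in h *.
have c20 : 0 < c2 by rewrite exprn_gt0// mulr_gt0//; lra.
pose f (n : nat) x := c2 * phi x ^+ 2 * ((sq x + n.+1%:R^-1)^-1) ^+ 2.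
have den n x : 0 < sq x + n.+1%:R^-1 by rewrite ltr_wpDl ?sq_ge0.
have cf n : continuous (f n).
  have [cp _ _ _ _] := C2p; have cq := @sq_continuous R N.
  by rewrite /f; cont; rewrite gt_eqF.
have f0 n x : 0 <= f n x.
  by apply: mulr_ge0; [apply: mulr_ge0; [exact: ltW|exact: sqr_ge0]|exact: sqr_ge0].
have nd x : {homo f ^~ x : n m / (n <= m)%N >-> n <= m}.
  move=> n m nm; rewrite /f ler_wpM2l//.
    by apply: mulr_ge0; [exact: ltW|exact: sqr_ge0].
  rewrite ler_pXn2r ?nnegrE ?invr_ge0 ?(ltW (den _ _))// lef_pV2 ?posrE//.
  by rewrite lerD2l lef_pV2 ?posrE// ler_nat.
apply: (@integral_RN_limn_le R N f _ _ (Num.max M 1)) => //.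
- move=> n; split; first by rewrite lt_max ltr01 orbT.
  by move=> x i; rewrite gt_max => /andP[/sM + _]; rewrite /f => ->; rewrite expr0n mulr0 mul0r.
- move=> n; apply: (rellich_reg C2p sM (ltW a0) Na) => //.
- by move=> x; rewrite lee_fin weight_ge0.
move=> x; apply: le_limn_nondecreasing => // s sw.
have [s0|s0] := leP s 0; first by exists 0%N; exact: le_trans (f0 _ _).
have pn : 0 < phi x ^+ 2.
  rewrite lt_neqAle sqr_ge0 andbT eq_sym; apply: contraTneq sw => ->.
  by rewrite mulr0 -leNgt ltW.
have gap : 0 < c2 * phi x ^+ 2 - s * sq x ^+ 2.
  have [q0|q0] := ltP 0 (sq x).
    rewrite subr_gt0; apply: (@lt_le_trans _ _ (weight alpha U x * phi x ^+ 2 * sq x ^+ 2)).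
      by rewrite ltr_pM2r// exprn_gt0.
    have := h x q0; rewrite -(ler_pM2r pn); congr (_ <= _); ring.
  have -> : sq x = 0 by apply/eqP; rewrite eq_le q0 sq_ge0.
  by rewrite expr0n mulr0 subr0 mulr_gt0.
set g := c2 * _ - _ in gap.
have k0 : 0 < s * (2 * sq x + 1) by rewrite mulr_gt0//; have := sq_ge0 x; lra.
(* With D = 1/(n+1) <= 1, the quantity s (|x|^2 + D)^2 exceeds s |x|^4 by at most D s (2 |x|^2 + 1);
   this n brings the excess below the gap g. *)
pose n := Num.trunc (s * (2 * sq x + 1) / g); exists n.
have /andP[_ hn] := truncn_itv (ltW (divr_gt0 k0 gap)).
have {}hn : n.+1%:R^-1 * (s * (2 * sq x + 1)) <= g.
  rewrite mulrC ler_pdivrMr// [leRHS]mulrC -ler_pdivrMr//; exact: ltW.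
rewrite /f; set D := n.+1%:R^-1 in hn *.
have D0 : 0 < D by rewrite invr_gt0.
have D1 : D <= 1 by rewrite invf_le1// ler1n.
have dD : 0 < sq x + D by apply: den.
rewrite exprVn ler_pdivlMr ?exprn_gt0//.
have : D ^+ 2 * s <= D * s by rewrite ler_pM2r// expr2 ger_pMr.
rewrite /g in hn; nra.
Qed.

Lemma compact_sq_le (rho : R) : compact [set x : V | sq x <= rho].
Proof.
apply: bounded_closed_compact.
  exists (rho + 1); split; first exact: num_real.
  move=> y hy x /= xr; have r0 := le_trans (sq_ge0 x) xr.
  apply: le_trans (ltW hy); apply: rvnorm_le => [|i]; first by lra.
  have : `|x ord0 i| ^+ 2 <= rho.
    apply: le_trans xr; rewrite /sq (bigD1 i)//= real_normK ?num_real// lerDl.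
    by apply: sumr_ge0 => j _; exact: sqr_ge0.
  have := normr_ge0 (x ord0 i); nra.
rewrite (_ : [set x | _] = sq @^-1` [set r | r <= rho])//.
apply: closed_comp; last exact: closed_le.
by move=> x _; exact: sq_continuous.
Qed.

Lemma log_stable_at_infinity alpha U (a rho : R) : - (2^-1) <= a -> N%:R = 4 + 2 * a ->
  (forall x, rho < sq x -> weight alpha U x <= ((sq x + 1)^-1) ^+ 2 *
     (4 * ((1 + ln (sq x + 1))^-1) ^+ 2 - 32 * (sq x + 1)^-1)) ->
  stable_at_infinity alpha U.
Proof.
move=> a0 Na h; exists [set x | sq x <= rho]; split; first exact: compact_sq_le.
apply/stable_onP => phi cphi.
have [M sM sO] := C2c_supp cphi; have [C2p _ _] := cphi.
pose W x := phi x ^+ 2 * ((sq x + 1)^-1) ^+ 2 *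
     (4 * ((1 + ln (sq x + 1))^-1) ^+ 2 - 32 * (sq x + 1)^-1).
have le x : weight alpha U x * phi x ^+ 2 <= W x.
  have [p0|/sO /=] := eqVneq (phi x) 0; first by rewrite /W p0 expr0n mulr0 !mul0r.
  move=> /negP; rewrite -ltNge => /h H; rewrite /W mulrC -mulrA.
  by rewrite ler_wpM2l ?sqr_ge0.
have cW : Cc W.
  have [cp _ _ _ _] := C2p; have cq := @sq_continuous R N.
  have sp x : 0 < sq x + 1 by rewrite ltr_wpDl// sq_ge0.
  have lg x : 1 + ln (sq x + 1) != 0.
    by rewrite gt_eqF// (@lt_le_trans _ _ 1)// lerDl ln_ge0// lerDr sq_ge0.
  apply: (jet_Cc sM); last by move=> x [p0 _ _]; rewrite /W p0 expr0n !mul0r.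
  have ce : continuous (fun x : V => (1 + ln (sq x + 1))^-1).
    apply: contV => //; apply: contD; first exact: cst_continuous.
    apply: cont_comp_at => [|x]; first by cont.
    exact: continuous_ln.
  have cd : continuous (fun x : V => (sq x + 1)^-1) by cont; rewrite gt_eqF.
  by rewrite /W; cont.
have [] := @integral_RN_le R N (fun x => (weight alpha U x * phi x ^+ 2)%:E)
  (fun x => (W x)%:E).
- by move=> x; rewrite lee_fin weight_ge0.
- by move=> x; rewrite lee_fin.
rewrite (integral_RNE cW) => _ H; apply: le_trans H _; rewrite lee_fin.
exact: (log_rellich C2p sM a0 Na cW).
Qed.

End StabilityCriteria.

Section RadialCriteria.
Context {R : realType}.
Implicit Types (alpha : R) (u : R -> R).

(* Emden-Fowler variables: t = ln r and r^(4 + alpha) e^u = e^w. *)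
Definition emden alpha u (t : R) := u (expR t) + (4 + alpha) * t.

Lemma weight_emden N alpha u (x : 'rV[R]_N) : 0 < sq x ->
  sq x ^+ 2 * weight alpha (radial N u) x = expR (emden alpha u (2^-1 * ln (sq x))).
Proof.
move=> q0; have e0 : 0 < enorm x by rewrite sqrtr_gt0.
have lE : 2^-1 * ln (sq x) = ln (enorm x).
  have -> : sq x = enorm x ^+ 2 by rewrite sqr_sqrtr// ltW.
  by rewrite lnXn// -[ln _ *+ 2]mulr_natl mulKf.
have A : sq x ^+ 2 = expR (4 * ln (enorm x)).
  rewrite expRM_natl lnK ?posrE// -[4%N]/(2 * 2)%N exprM sqr_sqrtr//.
  exact: ltW.
rewrite /emden lE lnK ?posrE// A /weight /radial /powR gt_eqF// -!expRD.
by congr expR; ring.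
Qed.

Lemma emden_stable N alpha u (a : R) Omega : 0 < a -> N%:R = 4 + 2 * a ->
  (forall t, expR (emden alpha u t) <= (a * (a + 2)) ^+ 2) ->
  stable_on alpha (radial N u) Omega.
Proof.
move=> a0 Na h; apply: (rellich_stable a0 Na) => x x0.
by rewrite weight_emden.
Qed.

(** The exponential decay of e^w beats the critical logarithmic weight, which is of order 1 /
    t^2. *)
Lemma emden_stable_at_infinity N alpha u (a C c T : R) :
  - (2^-1) <= a -> N%:R = 4 + 2 * a -> 0 < c ->
  (forall t, T <= t -> emden alpha u t <= C - c * t) ->
  stable_at_infinity alpha (radial N u).
Proof.
(* The cap 2 makes e^(-k t) dominate 1 / (|x|^2 + 1) as well. The negative term of the weight is
   then absorbed by the 8 in B, since 4 B = 4 e^C + 32. *)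
move=> a0 Na c0 h; pose k := Num.min c 2.
have k0 : 0 < k by rewrite lt_min c0 ltr0n.
have kc : k <= c by rewrite /k ge_min lexx.
have k2 : k <= 2 by rewrite /k ge_min lexx orbT.
pose B := expR C + 8; have B0 : 0 < B by rewrite /B; have := expR_gt0 C; lra.
(* From (k t / 3)^3 <= e^(k t), the bound 16 B t^2 <= e^(k t) follows for t >= 432 B / k^3, where
   432 = 16 * 27; S leaves some room. *)
pose S := 648 * B / k ^+ 3.
pose T' := Num.max T (Num.max 1 S).
apply: (@log_stable_at_infinity R N alpha _ a (expR (2 * T')) a0 Na) => x hx.
have q0 : 0 < sq x := lt_trans (expR_gt0 _) hx.
set t := 2^-1 * ln (sq x).
have qE : sq x = expR (2 * t) by rewrite /t mulVKf// lnK.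
have tT : T' <= t.
  by move: hx; rewrite qE ltr_expR ltr_pM2l// => /ltW.
move: tT; rewrite !ge_max => /and3P[tT t1 tS].
have q1 : 1 <= sq x by rewrite qE -[leLHS]expR0 ler_expR; lra.
have qn := gt_eqF q0.
rewrite -(ler_pM2l (exprn_gt0 2 q0)) weight_emden// -/t.
apply: (@le_trans _ _ (expR C * expR (- k * t))).
  rewrite -expRD ler_expR; apply: le_trans (h t tT) _.
  have : k * t <= c * t by rewrite ler_wpM2r//; lra.
  by lra.
set y := (sq x + 1)^-1.
have s0 : 0 < sq x + 1 by lra.
have y0 : 0 < y by rewrite invr_gt0.
have qy : 2^-1 <= sq x * y by rewrite ler_pdivlMr//; lra.
have yk : y <= expR (- k * t).
  apply: (@le_trans _ _ (sq x)^-1); first by rewrite lef_pV2 ?posrE//; lra.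
  rewrite qE -expRN ler_expR.
  have : k * t <= 2 * t by rewrite ler_wpM2r//; lra.
  by lra.
have lb : ln (sq x + 1) <= 2 * t + 1.
  rewrite -[leRHS]expRK ler_ln ?posrE ?expR_gt0// expRD -qE.
  have := expR_ge1Dx (1 : R); nra.
have l0 : 0 <= ln (sq x + 1) by rewrite ln_ge0//; lra.
have lam : (2 + 2 * t)^-1 <= (1 + ln (sq x + 1))^-1.
  by rewrite lef_pV2 ?posrE; lra.
have lam2 : (2 + 2 * t)^-1 ^+ 2 <= (1 + ln (sq x + 1))^-1 ^+ 2.
  by rewrite ler_pXn2r ?nnegrE ?invr_ge0//; lra.
set z := (1 + ln (sq x + 1))^-1 in lam lam2 *.
have main : 4 * B * expR (- k * t) <= (1 + t) ^- 2.
  rewrite -[leRHS]mul1r ler_pdivlMr ?exprn_gt0//; last by lra.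
  have e3 : (k * t / 3) ^+ 3 <= expR (k * t).
    have x0 : 0 <= k * t / 3 by rewrite divr_ge0// mulr_ge0//; lra.
    have {2}-> : k * t = 3%:R * (k * t / 3) by field.
    rewrite expRM_natl ler_pXn2r ?nnegrE ?expR_ge0//.
    by apply: le_trans (expR_ge1Dx _); lra.
  have e4 : 0 < expR (- k * t) by exact: expR_gt0.
  have e5 : expR (k * t) * expR (- k * t) = 1 by rewrite -expRD mulNr subrr expR0.
  have t2 : (1 + t) ^+ 2 <= 4 * t ^+ 2 by nra.
  have big : 16 * B * t ^+ 2 <= (k * t / 3) ^+ 3.
    have -> : (k * t / 3) ^+ 3 = k ^+ 3 * t / 27 * t ^+ 2 by field.
    rewrite ler_wpM2r ?sqr_ge0// ler_pdivlMr//.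
    have : 648 * B <= t * k ^+ 3 by rewrite -ler_pdivrMr ?exprn_gt0.
    lra.
  rewrite -[leRHS]e5 mulrAC ler_wpM2r ?(ltW e4)//.
  apply: le_trans e3; apply: le_trans big.
  have : 4 * B * (1 + t) ^+ 2 <= 4 * B * (4 * t ^+ 2) by rewrite ler_wpM2l// mulr_ge0// ltW.
  by lra.
have v2 : (2 + 2 * t)^-1 ^+ 2 = (1 + t) ^- 2 / 4 by field; lra.
set w := expR (- k * t) in main yk *.
have w0 : 0 < w by exact: expR_gt0.
have {}lam2 : 4 * B * w <= 4 * z ^+ 2 by rewrite v2 in lam2; lra.
have low : 4 * expR C * w <= 4 * z ^+ 2 - 32 * y by rewrite /B in lam2; lra.
have qy2 : 4^-1 <= sq x ^+ 2 * y ^+ 2.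
  by rewrite -exprMn; have : 0 < 2^-1 :> R by []; nra.
rewrite mulrA.
have ec : 0 < expR C * w by rewrite mulr_gt0// expR_gt0.
have : 4^-1 * (4 * expR C * w) <= sq x ^+ 2 * y ^+ 2 * (4 * z ^+ 2 - 32 * y).
  by apply: ler_pM => //; rewrite -mulrA mulr_ge0// ltW.
by lra.
Qed.

End RadialCriteria.

(** * Instability criteria *)

Section PositivePart.
Context {R : realType}.

(** The cube of the positive part is C^2: the cutoffs in the test functions are built from such
    cubes, while [pos] itself serves for continuous bumps. *)
Definition pos (t : R) : R := Num.max 0 t.

Lemma pos_ge0 t : 0 <= pos t.
Proof. by rewrite le_max lexx. Qed.

Lemma pos_gt0E t : 0 < t -> pos t = t.
Proof. by move=> t0; rewrite /pos max_r// ltW. Qed.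

Lemma pos_le0E t : t <= 0 -> pos t = 0.
Proof. by move=> t0; rewrite /pos max_l. Qed.

Lemma pos_le t s : 0 <= s -> t <= s -> pos t <= s.
Proof. by move=> s0 ts; rewrite ge_max s0. Qed.

Lemma pos_continuous : continuous pos.
Proof.
move=> t; apply: (@continuous_max R R (fun _ => 0) id t); first exact: cvg_cst.
exact: cvg_id.
Qed.

Lemma hasd_pos2 : hasd (fun t => pos t ^+ 2) (fun t => 2 * pos t).
Proof.
move=> t; have [t0|t0|->] := ltgtP t 0.
- rewrite pos_le0E ?mulr0; last exact: ltW.
  apply: (isd_near _ (isd_cst t 1 0)); near=> s.
  rewrite pos_le0E ?expr0n//; apply/ltW.
  by near: s; exact: lt_nbhsl.
- rewrite pos_gt0E//; apply: (@isd_near _ _ _ _ (fun t : R => t ^+ 2)).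
    near=> s; rewrite pos_gt0E//.
    by near: s; exact: lt_nbhsr.
  by der; rewrite /= expr1 mulr1.
- rewrite pos_le0E// mulr0.
  have L : (fun h : R => h^-1 *: (((fun t => pos t ^+ 2) \o shift 0) (h *: 1) -
      pos 0 ^+ 2)) @ 0^' --> (0 : R).
    apply/cvgrPdist_le => e e0; near=> h; rewrite sub0r normrN /=.
    rewrite [h *: 1]mulr1 addr0 [pos 0]pos_le0E// expr0n subr0.
    rewrite [_ *: _]mulrC; have h0 : h != 0 by near: h; exact: nbhs_dnbhs_neq.
    rewrite normrM normfV ler_pdivrMr ?normr_gt0//.
    have he : `|h| <= e by near: h; exact: dnbhs0_le.
    have ph : `|pos h| <= `|h|.
      by rewrite ger0_norm ?pos_ge0// pos_le// ler_norm.
    by rewrite normrX expr2 ler_pM//; exact: le_trans ph he.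
  split; first by apply/cvg_ex; eexists; exact: L.
  exact/cvg_lim.
Unshelve. all: by end_near. Qed.

Lemma hasd_pos3 : hasd (fun t => pos t ^+ 3) (fun t => 3 * pos t ^+ 2).
Proof.
have E t : pos t ^+ 2 * t = pos t ^+ 3.
  have [t0|t0] := leP t 0; first by rewrite pos_le0E// !expr0n mul0r.
  by rewrite pos_gt0E// -exprSr.
move=> t; have -> : (fun t => pos t ^+ 3) = (fun t => pos t ^+ 2 * t).
  by apply/funext => s; rewrite E.
have h2 := hasd_pos2; apply: isd_eq; first exact: isdM (h2 t) (isd_id t).
by rewrite mulr1 [t * _]mulrCA; have [t0|t0] := leP t 0;
  [rewrite pos_le0E//|rewrite pos_gt0E//]; ring.
Qed.

End PositivePart.

(** * Radial functions written in the variable t = ln |x| *)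

Section RadialFunctions.
Context {R : realType} {N : nat}.
Notation V := 'rV[R]_N.
Implicit Types (k l : R -> R) (v : R) (x : V).

(** A function of t = ln |x|, completed by the value [v] at the origin. Regularity is obtained when
    [k] is constantly [v] near -oo, which makes the function constant near the origin. *)
Definition rad k v x : R := if 0 < sq x then k (2^-1 * ln (sq x)) else v.

Lemma expR_logr x : 0 < sq x -> expR (2 * (2^-1 * ln (sq x))) = sq x.
Proof. by move=> x0; rewrite mulVKf// lnK. Qed.

Lemma near_sq_gt x : 0 < sq x -> nbhs x [set z : V | 0 < sq z].
Proof.
move=> x0; near=> z; near: z.
have c0 := @sq_continuous R N; exact: (cvgr_gt _ (c0 x)).
Unshelve. all: by end_near. Qed.

Lemma near_sq_lt x (c : R) : sq x < c -> nbhs x [set z : V | sq z < c].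
Proof.
move=> x0; near=> z; near: z.
have c0 := @sq_continuous R N; exact: (cvgr_lt _ (c0 x)).
Unshelve. all: by end_near. Qed.

Lemma rad_tail k v t0 x : (forall t, t <= t0 -> k t = v) ->
  sq x < expR (2 * t0) -> rad k v x = v.
Proof.
move=> kv xt; rewrite /rad; case: ifPn => // x0; apply: kv.
have : 2 * (2^-1 * ln (sq x)) < 2 * t0 by rewrite -ltr_expR expR_logr.
lra.
Qed.

Lemma rad_continuous k v t0 : continuous k -> (forall t, t <= t0 -> k t = v) ->
  continuous (rad k v).
Proof.
move=> ck kv x; have [x0|x0] := ltP 0 (sq x).
  apply: (@cont_near _ _ (fun z : V => k (2^-1 * ln (sq z)))).
    by apply: filterS (near_sq_gt x0) => z /= z0; rewrite /rad z0.
  apply: (@continuous_comp _ _ _ (fun z : V => 2^-1 * ln (sq z))); last exact: ck.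
  apply: (@continuousM _ _ (fun _ => 2^-1) (fun z => ln (sq z))); first exact: cst_continuous.
  by apply: continuous_comp; [exact: sq_continuous|exact: continuous_ln].
have xt : sq x < expR (2 * t0) by apply: le_lt_trans x0 (expR_gt0 _).
apply: (@cont_near _ _ (fun z : V => v)); last exact: cst_continuous.
by apply: filterS (near_sq_lt xt) => z /= zt; rewrite (rad_tail kv zt).
Qed.

(** The derivative is a coordinate times another radial function, so the rule applies to it again;
    e^(-2 t) = |x|^(-2) comes from differentiating ln |x|. *)
Lemma isd_rad k k1 v t0 (i : 'I_N) x : hasd k k1 ->
  (forall t, t <= t0 -> k t = v) ->
  isd x (evec R i) (rad k v) (x ord0 i * rad (fun t => k1 t * expR (- 2 * t)) 0 x).
Proof.
move=> hk kv; have [x0|x0] := ltP 0 (sq x).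
  apply: (@isd_near _ _ _ _ (fun z : V => k (2^-1 * ln (sq z)))).
    by apply: filterS (near_sq_gt x0) => z /= z0; rewrite /rad z0.
  apply: isd_eq; first apply: isd_outer; first exact: hk.
    apply: isdM; first exact: isd_cst.
    by apply: isd_ln => //; exact: isd_sq.
  rewrite /rad x0 mulNr expRN expR_logr// mulr0 addr0.
  by field; rewrite gt_eqF.
have xt : sq x < expR (2 * t0) by apply: le_lt_trans x0 (expR_gt0 _).
rewrite [rad _ 0 x]/rad ltNge x0 mulr0.
apply: (isd_near _ (isd_cst x (evec R i) v)).
by apply: filterS (near_sq_lt xt) => z /= zt; rewrite (rad_tail kv zt).
Qed.

Lemma rad_Cc k v t0 t1 : continuous k -> (forall t, t <= t0 -> k t = v) ->
  (forall t, t1 <= t -> k t = 0) -> Cc (rad k v).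
Proof.
move=> ck kv k0; split; first exact: rad_continuous kv.
exists (expR t1) => x i xi.
have sx : expR (2 * t1) <= sq x.
  rewrite /sq (bigD1 i)//= expRM_natl -[x ord0 i ^+ 2]real_normK ?num_real//.
  rewrite ler_wpDr//; first by apply: sumr_ge0 => j _; exact: sqr_ge0.
  by rewrite ler_pXn2r ?nnegrE ?expR_ge0// ltW.
have x0 : 0 < sq x := lt_le_trans (expR_gt0 _) sx.
rewrite /rad x0; apply: k0.
have : 2 * t1 <= 2 * (2^-1 * ln (sq x)) by rewrite -ler_expR expR_logr.
lra.
Qed.

Lemma radD k l x : rad k 0 x + rad l 0 x = rad (fun t => k t + l t) 0 x.
Proof. by rewrite /rad; case: ifPn => //; rewrite addr0. Qed.

Lemma radZ c k x : c * rad k 0 x = rad (fun t => c * k t) 0 x.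
Proof. by rewrite /rad; case: ifPn => //; rewrite mulr0. Qed.

Lemma rad_sq k x : sq x * rad k 0 x = rad (fun t => expR (2 * t) * k t) 0 x.
Proof. by rewrite /rad; case: ifPn => // x0; rewrite ?expR_logr// mulr0. Qed.

Lemma eq_rad k l x : (forall t, k t = l t) -> rad k 0 x = rad l 0 x.
Proof. by move=> kl; rewrite /rad; case: ifPn. Qed.

(* The field x e^(-Nt) Gam(t) has divergence e^(-Nt) Gam'(t). *)
Lemma Iv_rad_div (Gam dGam : R -> R) t0 t1 : hasd Gam dGam -> continuous dGam ->
  (forall t, t <= t0 -> Gam t = 0) -> (forall t, t1 <= t -> Gam t = 0) ->
  (forall t, t <= t0 -> dGam t = 0) -> (forall t, t1 <= t -> dGam t = 0) ->
  Iv (rad (fun t => expR (- N%:R * t) * dGam t) 0) = 0.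
Proof.
move=> hG cdG G0 G1 dG0 dG1.
pose g t := expR (- N%:R * t) * Gam t.
pose g1 t := expR (- N%:R * t) * dGam t - N%:R * (expR (- N%:R * t) * Gam t).
have hg : hasd g g1 by move=> t; rewrite /g /g1; der; ring.
have cG := hasd_cont hG; have cg := hasd_cont hg.
have cg1 : continuous g1 by rewrite /g1; cont.
pose g2 t := g1 t * expR (- 2 * t).
have cg2 : continuous g2 by rewrite /g2; cont.
have z0 t : t <= t0 -> g t = 0 by move=> tt; rewrite /g G0// mulr0.
have z1 t : t1 <= t -> g t = 0 by move=> tt; rewrite /g G1// mulr0.
have w0 t : t <= t0 -> g2 t = 0.
  by move=> tt; rewrite /g2 /g1 G0// dG0// !mulr0 subr0 mul0r.
have w1 t : t1 <= t -> g2 t = 0.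
  by move=> tt; rewrite /g2 /g1 G1// dG1// !mulr0 subr0 mul0r.
have crg := rad_Cc cg z0 z1; have crg2 := rad_Cc cg2 w0 w1.
have cx := @rvcoord_continuous R N.
pose X (i : 'I_N) x := x ord0 i * rad g 0 x.
pose dX (i : 'I_N) x := x ord0 i * (x ord0 i * rad g2 0 x) + rad g 0 x.
have hX i x : isd x (evec R i) (X i) (dX i x).
  apply: isd_eq; first exact: isdM (isd_coord x i i) (isd_rad i x hg z0).
  by rewrite eqxx mulr1n mulr1 /dX.
have cX i : Cc (X i) by apply: CcM.
have cdX i : Cc (dX i) by apply: CcD => //; apply: CcM => //; exact: CcM.
have : Iv (fun x => \sum_(i < N) dX i x) = 0.
  by rewrite Iv_sum// big1// => i _; exact: (Iv_pderiv (cX i) (cdX i) (hX i)).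
move=> h0; apply: etrans h0; congr Iv; apply/funext => x.
rewrite /dX big_split /= sumr_const card_ord -[rad g 0 x *+ N]mulr_natl.
have -> : \sum_(i < N) x ord0 i * (x ord0 i * rad g2 0 x) = sq x * rad g2 0 x.
  by rewrite mulr_suml; apply: eq_bigr => i _; rewrite mulrA.
rewrite rad_sq radZ radD; apply: eq_rad => t.
have e2 : expR (2 * t) * expR (- 2 * t) = 1 by rewrite -expRD mulNr subrr expR0.
by rewrite /g2 /g1 /g; ring: e2.
Qed.

(** Replaces polar coordinates. A multiple r of a fixed bump b is subtracted so that e^(N t) (g - r
    b) has total integral 0 in t; then g - r b is a divergence by [Iv_rad_div]. Hence the integral
    of g is r times the positive integral of b, and r has the sign of [Gam t1 - Gam t0]. *)
Lemma Iv_rad_lt0 (g Gam : R -> R) t0 t1 : (0 < N)%N -> continuous g ->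
  (forall t, t <= t0 -> g t = 0) -> (forall t, t1 <= t -> g t = 0) ->
  hasd Gam (fun t => expR (N%:R * t) * g t) -> Gam t1 < Gam t0 ->
  Iv (rad g 0) < 0.
Proof.
move=> N0 cg g0 g1 hG Glt.
pose b t := pos (t * (1 - t)) : R.
have cb : continuous b by rewrite /b; apply: cont_comp; [cont|exact: pos_continuous].
have b0 t : t <= 0 -> b t = 0 by move=> tt; rewrite /b pos_le0E//; nra.
have b1 t : 1 <= t -> b t = 0 by move=> tt; rewrite /b pos_le0E//; nra.
have cb' : continuous (fun t : R => expR (N%:R * t) * b t) by cont.
have [Z hZ _] := primitive cb'.
have cst (F dF : R -> R) (s t : R) : hasd F dF -> s <= t ->
    (forall r, s <= r -> r <= t -> dF r = 0) -> F s = F t.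
  move=> hF st zF; apply/eqP; rewrite eq_le; apply/andP; split.
    by apply: (der_le hF) => // r rs rt; rewrite zF.
  rewrite -lerN2; apply: (@der_le _ (fun t => - F t) (fun t => - dF t)) => //.
    by move=> r; have := hF r => hr; der.
  by move=> r rs rt; rewrite zF// oppr0.
have zpos : Z 0 < Z 1.
  have [c /andP[c0 c1] E] := der_mvt hZ ltr01.
  rewrite -subr_gt0 E; apply: mulr_gt0; last by lra.
  apply: mulr_gt0; first exact: expR_gt0.
  by rewrite /b pos_gt0E mulr_gt0//; lra.
pose m0 := Num.min t0 0; pose m1 := Num.max t1 1.
have [m00 m01] : m0 <= t0 /\ m0 <= 0 by rewrite /m0 !ge_min !lexx orbT.
have [m10 m11] : t1 <= m1 /\ 1 <= m1 by rewrite /m1 !le_max !lexx orbT.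
pose r := (Gam t1 - Gam t0) / (Z 1 - Z 0).
have r0 : r < 0 by rewrite /r ltr_pdivrMr; lra.
pose F t := (Gam t - Gam t0) - r * (Z t - Z 0).
pose dF t := expR (N%:R * t) * g t - r * (expR (N%:R * t) * b t).
have hF : hasd F dF by move=> t; rewrite /F /dF; der; ring.
have dF0 t : t <= m0 -> dF t = 0.
  by move=> tm; rewrite /dF g0 ?b0 ?mulr0 ?subr0//; apply: le_trans tm _.
have dF1 t : m1 <= t -> dF t = 0.
  by move=> tm; rewrite /dF g1 ?b1 ?mulr0 ?subr0//; apply: le_trans tm.
have F0 t : t <= m0 -> F t = 0.
  move=> tm; rewrite /F.
  rewrite (cst _ _ t t0 hG); last first.
  - by move=> s _ st; rewrite g0 ?mulr0.
  - exact: le_trans tm m00.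
  rewrite (cst _ _ t 0 hZ); last first.
  - by move=> s _ st; rewrite b0 ?mulr0.
  - exact: le_trans tm m01.
  by rewrite !subrr mulr0 subr0.
have F1 t : m1 <= t -> F t = 0.
  move=> tm; rewrite /F.
  rewrite -(cst _ _ t1 t hG); last first.
  - by move=> s st _; rewrite g1 ?mulr0.
  - exact: le_trans m10 tm.
  rewrite -(cst _ _ 1 t hZ); last first.
  - by move=> s st _; rewrite b1 ?mulr0.
  - exact: le_trans m11 tm.
  by rewrite /r divfK ?subrr// gt_eqF// subr_gt0.
have cdF : continuous dF by rewrite /dF; cont.
have := Iv_rad_div hF cdF F0 F1 dF0 dF1.
have -> : rad (fun t => expR (- N%:R * t) * dF t) 0 =
    (fun x => rad g 0 x + (- r) * rad b 0 x).
  apply/funext => x; rewrite radZ radD; apply: eq_rad => t.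
  have e1 : expR (- N%:R * t) * expR (N%:R * t) = 1.
    by rewrite -expRD mulNr addNr expR0.
  by rewrite /dF; ring: e1.
rewrite Iv_lin; last 2 first.
- exact: (rad_Cc cg g0 g1).
- exact: (rad_Cc cb b0 b1).
suff : 0 < Iv (rad b 0 : V -> R) by nra.
(* At this point t = 1/2, the middle of the bump. *)
pose x : V := expR 2^-1 *: evec R (Ordinal N0).
have sx : sq x = expR 1.
  rewrite /sq (bigD1 (Ordinal N0))//= big1 => [|i /negbTE ni]; last first.
    by rewrite !mxE eqxx ni mulr0 expr0n.
  by rewrite !mxE !eqxx mulr1 addr0 -expRM_natl mulfV.
apply: (@Iv_gt0 _ _ _ x); first exact: (rad_Cc cb b0 b1).
  by move=> z; rewrite /rad; case: ifPn => // _; exact: pos_ge0.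
rewrite /rad sx expR_gt0 expRK mulr1 /b pos_gt0E.
  by rewrite mulr_gt0//; lra.
by rewrite mulr_gt0//; lra.
Qed.

End RadialFunctions.

(** * Radial test functions and instability in dimensions 3 and 4 *)

Section Instability.
Context {R : realType} {N : nat}.
Notation V := 'rV[R]_N.
Implicit Types (k : R -> R) (x : V).

Section RadialTest.
Variables (k k1 k2 : R -> R) (v t0 t1 : R).
Hypotheses (hk : hasd k k1) (hk1 : hasd k1 k2) (ck2 : continuous k2).
Hypotheses (k_low : forall t, t <= t0 -> [/\ k t = v, k1 t = 0 & k2 t = 0]).
Hypotheses (k_high : forall t, t1 <= t -> [/\ k t = 0, k1 t = 0 & k2 t = 0]).

(** [l] multiplies x_i in the gradient of the radial function and [l2] multiplies x_i x_j in its
    Hessian. *)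
Let l (t : R) := k1 t * expR (- 2 * t).
Let l1 (t : R) := (k2 t - 2 * k1 t) * expR (- 2 * t).
Let l2 (t : R) := l1 t * expR (- 2 * t).

Let hl : hasd l l1.
Proof. by move=> t; rewrite /l /l1; der; ring. Qed.

Let cl2 : continuous l2.
Proof. by have c1 := hasd_cont hk1; rewrite /l2 /l1; cont. Qed.

Let l_low t : t <= t0 -> l t = 0.
Proof. by move=> /k_low[_ h _]; rewrite /l h mul0r. Qed.

Let l2_low t : t <= t0 -> l2 t = 0.
Proof. by move=> /k_low[_ h h']; rewrite /l2 /l1 h h' mulr0 subr0 !mul0r. Qed.

Lemma pderiv_rad i : pderiv i (rad k v) = fun x : V => x ord0 i * rad l 0 x.
Proof.
apply/funext => x; have kv t : t <= t0 -> k t = v by case/k_low.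
by have [_ <-] := isd_rad i x hk kv.
Qed.

Lemma isd_pderiv_rad i j x : isd x (evec R j) (pderiv i (rad k v))
  (x ord0 i * (x ord0 j * rad l2 0 x) + rad l 0 x * (i == j)%:R).
Proof.
rewrite pderiv_rad; exact: isdM (isd_coord x i j) (isd_rad j x hl l_low).
Qed.

Lemma pderiv2_rad i j : pderiv j (pderiv i (rad k v)) =
  fun x : V => x ord0 i * (x ord0 j * rad l2 0 x) + rad l 0 x * (i == j)%:R.
Proof. by apply/funext => x; have [_ <-] := isd_pderiv_rad i j x. Qed.

(** In t = ln r, the operator r^2 Delta acts on radial functions as the second derivative plus (N -
    2) times the first. *)
Lemma laplacian_rad x : laplacian (rad k v) x =
  rad (fun t => expR (- 2 * t) * (k2 t + (N%:R - 2) * k1 t)) 0 x.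
Proof.
rewrite /laplacian; under eq_bigr => i _ do rewrite pderiv2_rad eqxx mulr1n mulr1 mulrA.
rewrite big_split /= sumr_const card_ord -[rad l 0 x *+ N]mulr_natl -mulr_suml.
have -> : \sum_(i < N) x ord0 i * x ord0 i = sq x.
  by apply: eq_bigr => i _; rewrite expr2.
rewrite rad_sq radZ radD; apply: eq_rad => t.
have e2 : expR (2 * t) * expR (- 2 * t) = 1 by rewrite -expRD mulNr subrr expR0.
by rewrite /l2 /l1 /l; ring: e2.
Qed.

Lemma C2_rad : C2 (rad k v : V -> R).
Proof.
have kv t : t <= t0 -> k t = v by case/k_low.
have ck := hasd_cont hk; have cx := @rvcoord_continuous R N.
have cl : continuous (rad l 0 : V -> R) := rad_continuous (hasd_cont hl) l_low.
have crl2 : continuous (rad l2 0 : V -> R) := rad_continuous cl2 l2_low.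
split.
- exact: rad_continuous kv.
- by move=> i x; case: (isd_rad i x hk kv).
- by move=> i; rewrite pderiv_rad; cont.
- by move=> i j x; case: (isd_pderiv_rad i j x).
- by move=> i j; rewrite pderiv2_rad; cont.
Qed.

Lemma rad_eq0_high x : expR (2 * t1) <= sq x -> rad k v x = 0.
Proof.
move=> sx; have x0 : 0 < sq x := lt_le_trans (expR_gt0 _) sx.
rewrite /rad x0; have [] // := k_high (_ : t1 <= 2^-1 * ln (sq x)).
have : 2 * t1 <= 2 * (2^-1 * ln (sq x)) by rewrite -ler_expR expR_logr.
lra.
Qed.

Lemma C2c_rad (Omega : set V) : closure [set x : V | rad k v x != 0] `<=` Omega ->
  C2c Omega (rad k v : V -> R).
Proof.
move=> cO; split=> //; first exact: C2_rad.
apply: (subclosed_compact _ (@compact_sq_le R N (expR (2 * t1)))); first exact: closed_closure.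
have cl : closed [set x : V | sq x <= expR (2 * t1)].
  rewrite (_ : [set x | _] = sq @^-1` [set r | r <= expR (2 * t1)])//.
  apply: closed_comp; last exact: closed_le.
  by move=> x _; exact: sq_continuous.
apply: (subset_trans _ cl); apply: closure_subset => x /= h.
by rewrite leNgt; apply: contra h => /ltW /rad_eq0_high ->.
Qed.

Lemma closure_rad x : v = 0 -> closure [set x : V | rad k v x != 0] x ->
  expR (2 * t0) <= sq x.
Proof.
move=> v0.
have cl : closed [set x : V | expR (2 * t0) <= sq x].
  rewrite (_ : [set x | _] = sq @^-1` [set r | expR (2 * t0) <= r])//.
  apply: closed_comp; last exact: closed_ge.
  by move=> z _; exact: sq_continuous.
have kv t : t <= t0 -> k t = v by case/k_low.
suff H : closure [set x : V | rad k v x != 0] `<=` [set x : V | expR (2 * t0) <= sq x].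
  exact: H.
apply: (subset_trans _ cl); apply: closure_subset => z /= h.
by rewrite leNgt; apply: contra h => zt; rewrite (rad_tail kv zt) v0.
Qed.

(** [h] is a continuous compactly supported minorant of the weight term, so that its integral is
    exact. [Gam] is a primitive of the radial energy density, and its decrease from t0 to t1 makes
    the energy negative. *)
Lemma rad_unstable alpha u (h Gam : R -> R) (Omega : set V) : (0 < N)%N ->
  closure [set x : V | rad k v x != 0] `<=` Omega ->
  continuous h -> (forall t, 0 <= h t) ->
  (forall t, t <= t0 -> h t = 0) -> (forall t, t1 <= t -> h t = 0) ->
  (forall t, h t <= expR (emden alpha u t) * expR (- 4 * t) * k t ^+ 2) ->
  hasd Gam (fun t => expR (N%:R * t) *
     ((expR (- 2 * t) * (k2 t + (N%:R - 2) * k1 t)) ^+ 2 - h t)) ->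
  Gam t1 < Gam t0 ->
  ~ stable_on alpha (radial N u) Omega.
Proof.
move=> N0 cO ch h0 hlow hhigh hle hG Glt /stable_onP st.
have cphi := C2c_rad cO.
have := st _ cphi; apply/negP; rewrite -ltNge.
pose q t := (expR (- 2 * t) * (k2 t + (N%:R - 2) * k1 t)) ^+ 2.
have q_low t : t <= t0 -> q t = 0.
  by move=> /k_low[_ a b]; rewrite /q a b; ring.
have q_high t : t1 <= t -> q t = 0.
  by move=> /k_high[_ a b]; rewrite /q a b; ring.
have cq : continuous q by have c1 := hasd_cont hk1; rewrite /q; cont.
have Eq : (fun x : V => laplacian (rad k v) x ^+ 2) = rad q 0.
  apply/funext => x; rewrite laplacian_rad /rad /q; case: ifPn => // _.
  by rewrite expr0n.
have crh : Cc (rad h 0 : V -> R) := rad_Cc ch hlow hhigh.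
have crq : Cc (rad q 0 : V -> R) := rad_Cc cq q_low q_high.
have lt : Iv (rad q 0 : V -> R) < Iv (rad h 0 : V -> R).
  have g_low t : t <= t0 -> q t - h t = 0 by move=> tt; rewrite q_low ?hlow ?subr0.
  have g_high t : t1 <= t -> q t - h t = 0 by move=> tt; rewrite q_high ?hhigh ?subr0.
  have cg : continuous (fun t => q t - h t) by cont.
  have := Iv_rad_lt0 N0 cg g_low g_high hG Glt.
  have -> : (rad (fun t => q t - h t) 0 : V -> R) = (fun x => rad q 0 x + (-1) * rad h 0 x).
    apply/funext => x; rewrite radZ radD; apply: eq_rad => t; ring.
  by rewrite Iv_lin//; lra.
rewrite Eq; apply: (@lt_le_trans _ _ (Iv (rad h 0 : V -> R))%:E); first by rewrite lte_fin.
rewrite -(integral_RNE crh).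
have [] // := @integral_RN_le R N (fun x => (rad h 0 x)%:E)
   (fun x => (weight alpha (radial N u) x * rad k v x ^+ 2)%:E).
  by move=> x; rewrite lee_fin /rad; case: ifPn.
move=> x; rewrite lee_fin; have [x0|x0] := ltP 0 (sq x); last first.
  by rewrite [leLHS]/rad ltNge x0; exact: weight_ge0.
have W : weight alpha (radial N u) x =
    expR (emden alpha u (2^-1 * ln (sq x))) * expR (- 4 * (2^-1 * ln (sq x))).
  rewrite -weight_emden// mulrAC -[LHS]mul1r; congr (_ * _).
  have -> : - 4 * (2^-1 * ln (sq x)) = - (2%:R * ln (sq x)) by field.
  by rewrite expRN expRM_natl lnK// mulfV// gt_eqF// exprn_gt0.
by rewrite W /rad x0; exact: hle.
Qed.

End RadialTest.

(** Meant for P = [pos (t / m)], Q = [pos (q t)], I = 1 / m and n = N - 2. Each derivative of the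
    cutoff yields a factor I, and what remains is at most 54 + 18 + 9 * 2 = 90 in absolute value. *)
Lemma cutoff_bound (P Q I n : R) : 0 <= P -> P <= 1 -> 0 <= Q -> Q <= 1 ->
  0 < I -> I <= 1 -> 0 <= n -> n <= 2 ->
  (6 * Q * (- (3 * P ^+ 2 * I)) ^+ 2 + 3 * Q ^+ 2 * - (6 * P * I * I) +
    n * (3 * Q ^+ 2 * - (3 * P ^+ 2 * I))) ^+ 2 <= 90 ^+ 2 * (I * I).
Proof.
move=> P0 P1 Q0 Q1 I0 I1 n0 n1.
have ile (x y : R) : 0 <= x <= 1 -> 0 <= y <= 1 -> 0 <= x * y <= 1.
  by move=> /andP[x0 x1] /andP[y0 y1]; rewrite mulr_ge0//= mulr_ile1.
have iP : 0 <= P <= 1 by rewrite P0.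
have iQ : 0 <= Q <= 1 by rewrite Q0.
have iI : 0 <= I <= 1 by rewrite ltW.
have iPP := ile _ _ iP iP.
have /andP[X0 X1] := ile _ _ (ile _ _ iQ (ile _ _ iPP iPP)) iI.
have /andP[Y0 Y1] := ile _ _ (ile _ _ (ile _ _ iQ iQ) iP) iI.
have iZ := ile _ _ (ile _ _ iQ iQ) iPP; have /andP[Z0 Z1] := iZ.
set A := _ + _.
have -> : A = I * (54 * (Q * (P * P * (P * P)) * I) - 18 * (Q * Q * P * I)
   - 9 * (n * (Q * Q * (P * P)))) by rewrite /A; ring.
have nZ : n * (Q * Q * (P * P)) <= 2 * 1 by apply: ler_pM.
have nZ0 : 0 <= n * (Q * Q * (P * P)) by apply: mulr_ge0.
have B2 (B : R) : - 90 <= B -> B <= 90 -> B ^+ 2 <= 90 ^+ 2.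
  move=> b1 b2; have : 0 <= (90 - B) * (90 + B) by apply: mulr_ge0; lra.
  by lra.
rewrite exprMn mulrC -expr2 ler_wpM2r ?sqr_ge0// B2//; lra.
Qed.

Lemma cutoff_unstable alpha u : (N = 3 \/ N = 4)%N ->
  continuous (emden alpha u) -> ~ stable_on alpha (radial N u) [set: V].
Proof.
move=> N34 cw.
have N2 : 0 <= N%:R - 2 :> R /\ N%:R - 2 <= 2 :> R by case: N34 => ->; split; lra.
(* A bump on [-1, 0], where the cutoff equals 1: it bounds the weight term from below by an amount
   independent of the scale m. *)
pose b (t : R) := pos (- t * (1 + t)).
have cb : continuous b by rewrite /b; apply: cont_comp; [cont|exact: pos_continuous].
pose h t := expR (emden alpha u t) * expR (- 4 * t) * b t.
have ch : continuous h by rewrite /h; cont.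
have b_low t : t <= -1 -> b t = 0 by move=> tt; rewrite /b pos_le0E//; nra.
have b_high t : 0 <= t -> b t = 0 by move=> tt; rewrite /b pos_le0E//; nra.
have b_le t : b t <= 1 by rewrite /b pos_le//; nra.
have h_ge t : 0 <= h t.
  by apply: mulr_ge0; [apply: mulr_ge0; exact: expR_ge0|exact: pos_ge0].
have cH : continuous (fun t : R => expR (N%:R * t) * h t) by cont.
have [H hH _] := primitive cH.
have Hlt : H (-1) < H 0.
  have l0 : -1 < (0 : R) by lra.
  have [c /andP[c0 c1] E] := der_mvt hH l0.
  rewrite -subr_gt0 E; apply: mulr_gt0; last by lra.
  rewrite !mulr_gt0 ?expR_gt0// /b pos_gt0E.
    by rewrite mulr_gt0//; lra.
  by rewrite mulr_gt0//; lra.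
have [C CE] : exists C : R, C = 90 ^+ 2 by exists (90 ^+ 2).
have [m [m1 hm]] : exists L : R, 1 <= L /\ C / L < H 0 - H (-1).
  exists (Num.max 1 ((C + 1) / (H 0 - H (-1)))).
  have d0 : 0 < H 0 - H (-1) by lra.
  split; first by rewrite le_max lexx.
  set L := Num.max _ _.
  have L0 : 0 < L by rewrite lt_max ltr01.
  rewrite ltr_pdivrMr//.
  have : (C + 1) / (H 0 - H (-1)) <= L by rewrite le_max lexx orbT.
  rewrite ler_pdivrMr// mulrC; lra.
have m0 : 0 < m by lra.
(* The cutoff k = [pos] (q)^3 is 1 for t <= 0 and 0 for t >= m; the nested cubes make both junctions
   C^2. *)
pose q (t : R) := 1 - pos (t / m) ^+ 3.
pose q1 (t : R) := - (3 * pos (t / m) ^+ 2 / m).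
pose q2 (t : R) := - (6 * pos (t / m) / m / m).
have hs : hasd (fun t : R => t / m) (fun _ => m^-1).
  by move=> t; der; ring.
have hpq : hasd (fun t => pos (t / m) ^+ 3) (fun t => 3 * pos (t / m) ^+ 2 / m).
  by move=> t; apply: (isd_outer (k := fun t => pos t ^+ 3)); [exact: hasd_pos3|exact: hs].
have hpq2 : hasd (fun t => pos (t / m) ^+ 2) (fun t => 2 * pos (t / m) / m).
  by move=> t; apply: (isd_outer (k := fun t => pos t ^+ 2)); [exact: hasd_pos2|exact: hs].
have hq : hasd q q1 by move=> t; rewrite /q /q1; apply: isd_eq; [apply: isdD (isd_cst _ _ _) (isdN (hpq t))|rewrite add0r].
have hq1 : hasd q1 q2.
  move=> t; rewrite /q1 /q2; apply: isd_eq.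
    by apply: isdN; apply: isdM (isdM (isd_cst _ _ _) (hpq2 t)) (isd_cst _ _ _).
  by cbv beta; ring.
pose k (t : R) := pos (q t) ^+ 3.
pose k1 (t : R) := 3 * pos (q t) ^+ 2 * q1 t.
pose k2 (t : R) := 6 * pos (q t) * q1 t ^+ 2 + 3 * pos (q t) ^+ 2 * q2 t.
have hk : hasd k k1.
  by move=> t; apply: (isd_outer (k := fun t => pos t ^+ 3)); [exact: hasd_pos3|exact: hq].
have hk1 : hasd k1 k2.
  move=> t; rewrite /k1 /k2; apply: isd_eq.
    apply: isdM (hq1 t); apply: isdM; first exact: isd_cst.
    by apply: (isd_outer (k := fun t => pos t ^+ 2)); [exact: hasd_pos2|exact: hq].
  by cbv beta; ring.
have cpq : continuous (fun t => pos (q t)).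
  by apply: cont_comp; [exact: hasd_cont hq|exact: pos_continuous].
have cq1 := hasd_cont hq1.
have cpm : continuous (fun t : R => pos (t / m)).
  by apply: cont_comp; [exact: hasd_cont hs|exact: pos_continuous].
have cq2 : continuous q2 by rewrite /q2; cont.
have ck2 : continuous k2 by rewrite /k2; cont.
have qlow t : t <= 0 -> [/\ q t = 1, q1 t = 0 & q2 t = 0].
  move=> tt; rewrite /q /q1 /q2 pos_le0E; last by rewrite pmulr_lle0 ?invr_gt0.
  by split; ring.
have qhigh t : m <= t -> pos (q t) = 0.
  move=> tt; rewrite pos_le0E// /q subr_le0 exprn_ege1//.
  rewrite pos_gt0E ?ler_pdivlMr ?mul1r//.
  by rewrite divr_gt0//; lra.
have klow t : t <= 0 -> [/\ k t = 1, k1 t = 0 & k2 t = 0].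
  move=> /qlow[a a1 a2]; rewrite /k /k1 /k2 a a1 a2 pos_gt0E//.
  by split; ring.
have klow' t : t <= -1 -> [/\ k t = 1, k1 t = 0 & k2 t = 0].
  by move=> tt; apply: klow; lra.
have khigh t : m <= t -> [/\ k t = 0, k1 t = 0 & k2 t = 0].
  by move=> /qhigh a; rewrite /k /k1 /k2 a; split; ring.
pose f (t : R) := expR (N%:R * t) * (expR (- 2 * t) * (k2 t + (N%:R - 2) * k1 t)) ^+ 2.
have cf : continuous f by have ck1 := hasd_cont hk1; rewrite /f; cont.
have [F hF _] := primitive cf.
have f_le t : 0 <= t -> t <= m -> f t <= C / (m * m).
  move=> t0 tm.
  have E : f t = expR ((N%:R - 4) * t) * (k2 t + (N%:R - 2) * k1 t) ^+ 2.
    rewrite /f exprMn mulrA -expRM_natl -expRD; congr (expR _ * _); ring.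
  (* Here N <= 4 enters: the volume factor does not grow, so the density is O(1 / m^2) over a length
     m. *)
  have e1 : expR ((N%:R - 4) * t) <= 1.
    rewrite -[leRHS]expR0 ler_expR mulr_le0_ge0// subr_le0.
    by case: N34 => ->; rewrite ler_nat.
  have pm0 : 0 <= pos (t / m) by exact: pos_ge0.
  have pm1 : pos (t / m) <= 1 by rewrite pos_le// ler_pdivrMr// mul1r.
  have pq0 : 0 <= pos (q t) by exact: pos_ge0.
  have pq1 : pos (q t) <= 1 by rewrite pos_le// /q gerBl exprn_ge0.
  have i0 : 0 < m^-1 by rewrite invr_gt0.
  have i1 : m^-1 <= 1 by rewrite invf_le1.
  rewrite E /k1 /k2 /q1 /q2 invfM.
  have := cutoff_bound pm0 pm1 pq0 pq1 i0 i1 N2.1 N2.2; rewrite -CE => AI.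
  rewrite -[leRHS]mul1r; apply: ler_pM; last exact: AI.
  - exact: expR_ge0.
  - exact: sqr_ge0.
  - exact: e1.
have fz t : t <= 0 -> f t = 0 by move=> /klow[_ a a']; rewrite /f a a'; ring.
apply: (rad_unstable (k := k) (k1 := k1) (k2 := k2) (v := 1) (t0 := -1) (t1 := m)
   (h := h) (Gam := fun t => F t - H t) hk hk1 ck2 klow' khigh) => //.
- by case: N34 => ->.
- by move=> t tt; rewrite /h b_low ?mulr0.
- by move=> t tt; rewrite /h b_high ?mulr0//; lra.
- move=> t; rewrite /h; have [tt|tt] := leP t 0.
    have [-> _ _] := klow t tt; rewrite expr1n mulr1.
    apply: ler_piMr; last exact: b_le.
    by apply: mulr_ge0; exact: expR_ge0.
  rewrite b_high ?(ltW tt)// mulr0; apply: mulr_ge0; last exact: sqr_ge0.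
  by apply: mulr_ge0; exact: expR_ge0.
- by move=> t; rewrite mulrBr; apply: isdD; [exact: hF|apply: isdN; exact: hH].
have F0 : F (-1) = F 0.
  apply/eqP; rewrite eq_le; apply/andP; split.
    by apply: (der_le hF) (lerN10 R) => t _ t0; rewrite fz.
  rewrite -lerN2; apply: (@der_le _ (fun t => - F t) (fun t => - f t)); last exact: lerN10.
    by move=> t; apply: isdN.
  by move=> t _ t0; rewrite fz// oppr0.
have Fm : F m - F 0 <= C / m.
  have [c /andP[c0 cm] ->] := der_mvt hF m0.
  have := f_le c (ltW c0) (ltW cm); rewrite subr0 => fc.
  apply: le_trans (ler_wpM2r (ltW m0) fc) _.
  by rewrite invfM mulrA mulfVK// gt_eqF.
have Hm : H 0 <= H m.
  apply: (der_le hH) => [t _ _|]; last exact: ltW m0.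
  by rewrite mulr_ge0// expR_ge0.
by lra.
Qed.

End Instability.

(** * Instability outside every compact set *)

Section ExteriorInstability.
Context {R : realType} {N : nat}.
Notation V := 'rV[R]_N.

Lemma compact_sq_bound (K : set V) : compact K ->
  exists rho : R, forall x, K x -> sq x <= rho.
Proof.
move=> /compact_bounded[M [_ hM]]; exists (N%:R * (M + 1) ^+ 2) => x Kx.
have xM : `|x| <= M + 1 by apply: hM => //; rewrite ltrDl.
apply: (@le_trans _ _ (\sum_(i < N) (M + 1) ^+ 2)); last first.
  by rewrite sumr_const card_ord mulr_natl.
apply: ler_sum => i _; rewrite -[leLHS]real_normK ?num_real//.
have xi : `|x ord0 i| <= M + 1 := le_trans (rvnorm_ge x i) xM.
by rewrite ler_pXn2r ?nnegrE//; apply: le_trans xi.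
Qed.

(** With y = P^3 and I = 1 / L, the left side is (y'' + 2 y' - c y)^2 + 2 psi y y'. Derivatives of y
    carry factors I, so only c^2 y^2 survives up to an error of order I. *)
Lemma hump_bound (P d I c psi : R) : 0 <= P -> P <= 1 -> - 1 <= d -> d <= 1 ->
  0 < I -> I <= 1 -> 0 <= c -> forall B, - B <= psi -> psi <= B ->
  ((6 * P * d ^+ 2 - 6 * P ^+ 2) * I * I + 2 * (3 * P ^+ 2 * d * I) - c * P ^+ 3) ^+ 2
    + 2 * psi * P ^+ 3 * (3 * P ^+ 2 * d * I)
  <= c ^+ 2 * (P ^+ 3) ^+ 2 + (324 + 36 * c + 6 * B) * I.
Proof.
move=> P0 P1 d0 d1 I0 I1 c0 B p0 p1.
have I0' := ltW I0.
have bnd (x y : R) : -1 <= x -> x <= 1 -> -1 <= y -> y <= 1 -> -1 <= x * y /\ x * y <= 1.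
  by move=> *; split; nra.
have mP : -1 <= P by lra.
have mI : -1 <= I by lra.
have [a0 a1] := bnd _ _ mP P1 mP P1.
have [b0 b1] := bnd _ _ d0 d1 d0 d1.
have [e0 e1] := bnd _ _ mP P1 b0 b1.
have [f0 f1] := bnd _ _ a0 a1 d0 d1.
have [g0 g1] := bnd _ _ a0 a1 mP P1.
have [h0 h1] := bnd _ _ e0 e1 mI I1.
have [i0 i1] := bnd _ _ a0 a1 mI I1.
have [j0 j1] := bnd _ _ g0 g1 f0 f1.
pose Z := 6 * (P * (d * d) * I) - 6 * (P * P * I) + 6 * (P * P * d).
have Zb : - 18 <= Z /\ Z <= 18 by rewrite /Z; split; lra.
have Z2 : Z ^+ 2 * I <= 324.
  have : 0 <= (18 - Z) * (18 + Z) by apply: mulr_ge0; lra.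
  have := sqr_ge0 Z; nra.
have cZ : - (2 * c * (P * P * P) * Z) <= 36 * c.
  have : - (P * P * P * Z) <= 18 by nra.
  nra.
have pZ : 2 * psi * (P * P * P) * (3 * (P * P * d)) <= 6 * B.
  have : psi * (P * P * P * (P * P * d)) <= B by nra.
  lra.
have -> : ((6 * P * d ^+ 2 - 6 * P ^+ 2) * I * I + 2 * (3 * P ^+ 2 * d * I) - c * P ^+ 3) ^+ 2
    + 2 * psi * P ^+ 3 * (3 * P ^+ 2 * d * I) =
   c ^+ 2 * (P ^+ 3) ^+ 2 + (Z ^+ 2 * I - 2 * c * (P * P * P) * Z +
    2 * psi * (P * P * P) * (3 * (P * P * d))) * I by rewrite /Z; ring.
rewrite lerD2l ler_wpM2r//; lra.
Qed.

(** The factor e^(-a t) turns the energy density in t into (y'' + 2 y' - c y)^2 - e^w y^2. Writing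
    e^w as [Cs] plus the derivative of [Psi] and integrating by parts leaves (c^2 - Cs) L times a
    fixed positive integral, plus an error bounded independently of L. *)
Lemma exterior_unstable alpha (u : R -> R) (a Cs B T0 : R) (Psi : R -> R) :
  (0 < N)%N -> 0 <= a -> N%:R = 4 + 2 * a -> (a * (a + 2)) ^+ 2 < Cs ->
  continuous (emden alpha u) ->
  hasd Psi (fun t => expR (emden alpha u t) - Cs) ->
  (forall t, T0 <= t -> - B <= Psi t /\ Psi t <= B) ->
  forall K : set V, compact K -> ~ stable_on alpha (radial N u) (~` K).
Proof.
move=> N0 a0 Na; set c := a * (a + 2) => cC cw hPsi bPsi K cK.
have c0 : 0 <= c by apply: mulr_ge0 => //; lra.
have [rho hrho] := compact_sq_bound cK.
(* On the support |x|^2 >= e^(2 T) >= 1 + 2 T > rho, hence the support avoids K. *)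
pose T := Num.max T0 (Num.max rho 0).
have [TT0 Trho T_0] : [/\ T0 <= T, rho <= T & 0 <= T] by rewrite /T !le_max !lexx !orbT.
pose p (t : R) := pos (t * (1 - t)).
have cp : continuous p by rewrite /p; apply: cont_comp; [cont|exact: pos_continuous].
have cp6 : continuous (fun t => (p t ^+ 3) ^+ 2) by cont.
have [Y hY _] := primitive cp6.
have Ypos : 0 < Y 1 - Y 0.
  have [t /andP[t0 t1] E] := der_mvt hY ltr01.
  rewrite E; apply: mulr_gt0; last by lra.
  rewrite exprn_gt0// exprn_gt0// /p pos_gt0E mulr_gt0//; lra.
pose B' := 324 + 36 * c + 6 * B.
have B0 : 0 <= B by have := bPsi _ TT0; lra.
have B'0 : 0 < B' by rewrite /B'; lra.
have kC : 0 < (Cs - c ^+ 2) * (Y 1 - Y 0) by rewrite mulr_gt0// subr_gt0.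
have [L [L1 hL]] : exists L : R, 1 <= L /\ B' < (Cs - c ^+ 2) * (Y 1 - Y 0) * L.
  exists (Num.max 1 ((B' + 1) / ((Cs - c ^+ 2) * (Y 1 - Y 0)))).
  split; first by rewrite le_max lexx.
  set L := Num.max _ _.
  have : (B' + 1) / ((Cs - c ^+ 2) * (Y 1 - Y 0)) <= L by rewrite le_max lexx orbT.
  by rewrite ler_pdivrMr// mulrC => h; apply: lt_le_trans h; rewrite ltrDl.
have L0 : 0 < L by lra.
pose I := L^-1.
have I0 : 0 < I by rewrite invr_gt0.
have I1 : I <= 1 by rewrite invf_le1.
have IL : I * L = 1 by rewrite mulVf// gt_eqF.
pose s (t : R) := (t - T) * I.
have hs : hasd s (fun _ => I) by move=> t; rewrite /s; der; ring.
pose P (t : R) := p (s t).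
pose d (t : R) := 1 - 2 * s t.
have hz : hasd (fun t => s t * (1 - s t)) (fun t => d t * I).
  by move=> t; rewrite /d; der; ring.
have hd : hasd d (fun _ => - 2 * I) by move=> t; rewrite /d; der; ring.
have hP2 : hasd (fun t => P t ^+ 2) (fun t => 2 * P t * (d t * I)).
  by move=> t; apply: (isd_outer (k := fun t => pos t ^+ 2)); [exact: hasd_pos2|exact: hz].
pose y (t : R) := P t ^+ 3.
pose y1 (t : R) := 3 * P t ^+ 2 * d t * I.
pose y2 (t : R) := (6 * P t * d t ^+ 2 - 6 * P t ^+ 2) * I * I.
have hy : hasd y y1.
  move=> t; apply: isd_eq.
    by apply: (isd_outer (k := fun t => pos t ^+ 3)); [exact: hasd_pos3|exact: hz].
  by rewrite /y1 -/(P t) mulrA.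
have hy1 : hasd y1 y2.
  move=> t; rewrite /y1 /y2; apply: isd_eq.
    apply: isdM (isd_cst _ _ _); apply: isdM (hd t); apply: isdM (hP2 t).
    exact: isd_cst.
  by cbv beta; ring.
have P0 t : 0 <= P t by exact: pos_ge0.
have cP : continuous P by apply: cont_comp; [exact: hasd_cont hs|exact: cp].
have cd := hasd_cont hd; have cy := hasd_cont hy; have cy1 := hasd_cont hy1.
have cy2 : continuous y2 by rewrite /y2; cont.
have st t : s t = (t - T) / L by [].
have Plow t : t <= T -> P t = 0.
  move=> tT; rewrite /P /p pos_le0E//; apply: mulr_le0_ge0.
    by rewrite pmulr_lle0// subr_le0.
  have : s t <= 0 by rewrite pmulr_lle0// subr_le0.
  lra.
have Phigh t : T + L <= t -> P t = 0.
  move=> tT; have s1 : 1 <= s t by rewrite st ler_pdivlMr// mul1r; lra.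
  by rewrite /P /p pos_le0E//; apply: mulr_ge0_le0; lra.
pose e t := expR (- a * t).
have he : hasd e (fun t => - a * e t) by move=> t; rewrite /e; der; ring.
pose k t := e t * y t.
pose k1 t := e t * (y1 t - a * y t).
pose k2 t := e t * (y2 t - 2 * a * y1 t + a ^+ 2 * y t).
have hk : hasd k k1 by move=> t; rewrite /k /k1; der; ring.
have hk1 : hasd k1 k2 by move=> t; rewrite /k1 /k2; der; ring.
have ce := hasd_cont he.
have ck2 : continuous k2 by rewrite /k2; cont.
have kz t : P t = 0 -> [/\ k t = 0, k1 t = 0 & k2 t = 0].
  by move=> z; rewrite /k /k1 /k2 /y /y1 /y2 z; split; ring.
have klow t : t <= T -> [/\ k t = 0, k1 t = 0 & k2 t = 0] by move=> /Plow/kz.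
have khigh t : T + L <= t -> [/\ k t = 0, k1 t = 0 & k2 t = 0] by move=> /Phigh/kz.
pose h t := expR (emden alpha u t) * expR (- 4 * t) * k t ^+ 2.
have ck := hasd_cont hk.
have ch : continuous h by rewrite /h; cont.
pose g t := (y2 t + 2 * y1 t - c * y t) ^+ 2 - expR (emden alpha u t) * y t ^+ 2.
have cg : continuous g by rewrite /g; cont.
have [G hG _] := primitive cg.
have gE t : g t = expR (N%:R * t) *
     ((expR (- 2 * t) * (k2 t + (N%:R - 2) * k1 t)) ^+ 2 - h t).
  have E1 : expR (N%:R * t) * expR (- 4 * t) * e t ^+ 2 = 1.
    rewrite /e -expRM_natl -!expRD Na -[RHS]expR0; congr expR; ring.
  have E2 : expR (- 2 * t) ^+ 2 = expR (- 4 * t).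
    by rewrite -expRM_natl; congr expR; ring.
  rewrite /g /h.
  have -> : (expR (- 2 * t) * (k2 t + (N%:R - 2) * k1 t)) ^+ 2 =
     expR (- 4 * t) * e t ^+ 2 * (y2 t + 2 * y1 t - c * y t) ^+ 2.
    by rewrite -E2 /k2 /k1 Na /c; ring.
  have -> : expR (N%:R * t) * (expR (- 4 * t) * e t ^+ 2 * (y2 t + 2 * y1 t - c * y t) ^+ 2 -
     expR (emden alpha u t) * expR (- 4 * t) * k t ^+ 2) =
     expR (N%:R * t) * expR (- 4 * t) * e t ^+ 2 *
     ((y2 t + 2 * y1 t - c * y t) ^+ 2 - expR (emden alpha u t) * y t ^+ 2) by rewrite /k; ring.
  by rewrite E1 mul1r.
have TL : T <= T + L by lra.
apply: (rad_unstable (k := k) (k1 := k1) (k2 := k2) (v := 0) (t0 := T) (t1 := T + L)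
   (h := h) (Gam := G) hk hk1 ck2 klow khigh) => //.
- move=> x /(closure_rad klow erefl) sx /= Kx.
  have := hrho x Kx.
  have := expR_ge1Dx (2 * T); lra.
- by move=> t; apply: mulr_ge0; [apply: mulr_ge0; exact: expR_ge0|exact: sqr_ge0].
- by move=> t /klow[z _ _]; rewrite /h z expr0n mulr0.
- by move=> t /khigh[z _ _]; rewrite /h z expr0n mulr0.
- by move=> t; rewrite -gE; exact: hG.
(* The target bound minus the energy, with the term [Psi] y^2 from the integration by parts, which
   vanishes at both ends. That [D] is nondecreasing on [T, T + L] is the integrated form of
   [hump_bound]. *)
pose D t := (c ^+ 2 - Cs) * L * Y (s t) + B' * I * t - (G t + Psi t * y t ^+ 2).
pose dD t := (c ^+ 2 - Cs) * y t ^+ 2 + B' * I - (g t +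
   (expR (emden alpha u t) - Cs) * y t ^+ 2 + 2 * Psi t * y t * y1 t).
have hD : hasd D dD.
  have hYs : hasd (fun t => Y (s t)) (fun t => y t ^+ 2 * I).
    by move=> t; apply: (isd_outer (k := Y)); [exact: hY|exact: hs].
  move=> t; rewrite /D /dD; der.
  by rewrite /=; ring: IL.
have dD0 t : T <= t -> t <= T + L -> 0 <= dD t.
  move=> tT tL.
  have s0 : 0 <= s t by rewrite st divr_ge0 ?subr_ge0// ltW.
  have s1 : s t <= 1 by rewrite st ler_pdivrMr// mul1r; lra.
  have P1 : P t <= 1 by rewrite /P /p pos_le//; nra.
  have d0 : -1 <= d t by rewrite /d; lra.
  have d1 : d t <= 1 by rewrite /d; lra.
  have [p0 p1] := bPsi t (le_trans TT0 tT).
  have := hump_bound (P0 t) P1 d0 d1 I0 I1 c0 p0 p1.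
  rewrite -/B' -/(y t) -/(y1 t) -/(y2 t) /dD /g.
  lra.
have := der_le hD dD0 TL; rewrite /D.
have yT : y T = 0 by rewrite /y Plow// expr0n.
have yTL : y (T + L) = 0 by rewrite /y Phigh// expr0n.
have sT : s T = 0 by rewrite /s subrr mul0r.
have sTL : s (T + L) = 1 by rewrite st addrAC subrr add0r divff// gt_eqF.
rewrite yT yTL sT sTL expr0n !mulr0 !addr0.
have -> : B' * I * (T + L) = B' * I * T + B' by rewrite mulrDr -[X in _ + X]mulrA IL mulr1.
move: hL; nra.
Qed.

End ExteriorInstability.

(** * The radial equation as a first order system *)

Section LogSystem.
Context {R : realType}.

(* With t = ln r, b = r^(n-1) u_r, v = Laplacian u and m = r^(n-1) v_r the radial
   equation is a first order system on the whole line; [a] is the function in the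
   exponential, kept separate from [u] so that Picard iterates fit as well. *)
Record gsys (n al be : R) (a u b v m : R -> R) : Prop := GSys {
  gs_u : hasd u (fun t => expR ((2 - n) * t) * b t);
  gs_b : hasd b (fun t => expR (n * t) * v t);
  gs_v : hasd v (fun t => expR ((2 - n) * t) * m t);
  gs_m : hasd m (fun t => expR ((n + al) * t + a t));
  gl_u : limNy u 0;
  gl_b : limNy b 0;
  gl_v : limNy v be;
  gl_m : limNy m 0 }.

Lemma expR_ge2 : 2 <= expR 1 :> R.
Proof. by have := expR_ge1Dx (1 : R); lra. Qed.

Section Blowup.
Implicit Types (s h A : R).
Variables (n al : R) (u b v m : R -> R) (t1 : R).
Hypotheses (n2 : 2 <= n) (nal : 0 <= n + al) (al4 : 0 <= 4 + al) (t10 : 0 <= t1).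
Hypotheses (hu : hasd u (fun t => expR ((2 - n) * t) * b t))
  (hb : hasd b (fun t => expR (n * t) * v t))
  (hv : hasd v (fun t => expR ((2 - n) * t) * m t))
  (hm : hasd m (fun t => expR ((n + al) * t + u t))).
Hypotheses (m0 : 0 <= m t1) (v0 : 0 <= v t1) (b0 : 0 <= b t1).

Let m_ge0 t : t1 <= t -> 0 <= m t.
Proof.
by move=> h; apply: le_trans m0 _; apply: (der_le hm) => // s _ _; exact: expR_ge0.
Qed.

Let v_ge0 t : t1 <= t -> 0 <= v t.
Proof.
move=> h; apply: le_trans v0 _; apply: (der_le hv) => // s ts _.
by apply: mulr_ge0; [exact: expR_ge0|exact: m_ge0].
Qed.

Let b_ge0 t : t1 <= t -> 0 <= b t.
Proof.
move=> h; apply: le_trans b0 _; apply: (der_le hb) => // s ts _.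
by apply: mulr_ge0; [exact: expR_ge0|exact: v_ge0].
Qed.

Let u_nd s t : t1 <= s -> s <= t -> u s <= u t.
Proof.
move=> h st; apply: (der_le hu) => // r sr _.
by apply: mulr_ge0; [exact: expR_ge0|apply: b_ge0; exact: le_trans sr].
Qed.

Let b_nd s t : t1 <= s -> s <= t -> b s <= b t.
Proof.
move=> h st; apply: (der_le hb) => // r sr _.
by apply: mulr_ge0; [exact: expR_ge0|apply: v_ge0; exact: le_trans sr].
Qed.

Let v_nd s t : t1 <= s -> s <= t -> v s <= v t.
Proof.
move=> h st; apply: (der_le hv) => // r sr _.
by apply: mulr_ge0; [exact: expR_ge0|apply: m_ge0; exact: le_trans sr].
Qed.

Let m_nd s t : t1 <= s -> s <= t -> m s <= m t.
Proof. by move=> h st; apply: (der_le hm) => // r _ _; exact: expR_ge0. Qed.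

Let slope (f df : R -> R) (c s h : R) : hasd f df -> 0 < h ->
  (forall r, s < r -> r < s + h -> c <= df r) -> 0 <= f s -> h * c <= f (s + h).
Proof.
move=> hf h0 cf f0; have sh : s < s + h by lra.
have [r /andP[r1 r2] E] := der_mvt hf sh.
have := cf r r1 r2; have -> : f (s + h) = f s + df r * h by lra.
nra.
Qed.

(** Four integrations over a length h, through m, v, b and u, produce h^4. The exponents collected
    add up to 2 (2 - n) + (4 + al) t1 + u s, and (4 + al) t1 >= 0 makes the bound independent of
    t1. *)
Lemma blowup_step s h : t1 <= s -> 0 < h -> s + 4 * h <= t1 + 1 -> 0 <= u s ->
  h ^+ 4 * (expR (2 * (2 - n)) * expR (u s)) <= u (s + 4 * h).
Proof.
have [n2' t10'] := (n2, t10); move=> ts h0 sh us.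
have M : h * expR ((n + al) * t1 + u s) <= m (s + h).
  apply: (slope hm) => //; last exact: m_ge0.
  move=> r r1 r2; rewrite ler_expR; have := u_nd ts (ltW r1).
  have : (n + al) * t1 <= (n + al) * r by rewrite ler_wpM2l//; lra.
  lra.
have e2 (r : R) : r <= t1 + 1 -> expR ((2 - n) * (t1 + 1)) <= expR ((2 - n) * r).
  move=> r1; rewrite ler_expR -subr_ge0.
  have -> : (2 - n) * r - (2 - n) * (t1 + 1) = (n - 2) * (t1 + 1 - r) by ring.
  by apply: mulr_ge0; lra.
have P : 0 <= h * expR ((n + al) * t1 + u s) by rewrite mulr_ge0 ?expR_ge0// ltW.
have Vv : h * (expR ((2 - n) * (t1 + 1)) * (h * expR ((n + al) * t1 + u s))) <= v (s + h + h).
  apply: (slope hv) => //; last by apply: v_ge0; lra.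
  move=> r r1 r2; apply: ler_pM => //; first by apply: e2; lra.
  by apply: le_trans M _; apply: m_nd; lra.
set A := h * (_ * _) in Vv.
have A0 : 0 <= A by rewrite mulr_ge0 ?mulr_ge0 ?expR_ge0// ltW.
have B : h * (expR (n * t1) * A) <= b (s + h + h + h).
  apply: (slope hb) => //; last by apply: b_ge0; lra.
  move=> r r1 r2; apply: ler_pM => //.
    by rewrite ler_expR ler_wpM2l//; lra.
  by apply: le_trans Vv _; apply: v_nd; lra.
set C := h * (expR (n * t1) * A) in B.
have C0 : 0 <= C by rewrite mulr_ge0 ?mulr_ge0 ?expR_ge0// ltW.
have U : h * (expR ((2 - n) * (t1 + 1)) * C) <= u (s + h + h + h + h).
  apply: (slope hu) => //; last first.
    by apply: le_trans us _; apply: u_nd; lra.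
  move=> r r1 r2; apply: ler_pM => //; first by apply: e2; lra.
  by apply: le_trans B _; apply: b_nd; lra.
have -> : s + 4 * h = s + h + h + h + h by ring.
apply: le_trans U; rewrite /C /A.
have -> : h * (expR ((2 - n) * (t1 + 1)) * (h * (expR (n * t1) *
   (h * (expR ((2 - n) * (t1 + 1)) * (h * expR ((n + al) * t1 + u s))))))) =
   h ^+ 4 * (expR ((2 - n) * (t1 + 1)) * expR (n * t1) * expR ((2 - n) * (t1 + 1)) *
     expR ((n + al) * t1 + u s)) by ring.
rewrite ler_wpM2l ?exprn_ge0 ?(ltW h0)// -!expRD ler_expR.
have : 0 <= (4 + al) * t1 by rewrite mulr_ge0.
lra.
Qed.

(* Along t1 + 1 - 2^-k the values of u grow at least like A + 5 k, although
   u is bounded on [t1, t1 + 1]. *)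
Lemma no_large_start A : 0 <= A -> A + 5 <= expR (2 * (2 - n)) / 4096 * expR A ->
  ~ A <= u t1.
Proof.
move=> A0 hA uA; set kap := expR (2 * (2 - n)) / 4096 in hA.
pose tau (k : nat) := t1 + (1 - (2^-1) ^+ k).
have half (k : nat) : 0 < (2^-1 : R) ^+ k by rewrite exprn_gt0.
have tauP k : t1 <= tau k /\ tau k <= t1 + 1.
  rewrite /tau; have := half k; have : (2^-1 : R) ^+ k <= 1 by rewrite exprn_ile1//; lra.
  by split; lra.
(* The step length 2^-k / 8 costs 4096 = 8^4 and 2^(-4 k); the factor e^(5 k) >= 32^k overcomes this
   with 2^k to spare, enough to add 5. *)
have grow k : A + 5 * k%:R <= u (tau k).
  elim: k => [|k IH]; first by rewrite mulr0 addr0 /tau expr0 subrr addr0.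
  have [T1 T2] := tauP k.
  have k0 : 0 <= k%:R :> R by [].
  have tS : tau k + 4 * ((2^-1) ^+ k / 8) = tau k.+1.
    by rewrite /tau exprS; field.
  have us : 0 <= u (tau k) by lra.
  have hk : 0 < (2^-1 : R) ^+ k / 8 by rewrite divr_gt0.
  have := blowup_step T1 hk; rewrite tS => /(_ (tauP k.+1).2 us); apply: le_trans.
  have e5 : (32 : R) ^+ k <= expR (5 * k%:R).
    rewrite mulrC expRM_natl; apply: lerXn2r; rewrite ?nnegrE ?expR_ge0//.
    rewrite -[5%:R]mulr1 expRM_natl.
    have -> : (32 : R) = 2 ^+ 5 by ring.
    by apply: lerXn2r; rewrite ?nnegrE ?expR_ge0// expR_ge2.
  have two : 1 + k%:R <= 2 ^+ k :> R.
    by rewrite -natrX -[1 + _]/(1%:R + k%:R) -natrD ler_nat add1n ltn_expl.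
  have eu : expR A * 32 ^+ k <= expR (u (tau k)).
    apply: (@le_trans _ _ (expR A * expR (5 * k%:R))).
      by rewrite ler_wpM2l// expR_ge0.
    by rewrite -expRD ler_expR.
  have pw : ((2^-1 : R) ^+ k / 8) ^+ 4 * 32 ^+ k = 2 ^+ k / 4096.
    rewrite exprMn -exprM mulnC exprM mulrAC -exprMn.
    have -> : (2^-1 : R) ^+ 4 * 32 = 2 by field.
    by congr (_ * _); field.
  have -> : A + 5 * k.+1%:R = (A + 5) + 5 * k%:R by rewrite -addn1 natrD; ring.
  apply: (@le_trans _ _ ((A + 5) * 2 ^+ k)).
    apply: (@le_trans _ _ ((A + 5) * (1 + k%:R))); first by nra.
    by rewrite ler_wpM2l//; lra.
  apply: (@le_trans _ _ (kap * expR A * 2 ^+ k)).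
    by rewrite ler_wpM2r// exprn_ge0.
  have -> : kap * expR A * 2 ^+ k =
    ((2^-1 : R) ^+ k / 8) ^+ 4 * (expR (2 * (2 - n)) * (expR A * 32 ^+ k)).
    rewrite /kap; ring: pw.
  rewrite ler_wpM2l ?exprn_ge0 ?(ltW hk)//.
  by rewrite ler_wpM2l// expR_ge0.
pose M := Num.trunc (u (t1 + 1)).
have uM : u (t1 + 1) < M.+1%:R.
  have u0 : 0 <= u (t1 + 1) by apply: le_trans (le_trans A0 uA) _; apply: u_nd; lra.
  by have /andP[] := truncn_itv u0.
have := grow M.+1; have [T1 T2] := tauP M.+1; have := u_nd T1 T2.
have : 0 < M.+1%:R :> R by [].
lra.
Qed.

End Blowup.

Lemma large_start (k : R) : 0 < k -> exists A : R, 0 <= A /\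
  forall A', A <= A' -> A' + 5 <= k * expR A'.
Proof.
move=> k0; exists (5 + 8 / k).
have i0 : 0 < 8 / k by rewrite divr_gt0.
split=> [|A AA]; first by lra.
have h : 1 + A / 2 <= expR (A / 2) := expR_ge1Dx _.
have -> : expR A = expR (A / 2) ^+ 2 by rewrite -expRM_natl; congr expR; field.
have h2 : A ^+ 2 / 4 <= expR (A / 2) ^+ 2 by nra.
apply: (@le_trans _ _ (k * (A ^+ 2 / 4))); last by rewrite ler_wpM2l// ltW.
have h3 : 8 / k <= A by lra.
have : 8 <= k * A by rewrite mulrC -ler_pdivrMr.
have A5 : 5 <= A by lra.
nra.
Qed.

End LogSystem.

Section LimitComparison.
Context {R : realType}.
Implicit Types (t s k c l : R) (F dF G dG : R -> R).

Lemma lim_cmp F dF G dG l l' t : hasd F dF -> hasd G dG ->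
  (forall s, s <= t -> dF s <= dG s) -> limNy F l -> limNy G l' ->
  F t - l <= G t - l'.
Proof.
move=> hF hG le lF lG.
have h : hasd (fun t => F t - G t) (fun t => dF t - dG t) by move=> s; der.
have : F t - G t <= l - l'.
  by apply: (der_le_lim h _ (limNyB lF lG)) => s st; rewrite subr_le0; exact: le.
by lra.
Qed.

Lemma limNy_cexp c k : 0 < k -> limNy (fun t => c * expR (k * t)) 0.
Proof.
by move=> k0; rewrite -(mulr0 c); apply: limNyM (limNy_cst _) (limNy_expR k0).
Qed.

End LimitComparison.

(** * A priori bounds for the linearized system *)

Section OneSidedBounds.
Context {R : realType}.
Variables (n al be : R) (a u b v m : R -> R).
Hypotheses (n3 : 3 <= n) (al2 : -2 < al) (S : gsys n al be a u b v m).
Implicit Types (t s : R).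

Let n0 : 0 < n. Proof. by move: (n3); lra. Qed.
Let hv := gs_v S.
Let hb := gs_b S.
Let hu := gs_u S.
Let hm := gs_m S.

Lemma gs_m_gt0 t : 0 < m t.
Proof. by apply: (der_gt_lim hm _ (gl_m S)) => s _; exact: expR_gt0. Qed.

Lemma gs_v_ge t : be <= v t.
Proof.
apply: (der_ge_lim hv _ (gl_v S)) => s _.
by rewrite mulr_ge0 ?expR_ge0// ltW ?gs_m_gt0.
Qed.

Lemma gs_b_ge t : be / n * expR (n * t) <= b t.
Proof.
have h : hasd (fun t => be / n * expR (n * t)) (fun t => be * expR (n * t)).
  by move=> s; der; field; rewrite gt_eqF.
have := lim_cmp (t := t) h hb _ (limNy_cexp _ n0) (gl_b S); rewrite !subr0; apply.
by move=> s _; rewrite mulrC ler_wpM2l ?expR_ge0 ?gs_v_ge.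
Qed.

Lemma gs_u_ge t : be / (2 * n) * expR (2 * t) <= u t.
Proof.
have h : hasd (fun t => be / (2 * n) * expR (2 * t)) (fun t => be / n * expR (2 * t)).
  by move=> s; der; field; rewrite gt_eqF.
have := lim_cmp (t := t) h hu _ (limNy_cexp _ (ltr0Sn R 1)) (gl_u S); rewrite !subr0; apply.
move=> s _; have -> : expR (2 * s) = expR ((2 - n) * s) * expR (n * s).
  by rewrite -expRD; congr expR; ring.
by rewrite mulrCA ler_wpM2l ?expR_ge0 ?gs_b_ge.
Qed.

Hypothesis a0 : forall t, a t <= 0.

(** Since e^a <= 1 the four equations integrate explicitly from -oo. The resulting bounds depend
    only on n, al and be, so they are uniform along sequences of iterates. *)
Lemma gs_up_m t : m t <= (n + al)^-1 * expR ((n + al) * t).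
Proof.
move: (n3) (al2) => n3' al2'; have p : 0 < n + al by lra.
have h : hasd (fun t => (n + al)^-1 * expR ((n + al) * t)) (fun t => expR ((n + al) * t)).
  by move=> s; der; field; rewrite gt_eqF.
have := lim_cmp (t := t) hm h _ (gl_m S) (limNy_cexp _ p); rewrite !subr0; apply.
by move=> s _; rewrite ler_expR gerDl.
Qed.

Let c1 := ((n + al) * (2 + al))^-1.

Lemma gs_up_v t : v t <= be + c1 * expR ((2 + al) * t).
Proof.
move: (n3) (al2) => n3' al2'; have p : 0 < n + al by lra.
have q : 0 < 2 + al by lra.
have h : hasd (fun t => c1 * expR ((2 + al) * t)) (fun t => (n + al)^-1 * expR ((2 + al) * t)).
  by move=> s; der; rewrite /c1; field; rewrite !gt_eqF.
have := lim_cmp (t := t) hv h _ (gl_v S) (limNy_cexp _ q); rewrite subr0 lerBlDl; apply.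
move=> s _; have -> : expR ((2 + al) * s) = expR ((2 - n) * s) * expR ((n + al) * s).
  by rewrite -expRD; congr expR; ring.
by rewrite mulrCA ler_wpM2l ?expR_ge0// gs_up_m.
Qed.

Let c2 := c1 / (n + 2 + al).

Lemma gs_up_b t : b t <= be / n * expR (n * t) + c2 * expR ((n + 2 + al) * t).
Proof.
move: (n3) (al2) => n3' al2'; have p : 0 < n + 2 + al by lra.
have h : hasd (fun t => be / n * expR (n * t) + c2 * expR ((n + 2 + al) * t))
   (fun t => be * expR (n * t) + c1 * expR ((n + 2 + al) * t)).
  by move=> s; der; rewrite /c2; field; rewrite !gt_eqF.
have := lim_cmp (t := t) hb h _ (gl_b S) (limNyD (limNy_cexp _ n0) (limNy_cexp _ p)).
rewrite addr0 !subr0; apply.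
move=> s _; have -> : expR ((n + 2 + al) * s) = expR (n * s) * expR ((2 + al) * s).
  by rewrite -expRD; congr expR; ring.
have := gs_up_v s; rewrite -(ler_pM2l (expR_gt0 (n * s))); lra.
Qed.

Let c3 := c2 / (4 + al).

Lemma gs_up_u t : u t <= be / (2 * n) * expR (2 * t) + c3 * expR ((4 + al) * t).
Proof.
move: (n3) (al2) => n3' al2'; have p : 0 < 4 + al by lra.
have h : hasd (fun t => be / (2 * n) * expR (2 * t) + c3 * expR ((4 + al) * t))
   (fun t => be / n * expR (2 * t) + c2 * expR ((4 + al) * t)).
  by move=> s; der; rewrite /c3; field; rewrite !gt_eqF.
have := lim_cmp (t := t) hu h _ (gl_u S) (limNyD (limNy_cexp _ (ltr0Sn R 1)) (limNy_cexp _ p)).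
rewrite addr0 !subr0; apply.
move=> s _; have -> : expR ((4 + al) * s) = expR ((2 - n) * s) * expR ((n + 2 + al) * s).
  by rewrite -expRD; congr expR; ring.
have -> : expR (2 * s) = expR ((2 - n) * s) * expR (n * s).
  by rewrite -expRD; congr expR; ring.
have := gs_up_b s; rewrite -(ler_pM2l (expR_gt0 ((2 - n) * s))); lra.
Qed.

End OneSidedBounds.

(** * Signs of entire solutions and the bound on r^(4 + alpha) e^u *)

Section EntireSolutions.
Context {R : realType}.
Variables (n al be : R) (u b v m : R -> R).
Hypotheses (n3 : 3 <= n) (al2 : -2 < al) (S : gsys n al be u u b v m).
Implicit Types (t s : R).

Lemma gs_v_incr s t : s < t -> v s < v t.
Proof.
move=> st; have [c _ E] := der_mvt (gs_v S) st.
by rewrite -subr_gt0 E !mulr_gt0 ?subr_gt0 ?expR_gt0 ?(gs_m_gt0 S).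
Qed.

(** Once v reaches 0 it later stays above some dl > 0, so b >= dl e^(n t) / n up to a constant and
    the derivative of u eventually exceeds 1. Then u passes the level A beyond which
    [no_large_start] excludes a global solution. *)
Lemma gs_v_lt0 t : v t < 0.
Proof.
move: (n3) (al2) => n3' al2'.
have [n2' na' a4'] : [/\ 2 <= n, 0 <= n + al & 0 <= 4 + al] by split; lra.
rewrite ltNge; apply/negP => vt.
set t2 := Num.max (t + 1) 0.
have [tt2 t20] : t + 1 <= t2 /\ 0 <= t2 by rewrite /t2 !le_max !lexx orbT.
set dl := v t2.
have dl0 : 0 < dl by apply: le_lt_trans vt _; apply: gs_v_incr; lra.
have v_ge s : t2 <= s -> dl <= v s.
  by rewrite le_eqVlt => /predU1P[<-|/gs_v_incr/ltW].
have n0 : 0 < n by lra.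
pose bb := b t2 - dl / n * expR (n * t2).
have b_ge s : t2 <= s -> bb + dl / n * expR (n * s) <= b s.
  move=> ts.
  have h : hasd (fun s => b s - dl / n * expR (n * s)) (fun s => expR (n * s) * (v s - dl)).
    by move=> r; have hb := gs_b S; der; field; rewrite gt_eqF.
  have := @der_le _ _ _ t2 s h; rewrite /bb; move=> H.
  suff : b t2 - dl / n * expR (n * t2) <= b s - dl / n * expR (n * s) by lra.
  by apply: H => // r tr _; rewrite mulr_ge0 ?expR_ge0// subr_ge0 v_ge.
have dn0 : 0 < dl / n by rewrite divr_gt0.
have up s : t2 <= s -> - `|bb| + dl / n * (1 + 2 * s) <= expR ((2 - n) * s) * b s.
  move=> ts; have s0 : 0 <= s by lra.
  apply: (@le_trans _ _ (expR ((2 - n) * s) * (bb + dl / n * expR (n * s)))); last first.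
    by rewrite ler_wpM2l ?expR_ge0// b_ge.
  have e1 : expR ((2 - n) * s) <= 1.
    by rewrite -[leRHS]expR0 ler_expR mulr_le0_ge0//; lra.
  have e2 : expR ((2 - n) * s) * expR (n * s) = expR (2 * s).
    by rewrite -expRD; congr expR; ring.
  have e3 : 1 + 2 * s <= expR (2 * s) := expR_ge1Dx _.
  have -> : expR ((2 - n) * s) * (bb + dl / n * expR (n * s)) =
     expR ((2 - n) * s) * bb + dl / n * expR (2 * s) by rewrite -e2; ring.
  apply: lerD; last by rewrite ler_wpM2l// ltW.
  have := ler_norm (- bb); rewrite normrN => nb.
  have := expR_ge0 ((2 - n) * s); have := normr_ge0 bb; nra.
pose t3 := t2 + (1 + `|bb|) / (dl / n).
have q0 : 0 <= (1 + `|bb|) / (dl / n) by rewrite divr_ge0 ?addr_ge0// ltW.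
have up1 s : t3 <= s -> 1 <= expR ((2 - n) * s) * b s.
  move=> ts; apply: le_trans (up s _); last by rewrite /t3 in ts; lra.
  have : (1 + `|bb|) / (dl / n) <= 1 + 2 * s by rewrite /t3 in ts; lra.
  by rewrite ler_pdivrMr// mulrC; lra.
have e0 : 0 < expR (2 * (2 - n)) / 4096.
  by apply: divr_gt0; [exact: expR_gt0 | rewrite ltr0n].
have {e0} [A [A0 hA]] := large_start e0.
have u_ge s : t3 <= s -> u t3 + (s - t3) <= u s.
  move=> ts; have h : hasd (fun s => u s - s) (fun s => expR ((2 - n) * s) * b s - 1).
    by move=> r; have hu := gs_u S; der.
  have := @der_le _ _ _ t3 s h; move=> H.
  suff : u t3 - t3 <= u s - s by lra.
  by apply: H => // r tr _; rewrite subr_ge0 up1.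
pose t1 := t3 + (`|u t3| + A).
have t31 : t3 <= t1 by rewrite /t1; have := normr_ge0 (u t3); lra.
have t1p : 0 <= t1 by rewrite /t3 in t31; lra.
have m1 := ltW (gs_m_gt0 S t1).
have v1 : 0 <= v t1 by apply: le_trans (ltW dl0) (v_ge _ _); rewrite /t3 in t31; lra.
have b1 : 0 <= b t1.
  have h := lt_le_trans ltr01 (up1 t1 t31).
  by move: h; rewrite pmulr_rgt0 ?expR_gt0// => /ltW.
apply: (no_large_start n2' na' a4' t1p (gs_u S) (gs_b S) (gs_v S) (gs_m S) m1 v1 b1
  A0 (hA A (lexx _))).
have := u_ge t1 t31; have := ler_norm (- u t3); rewrite normrN /t1; lra.
Qed.

Lemma gs_b_lt0 t : b t < 0.
Proof.
apply: (der_lt_lim (gs_b S) _ (gl_b S)) => s _.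
by rewrite pmulr_rlt0 ?expR_gt0// gs_v_lt0.
Qed.

Lemma gs_du_lt0 t : expR ((2 - n) * t) * b t < 0.
Proof. by rewrite pmulr_rlt0 ?expR_gt0// gs_b_lt0. Qed.

Lemma gs_u_lt0 t : u t < 0.
Proof. by apply: (der_lt_lim (gs_u S) _ (gl_u S)) => s _; exact: gs_du_lt0. Qed.

Lemma gs_be_lt0 : be < 0.
Proof. exact: le_lt_trans (gs_v_ge S 0) (gs_v_lt0 0). Qed.

Lemma limNy_expu : limNy (fun t => expR ((n + al) * t + u t)) 0.
Proof.
move: (n3) (al2) => n3' al2'.
apply: (limNy_squeeze (limNy_cst 0) (limNy_expR (_ : 0 < n + al))); first by lra.
exists 0 => t _; rewrite expR_ge0/= ler_expR.
by have := gs_u_lt0 t; lra.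
Qed.

(** Since u decreases, e^(u t) is the smallest value of e^u up to t, and m integrates e^((n + al) s
    + u s) from -oo. *)
Lemma gs_m_ge t : expR ((n + al) * t + u t) / (n + al) <= m t.
Proof.
move: (n3) (al2) => n3' al2'; have na : 0 < n + al by lra.
have h : hasd (fun t => m t - expR ((n + al) * t + u t) / (n + al))
   (fun t => - (expR ((n + al) * t + u t) / (n + al) * (expR ((2 - n) * t) * b t))).
  by move=> r; have hm := gs_m S; have hu := gs_u S; der; field; rewrite gt_eqF.
rewrite -subr_ge0; apply: (der_ge_lim h) => [s _|].
  rewrite oppr_ge0 mulr_ge0_le0 ?divr_ge0 ?expR_ge0 ?(ltW na)//.
  exact/ltW/gs_du_lt0.
rewrite -[X in limNy _ X](subrr 0); apply: limNyB; first exact: gl_m S.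
rewrite -[X in limNy _ X](mul0r (n + al)^-1); apply: limNyM; last exact: limNy_cst.
exact: limNy_expu.
Qed.

(** The function Z = v + m e^((2 - n) t) / (n - 2) is nondecreasing. If it were positive somewhere,
    v < 0 would force the derivative of v above a positive constant from then on, and v would become
    positive. *)
Lemma gs_v_le t : m t * expR ((2 - n) * t) / (n - 2) <= - v t.
Proof.
move: (n3) (al2) => n3' al2'; have n2 : 0 < n - 2 by lra.
pose Z t := v t + m t * expR ((2 - n) * t) / (n - 2).
have h : hasd Z (fun t => expR ((n + al) * t + u t) * expR ((2 - n) * t) / (n - 2)).
  by move=> r; have hm := gs_m S; have hv := gs_v S; rewrite /Z; der; field; rewrite gt_eqF.
rewrite -subr_le0 opprK addrC -/(Z t) leNgt; apply/negP => Zt.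
have Z_ge s : t <= s -> Z t <= Z s.
  by move=> ts; apply: (der_le h) => // r _ _; rewrite divr_ge0 ?mulr_ge0 ?expR_ge0// ltW.
pose s := t + (1 - v t) / ((n - 2) * Z t).
have k0 : 0 < (n - 2) * Z t by rewrite mulr_gt0.
have vt := gs_v_lt0 t.
have ts : t <= s by rewrite /s lerDl divr_ge0 ?(ltW k0)//; lra.
have h2 : hasd (fun s => v s - (n - 2) * Z t * s)
   (fun s => expR ((2 - n) * s) * m s - (n - 2) * Z t).
  by move=> r; have hv := gs_v S; der; ring.
have W : v t - (n - 2) * Z t * t <= v s - (n - 2) * Z t * s.
  apply: (der_le h2) => // r tr _; rewrite subr_ge0.
  have := Z_ge r tr; have := gs_v_lt0 r; rewrite {2}/Z => v1 v2.
  have : Z t <= m r * expR ((2 - n) * r) / (n - 2) by lra.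
  by rewrite ler_pdivlMr// mulrC [m r * _]mulrC.
have := gs_v_lt0 s.
have : (n - 2) * Z t * s = (n - 2) * Z t * t + (1 - v t).
  by rewrite /s mulrDr [X in _ + X]mulrC divfK// gt_eqF.
lra.
Qed.

Lemma limNy_evn c : 0 < c -> limNy (fun t => v t * expR (c * t)) 0.
Proof.
by move=> c0; rewrite -(mulr0 be); apply: limNyM (gl_v S) (limNy_expR c0).
Qed.

(** -v decreases, so its mean over the ball of radius e^t, which is -n e^(-n t) b, is at least its
    boundary value. *)
Lemma gs_b_le t : - v t * expR (n * t) / n <= - b t.
Proof.
move: (n3) => n3'; have n0 : 0 < n by lra.
have h : hasd (fun t => v t * expR (n * t) / n - b t)
  (fun t => expR ((2 - n) * t) * m t * expR (n * t) / n).
  by move=> r; have hb := gs_b S; have hv := gs_v S; der; field; rewrite gt_eqF.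
have : 0 <= v t * expR (n * t) / n - b t; last by rewrite !mulNr; lra.
apply: (der_ge_lim h) => [s _|].
  by rewrite divr_ge0 ?mulr_ge0 ?expR_ge0 ?(ltW n0)// ltW ?(gs_m_gt0 S).
rewrite -[X in limNy _ X](subrr 0); apply: limNyB; last exact: gl_b S.
rewrite -[X in limNy _ X](mul0r n^-1); apply: limNyM; last exact: limNy_cst.
exact: limNy_evn.
Qed.

(* The chain of monotonicity estimates gives -u' >= k e^((4+al)t+u), which
   integrates to an explicit bound for r^(4+alpha) e^u. *)
Lemma gs_emden_bound t :
  expR (u t + (4 + al) * t) <= (4 + al) * (n * (n - 2) * (n + al)).
Proof.
move: (n3) (al2) => n3' al2'.
have [n0 n2 na a4] : [/\ 0 < n, 0 < n - 2, 0 < n + al & 0 < 4 + al] by split; lra.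
set K := n * (n - 2) * (n + al).
have K0 : 0 < K by rewrite /K !mulr_gt0.
have du s : K^-1 * expR ((4 + al) * s + u s) <= - (expR ((2 - n) * s) * b s).
  have e1 := gs_b_le s; have e2 := gs_v_le s; have e3 := gs_m_ge s.
  rewrite -mulrN; apply: (@le_trans _ _ (expR ((2 - n) * s) * (- v s * expR (n * s) / n))).
    apply: (@le_trans _ _ (expR ((2 - n) * s) * (m s * expR ((2 - n) * s) / (n - 2) * expR (n * s) / n))).
      apply: (@le_trans _ _ (expR ((2 - n) * s) * (expR ((n + al) * s + u s) / (n + al)
          * expR ((2 - n) * s) / (n - 2) * expR (n * s) / n))).
        rewrite le_eqVlt; apply/orP; left; apply/eqP.
        have -> : expR ((2 - n) * s) * (expR ((n + al) * s + u s) / (n + al)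
          * expR ((2 - n) * s) / (n - 2) * expR (n * s) / n) =
          K^-1 * (expR ((2 - n) * s) * expR ((n + al) * s + u s) * expR ((2 - n) * s) * expR (n * s)).
          by rewrite /K; field; rewrite !gt_eqF.
        by rewrite -!expRD; congr (_ * expR _); ring.
      rewrite ler_wpM2l ?expR_ge0// ler_wpM2r ?invr_ge0 ?(ltW n0)//.
      rewrite ler_wpM2r ?expR_ge0// ler_wpM2r ?invr_ge0 ?(ltW n2)//.
      by rewrite ler_wpM2r ?expR_ge0.
    rewrite ler_wpM2l ?expR_ge0// ler_wpM2r ?invr_ge0 ?(ltW n0)//.
    by rewrite ler_wpM2r ?expR_ge0.
  by rewrite ler_wpM2l ?expR_ge0.
pose c := K^-1 / (4 + al).
have c0 : 0 < c by rewrite divr_gt0 ?invr_gt0.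
(* Multiplication by e^(-u) removes the nonlinearity: the derivative of e^(-u) dominates that of c
   e^((4 + al) s). *)
have h : hasd (fun s => expR (- u s) - c * expR ((4 + al) * s))
  (fun s => expR (- u s) * (- (expR ((2 - n) * s) * b s)) - K^-1 * expR ((4 + al) * s)).
  by move=> r; have hu := gs_u S; rewrite /c; der; field; rewrite !gt_eqF.
have lim : limNy (fun s => expR (- u s) - c * expR ((4 + al) * s)) 1.
  rewrite -[X in limNy _ X]subr0; apply: limNyB.
    apply/limNyP; have /limNyP/cvgN := gl_u S; rewrite oppr0 => l0.
    by rewrite -[X in _ --> X]expR0; apply: continuous_cvg l0; exact: continuous_expR.
  by rewrite -(mulr0 c); apply: limNyM (limNy_cst _) (limNy_expR a4).
have : 1 <= expR (- u t) - c * expR ((4 + al) * t).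
  apply: (der_ge_lim h _ lim) => s _; rewrite subr_ge0.
  apply: (@le_trans _ _ (expR (- u s) * (K^-1 * expR ((4 + al) * s + u s)))).
    rewrite expRD [leRHS]mulrC -!mulrA -expRD subrr expR0 mulr1//.
  by rewrite ler_wpM2l ?expR_ge0.
move=> H.
have {}H : c * expR ((4 + al) * t) <= expR (- u t) by lra.
have {}H : c * expR (u t + (4 + al) * t) <= 1.
  have : expR (u t) * (c * expR ((4 + al) * t)) <= expR (u t) * expR (- u t).
    by rewrite ler_wpM2l ?expR_ge0.
  by rewrite -expRD subrr expR0 mulrCA -expRD.
have -> : (4 + al) * K = c^-1 by rewrite /c invfM invrK mulrC invrK.
by rewrite -[leRHS]mul1r ler_pdivlMr// mulrC.
Qed.

End EntireSolutions.

(** * Emden-Fowler analysis of entire solutions *)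

Section LimitsAtMinusInfinity.
Context {R : realType}.
Implicit Types (f df : R -> R) (c l t : R).

Lemma limNy_id_expR c : 0 < c -> limNy (fun t => t * expR (c * t)) 0.
Proof.
move=> c0; have c20 : 0 < c / 2 by rewrite divr_gt0.
have lB : limNy (fun t => 2 / c * expR (c / 2 * t)) 0.
  by rewrite -(mulr0 (2 / c)); apply: limNyM (limNy_cst _) (limNy_expR c20).
apply: (limNy_squeeze _ lB); first by have := limNyN lB; rewrite oppr0; exact.
exists 0 => t t0.
have h : - t * expR (c * t) <= 2 / c * expR (c / 2 * t).
  have -> : expR (c * t) = expR (c / 2 * t) * expR (c / 2 * t).
    by rewrite -expRD; congr expR; field.
  rewrite mulrA ler_wpM2r ?expR_ge0//.
  have e1 : 1 + c / 2 * - t <= expR (c / 2 * - t) := expR_ge1Dx _.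
  have e2 : expR (c / 2 * - t) * expR (c / 2 * t) = 1.
    by rewrite -expRD mulrN addNr expR0.
  have e3 : c / 2 * - t * expR (c / 2 * t) <= 1.
    by rewrite -[leRHS]e2 ler_wpM2r ?expR_ge0//; lra.
  have -> : - t * expR (c / 2 * t) = 2 / c * (c / 2 * - t * expR (c / 2 * t)).
    by field; rewrite gt_eqF.
  by rewrite -[leRHS]mulr1 ler_wpM2l// divr_ge0// ltW.
have := expR_ge0 (c * t); have := expR_ge0 (c / 2 * t).
have i0 : 0 <= 2 / c by rewrite divr_ge0// ltW.
move=> a1 a2; apply/andP; split; first by lra.
apply: (@le_trans _ _ 0); first by rewrite mulr_le0_ge0.
exact: mulr_ge0.
Qed.

(** For l < 0 the integrating factor e^(-l t) tends to 0 at -oo, so the comparison starts from zero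
    data even for functions that grow linearly there. *)
Lemma ge0_of_factor f df l : l < 0 -> hasd f df -> (forall t, 0 <= df t - l * f t) ->
  limNy (fun t => f t * expR (- l * t)) 0 -> forall t, 0 <= f t.
Proof.
move=> l0 hf pos lim t.
have h : hasd (fun t => f t * expR (- l * t)) (fun t => expR (- l * t) * (df t - l * f t)).
  by move=> s; der; ring.
have : 0 <= f t * expR (- l * t).
  by apply: (der_ge_lim h _ lim) => s _; rewrite mulr_ge0 ?expR_ge0.
by rewrite pmulr_lge0 ?expR_gt0.
Qed.

Lemma relax_le f (g : R -> R) (k M : R) : 0 < k -> hasd f (fun t => - k * f t + g t) -> (forall t, g t <= M) ->
  limNy f 0 -> forall t, f t <= M / k.
Proof.
move=> k0 hf gM lf t; rewrite -subr_ge0.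
have h : hasd (fun t => M / k - f t) (fun t => k * f t - g t) by move=> s; der; ring.
apply: (ge0_of_factor (l := - k) _ h) => [|s|]; first by rewrite oppr_lt0.
  have -> : k * f s - g s - - k * (M / k - f s) = M - g s by field; rewrite gt_eqF.
  by rewrite subr_ge0.
apply: limNy_eq.
  by apply: limNyM (limNy_expR _); [exact: limNyB (limNy_cst _) lf|rewrite opprK].
by rewrite mulr0.
Qed.

(** A positive value at t0 is amplified by e^(l (t - t0)); at the time chosen the linear part of
    this exponential already exceeds the bound M. *)
Lemma growth_unbounded f l M t0 : 0 < l -> (forall t, f t <= M) ->
  (exists2 df, hasd f df & forall t, l * f t <= df t) -> f t0 <= 0.
Proof.
move=> l0 fM [df hf le]; rewrite leNgt; apply/negP => f0.
have h : hasd (fun t => f t * expR (- l * t)) (fun t => expR (- l * t) * (df t - l * f t)).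
  by move=> s; der; ring.
have i0 : 0 <= M by have := fM t0; lra.
pose t := t0 + (M / f t0 + 1) / l.
have q0 : 0 <= (M / f t0 + 1) / l by rewrite divr_ge0 ?addr_ge0 ?divr_ge0// ltW.
have H : f t0 * expR (- l * t0) <= f t * expR (- l * t).
  apply: (der_le h); last by rewrite /t lerDl.
  by move=> s _ _; rewrite mulr_ge0 ?expR_ge0// subr_ge0.
have {}H : f t0 * expR (l * (t - t0)) <= f t.
  have E0 : expR (- l * t) * expR (l * t) = 1 by rewrite -expRD mulNr addNr expR0.
  have E1 : expR (- l * t0) * expR (l * t) = expR (l * (t - t0)).
    by rewrite -expRD; congr expR; ring.
  by have := ler_wpM2r (expR_ge0 (l * t)) H; rewrite -!mulrA E0 E1 mulr1.
have e1 : 1 + l * (t - t0) <= expR (l * (t - t0)) := expR_ge1Dx _.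
have E : l * (t - t0) = M / f t0 + 1 by rewrite /t; field; rewrite !gt_eqF.
have h2 : f t0 * (1 + l * (t - t0)) <= f t.
  by apply: le_trans H; rewrite ler_wpM2l// ltW.
have E2 : f t0 * (1 + l * (t - t0)) = M + 2 * f t0 by rewrite E; field; rewrite gt_eqF.
by move: h2; rewrite E2; have := fM t; lra.
Qed.

Lemma quadratic_unbounded f f1 f2 c M t0 : 0 < c -> hasd f f1 -> hasd f1 f2 ->
  (forall t, t0 <= t -> c <= f2 t) -> exists2 t, t0 <= t & M < f t.
Proof.
move=> c0 h1 h2 f2c.
have g1 t : t0 <= t -> f1 t0 + c * (t - t0) <= f1 t.
  move=> tt; have h : hasd (fun t => f1 t - c * t) (fun t => f2 t - c).
    by move=> s; der; ring.
  suff : f1 t0 - c * t0 <= f1 t - c * t by lra.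
  by apply: (der_le h) => // s ts _; rewrite subr_ge0 f2c.
have g0 t : t0 <= t -> f t0 + f1 t0 * (t - t0) + c * ((t - t0) * (t - t0)) / 2 <= f t.
  move=> tt.
  have h : hasd (fun t => f t - f1 t0 * (t - t0) - c * ((t - t0) * (t - t0)) / 2)
     (fun t => f1 t - (f1 t0 + c * (t - t0))).
    by move=> s; der; field.
  suff : f t0 - f1 t0 * (t0 - t0) - c * ((t0 - t0) * (t0 - t0)) / 2 <=
      f t - f1 t0 * (t - t0) - c * ((t - t0) * (t - t0)) / 2.
    by rewrite subrr !mulr0 mul0r !subr0; lra.
  by apply: (der_le h) => // s ts _; rewrite subr_ge0 g1.
pose K := `|f1 t0| + `|M - f t0| + 1.
have K0 : 0 < K by rewrite /K ltr_wpDl ?addr_ge0.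
pose x := 1 + 2 * K / c.
have x1 : 1 <= x by rewrite /x lerDl divr_ge0 ?mulr_ge0// ltW.
have cx : K <= c * x / 2.
  have -> : c * x / 2 = c / 2 + K by rewrite /x; field; rewrite gt_eqF.
  by rewrite lerDr divr_ge0// ltW.
exists (t0 + x); first by lra.
apply: lt_le_trans (g0 _ _); last by lra.
have -> : t0 + x - t0 = x by ring.
have a1 : - `|f1 t0| <= f1 t0 by have := ler_norm (- f1 t0); rewrite normrN; lra.
have a2 := ler_norm (M - f t0).
have : (K - `|f1 t0|) * 1 <= (c * x / 2 + f1 t0) * x.
  by apply: ler_pM => //; have := normr_ge0 (M - f t0); move: cx; rewrite /K; lra.
rewrite /K; lra.
Qed.

End LimitsAtMinusInfinity.

Section EmdenFowler.
Context {R : realType}.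
Variables (n al be : R) (u b v m : R -> R).
Hypotheses (n3 : 3 <= n) (al2 : -2 < al) (S : gsys n al be u u b v m).

(** In terms of r: p = -r u', F = -r^2 Delta u and H = r^3 (Delta u)'. Together with w they form the
    autonomous system; p, F and H are positive and tend to 0 at -oo. *)
Let w (t : R) := u t + (4 + al) * t.
Let p (t : R) := - (expR ((2 - n) * t) * b t).
Let F (t : R) := - (expR (2 * t) * v t).
Let H (t : R) := expR ((4 - n) * t) * m t.

Let hw : hasd w (fun t => 4 + al - p t).
Proof. by move=> t; have hu := gs_u S; rewrite /w /p; der; ring. Qed.

Let hp : hasd p (fun t => - (n - 2) * p t + F t).
Proof.
move=> t; have hb := gs_b S; rewrite /p /F; der.
have E : expR (2 * t) = expR ((2 - n) * t) * expR (n * t).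
  by rewrite -expRD; congr expR; ring.
by rewrite E; ring.
Qed.

Let hF : hasd F (fun t => 2 * F t - H t).
Proof.
move=> t; have hv := gs_v S; rewrite /F /H; der.
have E : expR ((4 - n) * t) = expR (2 * t) * expR ((2 - n) * t).
  by rewrite -expRD; congr expR; ring.
by rewrite E; ring.
Qed.

Let hH : hasd H (fun t => - (n - 4) * H t + expR (w t)).
Proof.
move=> t; have hm := gs_m S; rewrite /H; der.
have E : expR (w t) = expR ((4 - n) * t) * expR ((n + al) * t + u t).
  by rewrite /w -expRD; congr expR; ring.
by rewrite E; ring.
Qed.

Let p_gt0 t : 0 < p t.
Proof. by rewrite oppr_gt0; exact: gs_du_lt0 n3 al2 S t. Qed.

Let F_gt0 t : 0 < F t.
Proof. by rewrite oppr_gt0 pmulr_rlt0 ?expR_gt0// (gs_v_lt0 n3 al2 S). Qed.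

Let H_gt0 t : 0 < H t.
Proof. by rewrite mulr_gt0 ?expR_gt0// (gs_m_gt0 S). Qed.

Let F_lim : limNy F 0.
Proof.
have l : limNy (fun t => expR (2 * t) * v t) (0 * be) := limNyM (limNy_expR (ltr0Sn R 1)) (gl_v S).
by apply: limNy_eq; [exact: limNyN l|rewrite mul0r oppr0].
Qed.

Let p_lim : limNy p 0.
Proof.
have l : limNy (fun t => (- be / n) * expR (2 * t)) 0.
  by rewrite -(mulr0 (- be / n)); apply: limNyM (limNy_cst _) (limNy_expR _).
apply: (limNy_squeeze (limNy_cst 0) l); exists 0 => t _; rewrite ltW//=.
rewrite /p -mulrN.
have -> : - be / n * expR (2 * t) = expR ((2 - n) * t) * - (be / n * expR (n * t)).
  have -> : expR (2 * t) = expR ((2 - n) * t) * expR (n * t).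
    by rewrite -expRD; congr expR; ring.
  by ring.
by rewrite ler_wpM2l ?expR_ge0// lerN2 (gs_b_ge n3 S).
Qed.

Let H_lim : limNy H 0.
Proof.
move: (n3) (al2) => n3' al2'; have a4 : 0 < 4 + al by lra.
have l : limNy (fun t => (n + al)^-1 * expR ((4 + al) * t)) 0.
  by rewrite -(mulr0 (n + al)^-1); apply: limNyM (limNy_cst _) (limNy_expR _).
apply: (limNy_squeeze (limNy_cst 0) l); exists 0 => t _; rewrite ltW//=.
rewrite /H.
have -> : (n + al)^-1 * expR ((4 + al) * t) =
    expR ((4 - n) * t) * ((n + al)^-1 * expR ((n + al) * t)).
  have -> : expR ((4 + al) * t) = expR ((4 - n) * t) * expR ((n + al) * t).
    by rewrite -expRD; congr expR; ring.
  by ring.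
have u0 s : u s <= 0 := ltW (gs_u_lt0 n3 al2 S s).
by rewrite ler_wpM2l ?expR_ge0// (gs_up_m n3 al2 S u0).
Qed.

Let C0 := (4 + al) * (n * (n - 2) * (n + al)).

Let C0_gt0 : 0 < C0.
Proof.
move: (n3) (al2) => n3' al2'.
by rewrite /C0 !mulr_gt0//; lra.
Qed.

Let w_le t : w t <= ln C0.
Proof.
by rewrite -ler_expR lnK ?posrE//; exact: gs_emden_bound n3 al2 S t.
Qed.

(* With y = ln (e^w / Cs) the linearization of the equation at y = 0 factors as
   (D - l1)(D - l2)(D - l3)(D - l4) y = Cs (e^y - 1 - y) >= 0, with real roots
   because Cs <= (a (a + 2))^2 and l1, l2, l3 < 0 < l4. Integrating the negative
   factors from -oo gives y' >= l4 y, so y > 0 somewhere would make y unbounded. *)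
Lemma gs_emden_le (a : R) : 0 < a -> n = 4 + 2 * a ->
  2 * (4 + al) * (n - 2) * (n - 4) <= (a * (a + 2)) ^+ 2 ->
  forall t, expR (u t + (4 + al) * t) <= 2 * (4 + al) * (n - 2) * (n - 4).
Proof.
move: (n3) (al2) => n3' al2' a0 nE; set Cs := 2 * _ * _ * _ => CC t0.
have Cs0 : 0 < Cs by rewrite /Cs !mulr_gt0//; lra.
(* With mu = lambda + a the characteristic equation is (mu^2 - a^2) (mu^2 - (a + 2)^2) = Cs, so mu^2
   is (q - dl) / 2 or (q + dl) / 2. The smaller value is nonnegative exactly when Cs <= (a (a +
   2))^2. *)
pose dl := Num.sqrt ((4 * (a + 1)) ^+ 2 + 4 * Cs).
have dl2 : dl ^+ 2 = (4 * (a + 1)) ^+ 2 + 4 * Cs.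
  by rewrite sqr_sqrtr// addr_ge0 ?sqr_ge0// mulr_ge0// ltW.
have dl0 : 0 <= dl := sqrtr_ge0 _.
pose q := a ^+ 2 + (a + 2) ^+ 2.
have dl_gt : 4 * (a + 1) < dl.
  rewrite -(@ltr_pXn2r _ 2)// ?nnegrE//; last by lra.
  by rewrite dl2 ltrDl mulr_gt0.
have q0 : 0 <= q by rewrite addr_ge0 ?sqr_ge0.
have dl_le : dl <= q.
  rewrite -(@ler_pXn2r _ 2)// ?nnegrE// dl2 /q.
  have -> : (a ^+ 2 + (a + 2) ^+ 2) ^+ 2 = (4 * (a + 1)) ^+ 2 + 4 * (a * (a + 2)) ^+ 2 by ring.
  by rewrite lerD2l ler_wpM2l.
pose x1 := Num.sqrt ((q - dl) / 2); pose x2 := Num.sqrt ((q + dl) / 2).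
have x10 : 0 <= x1 := sqrtr_ge0 _.
have x20 : 0 <= x2 := sqrtr_ge0 _.
have x12 : x1 ^+ 2 = (q - dl) / 2 by rewrite sqr_sqrtr// divr_ge0// subr_ge0.
have x22 : x2 ^+ 2 = (q + dl) / 2 by rewrite sqr_sqrtr// divr_ge0// addr_ge0.
have x1a : x1 < a.
  rewrite -(@ltr_pXn2r _ 2)// ?nnegrE ?(ltW a0)// x12 /q.
  by move: dl_gt; lra.
have x2a : a + 2 < x2.
  rewrite -(@ltr_pXn2r _ 2)// ?nnegrE//; last by lra.
  by rewrite x22 /q; move: dl_gt; lra.
have sumX : x2 ^+ 2 = q - x1 ^+ 2 by rewrite x12 x22; field.
have prodX : x1 ^+ 2 * x2 ^+ 2 = (a * (a + 2)) ^+ 2 - Cs.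
  rewrite x12 x22.
  have -> : (q - dl) / 2 * ((q + dl) / 2) = (q ^+ 2 - dl ^+ 2) / 4 by field.
  by rewrite dl2 /q; field.
pose l1 := - a - x2; pose l2 := - a - x1; pose l3 := - a + x1; pose l4 := x2 - a.
have [l10 l20 l30 l40] : [/\ l1 < 0, l2 < 0, l3 < 0 & 0 < l4].
  by rewrite /l1 /l2 /l3 /l4; move: x10 x20 x1a x2a a0; split; lra.
pose y t := w t - ln Cs.
have hy : hasd y (fun t => 4 + al - p t) by move=> t; rewrite /y; der; ring.
(* z1 = (D - l4) y, z2 = (D - l3) z1 and z3 = (D - l2) z2, expressed through y, p, F and H by means
   of the first-order system. *)
pose z1 t := (4 + al) - p t - l4 * y t.
pose z2 t := - (l4 + l3) * (4 + al) + l3 * l4 * y t + (l4 + l3 + n - 2) * p t - F t.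
pose z3 t := (4 + al) * (l3 * l4 + l2 * l3 + l2 * l4) - l2 * l3 * l4 * y t
   + (- l3 * l4 - (n - 2 + l2) * (l3 + l4 + n - 2)) * p t
   + (l2 + l3 + l4 + n - 4) * F t + H t.
have hz1 : hasd z1 (fun t => z2 t + l3 * z1 t).
  by move=> t; rewrite /z1 /z2; der; ring.
have hz2 : hasd z2 (fun t => z3 t + l2 * z2 t).
  by move=> t; rewrite /z2 /z3; der; ring.
have CsE : Cs = (4 + al) * (8 * a * (1 + a)) by rewrite /Cs nE; ring.
have CsE' : Cs = (a * (a + 2)) ^+ 2 - x1 ^+ 2 * x2 ^+ 2 by rewrite prodX; ring.
have hz3 : hasd z3 (fun t => (expR (w t) - Cs - Cs * y t) + l1 * z3 t).
  move=> t; rewrite {1}CsE CsE' /z3; der.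
  rewrite /l1 /l2 /l3 /l4 nE; move: (y t) (p t) (F t) (H t) (expR (w t)) => Y P F' H' W.
  have sumX' : x2 ^+ 2 = a ^+ 2 + (a + 2) ^+ 2 - x1 ^+ 2 := sumX.
  by ring: sumX'.
(* Only y is unbounded at -oo, where it is linear up to a convergent term, and e^(c t) suppresses
   it. *)
have lim c k0 k1 k2 k3 k4 : 0 < c ->
    limNy (fun t => (k0 + k1 * y t + k2 * p t + k3 * F t + k4 * H t) * expR (c * t)) 0.
  move=> c0.
  have -> : (fun t => (k0 + k1 * y t + k2 * p t + k3 * F t + k4 * H t) * expR (c * t)) =
    (fun t => (k0 + k1 * (u t - ln Cs) + k2 * p t + k3 * F t + k4 * H t) * expR (c * t)
        + k1 * (4 + al) * (t * expR (c * t))).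
    by apply/funext => t; rewrite /y /w; ring.
  apply: limNy_eq.
    apply: limNyD; last exact: limNyM (limNy_cst _) (limNy_id_expR c0).
    apply: limNyM (limNy_expR c0).
    apply: limNyD (limNyM (limNy_cst k4) H_lim).
    apply: limNyD (limNyM (limNy_cst k3) F_lim).
    apply: limNyD (limNyM (limNy_cst k2) p_lim).
    apply: limNyD; first exact: limNy_cst.
    apply: limNyM; first exact: limNy_cst.
    exact: limNyB (gl_u S) (limNy_cst _).
  by rewrite !mulr0 addr0.
have lim' f c k0 k1 k2 k3 k4 : 0 < c ->
    (forall t, f t = k0 + k1 * y t + k2 * p t + k3 * F t + k4 * H t) ->
    limNy (fun t => f t * expR (c * t)) 0.
  move=> c0 fE; have := lim c k0 k1 k2 k3 k4 c0; congr limNy.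
  by apply/funext => t; rewrite fE.
have pos3 t : 0 <= expR (w t) - Cs - Cs * y t.
  have -> : expR (w t) = Cs * expR (y t) by rewrite /y expRB lnK ?posrE// mulrC divfK// gt_eqF.
  have -> : Cs * expR (y t) - Cs - Cs * y t = Cs * (expR (y t) - (1 + y t)) by ring.
  by rewrite mulr_ge0 ?(ltW Cs0)// subr_ge0 expR_ge1Dx.
have z30 : forall t, 0 <= z3 t.
  apply: (ge0_of_factor l10 hz3) => [t|]; first by rewrite addrK.
  apply: (lim' _ _ ((4 + al) * (l3 * l4 + l2 * l3 + l2 * l4)) (- (l2 * l3 * l4))
    (- l3 * l4 - (n - 2 + l2) * (l3 + l4 + n - 2)) (l2 + l3 + l4 + n - 4) 1) => [|t].
    by rewrite oppr_gt0.
  by rewrite /z3; ring.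
have z20 : forall t, 0 <= z2 t.
  apply: (ge0_of_factor l20 hz2) => [t|]; first by rewrite addrK.
  apply: (lim' _ _ (- (l4 + l3) * (4 + al)) (l3 * l4) (l4 + l3 + n - 2) (-1) 0) => [|t].
    by rewrite oppr_gt0.
  by rewrite /z2; ring.
have z10 : forall t, 0 <= z1 t.
  apply: (ge0_of_factor l30 hz1) => [t|]; first by rewrite addrK.
  apply: (lim' _ _ (4 + al) (- l4) (-1) 0 0) => [|t].
    by rewrite oppr_gt0.
  by rewrite /z1; ring.
have A1 t : y t <= ln C0 - ln Cs by rewrite /y; have := w_le t; lra.
have A2 : exists2 dy, hasd y dy & forall t, l4 * y t <= dy t.
  exists (fun t => 4 + al - p t) => // t.
  by have := z10 t; rewrite /z1; lra.
have := growth_unbounded t0 l40 A1 A2; rewrite /y subr_le0 => h.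
have : expR (w t0) <= expR (ln Cs) by rewrite ler_expR.
by rewrite lnK ?posrE.
Qed.

Let decay_of_p c T : (forall t, T <= t -> 4 + al + c <= p t) ->
  forall t, T <= t -> w t <= w T + c * T - c * t.
Proof.
move=> pc t Tt.
have h : hasd (fun t => - w t - c * t) (fun t => p t - (4 + al + c)).
  by move=> s; der; ring.
suff : - w T - c * T <= - w t - c * t by lra.
by apply: (der_le h) => // s Ts _; rewrite subr_ge0 pc.
Qed.

(** For n = 4 the equation is (D + 2)(D - 2) D^2 w = e^w. Here y is the second derivative of w and x
    = (D - 2) y is nonnegative, so y > 0 somewhere would make w grow quadratically; thus w is
    concave and p nondecreasing. If p never passed 4 + al, w would be nondecreasing, H would grow
    linearly, and the derivative H - 4 p of y would push y above 0. *)
Lemma gs_decay4 : n = 4 -> exists C, exists2 c, 0 < c & exists T, forall t, T <= t ->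
  u t + (4 + al) * t <= C - c * t.
Proof.
move: (al2) => al2' n4.
pose x t := H t - 8 * p t + 2 * F t; pose y t := 2 * p t - F t.
have hx : hasd x (fun t => expR (w t) - 2 * x t).
  by move=> t; rewrite /x; der; rewrite n4; ring.
have hy : hasd y (fun t => H t - 4 * p t).
  by move=> t; rewrite /y; der; rewrite n4; ring.
have x0 : forall t, 0 <= x t.
  apply: (ge0_of_factor (l := -2) _ hx) => [|t|].
  - by lra.
  - by have := expR_ge0 (w t); lra.
  apply: limNy_eq.
    apply: limNyM; last by apply: limNy_expR; lra.
    apply: limNyD; last exact: limNyM (limNy_cst _) F_lim.
    exact: limNyB H_lim (limNyM (limNy_cst _) p_lim).
  by rewrite mulr0.
have y0 t0 : y t0 <= 0.
  rewrite leNgt; apply/negP => yt0.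
  have yt t : t0 <= t -> y t0 <= y t.
    move=> tt.
    have h : hasd (fun t => y t * expR (- 2 * t)) (fun t => x t * expR (- 2 * t)).
      by move=> s; der; rewrite /x /y; ring.
    have : y t0 * expR (- 2 * t0) <= y t * expR (- 2 * t).
      by apply: (der_le h) => // s _ _; rewrite mulr_ge0 ?expR_ge0.
    have e1 : expR (- 2 * t) <= expR (- 2 * t0) by rewrite ler_expR; lra.
    move=> h1; rewrite -(ler_pM2r (expR_gt0 (- 2 * t0))).
    apply: (le_trans h1); rewrite ler_wpM2l//.
    by rewrite -(pmulr_lge0 _ (expR_gt0 (- 2 * t))); apply: le_trans h1; rewrite mulr_ge0 ?expR_ge0 ?ltW.
  have hw' : hasd (fun t => 4 + al - p t) y.
    by move=> t; rewrite /y; der; rewrite n4; ring.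
  have [t _] := quadratic_unbounded (ln C0) yt0 hw hw' yt.
  by rewrite ltNge w_le.
have p_incr s t : s <= t -> p s <= p t.
  apply: der_le_nonneg hp _ _ _ => r.
  by have := y0 r; rewrite /y n4; lra.
have [t1 pt1] : exists t1, 4 + al < p t1.
  apply: contrapT => /forallNP np.
  have ple t : p t <= 4 + al by rewrite leNgt; apply/negP; exact: np.
  have w_incr s t : s <= t -> w s <= w t.
    by apply: der_le_nonneg hw _ _ _ => r; rewrite subr_ge0.
  pose e0 := expR (w 0); have e00 : 0 < e0 := expR_gt0 _.
  have H_ge t : 0 <= t -> e0 * t <= H t.
    move=> t0; have h : hasd (fun t => H t - e0 * t) (fun t => expR (w t) - e0).
      by move=> s; der; rewrite n4; ring.
    have : H 0 - e0 * 0 <= H t - e0 * t.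
      by apply: (der_le h) => // s s0 _; rewrite subr_ge0 ler_expR w_incr.
    by have := H_gt0 0; lra.
  pose T := (1 + 4 * (4 + al)) / e0.
  have T0 : 0 <= T by rewrite divr_ge0 ?(ltW e00)//; lra.
  have hy' : hasd (fun t => y t - t) (fun t => H t - 4 * p t - 1).
    by move=> t; der.
  have yT := y0 T.
  have : y T - T <= y (T + 1 - y T) - (T + 1 - y T).
    apply: (der_le hy'); last by lra.
    move=> s Ts _; have s0 : 0 <= s by apply: le_trans Ts.
    have := H_ge s s0; have := ple s.
    have : e0 * T <= e0 * s by rewrite ler_wpM2l// ltW.
    have -> : e0 * T = 1 + 4 * (4 + al) by rewrite mulrC divfK// gt_eqF.
    by lra.
  by have := y0 (T + 1 - y T); lra.
exists (w t1 + (p t1 - (4 + al)) * t1), (p t1 - (4 + al)); first by rewrite subr_gt0.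
exists t1; apply: decay_of_p => t tt.
by have := p_incr _ _ tt; lra.
Qed.

(** For n = 3, [gs_v_le] and the growth of m give F >= m(0) e^t for t >= 0. The equation for p then
    makes p grow at least linearly, so it passes 5 + al and w decreases with slope at most -1. *)
Lemma gs_decay3 : n = 3 -> exists C, exists2 c, 0 < c & exists T, forall t, T <= t ->
  u t + (4 + al) * t <= C - c * t.
Proof.
move: (al2) => al2' nE; pose m0 := m 0; have m00 : 0 < m0 := gs_m_gt0 S 0.
have m_incr s t : s <= t -> m s <= m t.
  by apply: der_le_nonneg (gs_m S) _ _ _ => r; exact: expR_ge0.
have F_ge t : 0 <= t -> m0 * expR t <= F t.
  move=> t0; have := gs_v_le n3 al2 S t; have -> : n - 2 = 1 by rewrite nE; ring.
  rewrite divr1 => h; rewrite /F -mulrN.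
  have h2 : expR (2 * t) * (m t * expR ((2 - n) * t)) <= expR (2 * t) * - v t.
    by rewrite ler_wpM2l ?expR_ge0.
  apply: le_trans h2; have -> : expR (2 * t) * (m t * expR ((2 - n) * t)) = m t * expR t.
    have -> : expR t = expR (2 * t) * expR ((2 - n) * t).
      by rewrite -expRD nE; congr expR; ring.
    by ring.
  by rewrite ler_wpM2r ?expR_ge0// m_incr.
have p_ge t : 0 <= t -> m0 / 2 * t <= p t.
  move=> t0.
  have h : hasd (fun t => p t * expR t - m0 / 2 * (expR t * expR t))
      (fun t => (F t - m0 * expR t) * expR t).
    have he : hasd expR (expR : R -> R).
      by move=> s; have := isd_expR (isd_id s); rewrite mulr1.
    by move=> s; der; rewrite nE; field.
  have : p 0 * expR 0 - m0 / 2 * (expR 0 * expR 0) <= p t * expR t - m0 / 2 * (expR t * expR t).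
    by apply: (der_le h) => // s s0 _; rewrite mulr_ge0 ?expR_ge0// subr_ge0 F_ge.
  rewrite expR0 !mulr1 => h1; have p00 := p_gt0 0.
  have e1 : 1 + t <= expR t := expR_ge1Dx _.
  rewrite -(ler_pM2r (expR_gt0 t)).
  have : m0 / 2 * ((1 + t) * expR t) <= m0 / 2 * (expR t * expR t).
    by rewrite ler_wpM2l ?divr_ge0 ?(ltW m00)// ler_wpM2r ?expR_ge0.
  have : m0 / 2 * 1 <= m0 / 2 * expR t.
    by rewrite ler_wpM2l ?divr_ge0 ?(ltW m00)//; lra.
  by lra.
pose T := (5 + al) / (m0 / 2); have T0 : 0 <= T.
  by rewrite divr_ge0//; [lra|rewrite divr_ge0// ltW].
exists (w T + 1 * T), 1 => //; exists T; apply: decay_of_p => t Tt.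
have t0 : 0 <= t by lra.
apply: le_trans (p_ge t t0).
have : m0 / 2 * T <= m0 / 2 * t by rewrite ler_wpM2l// divr_ge0// ltW.
have -> : m0 / 2 * T = 5 + al by rewrite mulrC divfK// gt_eqF// divr_gt0.
by lra.
Qed.

(* Psi is H - (n-4) F + 2 (n-4) p - 2 (n-2)(n-4) w: all terms but the last are
   bounded, and Psi cannot grow where w < ln Cs. *)
Lemma gs_psi_bounded : 4 < n -> (forall c, 0 < c -> exists t, - c < v t) ->
  exists Psi, exists2 B,
    hasd Psi (fun t => expR (u t + (4 + al) * t) - 2 * (4 + al) * (n - 2) * (n - 4)) &
    forall t, 0 <= t -> - B <= Psi t /\ Psi t <= B.
Proof.
move: (al2) => al2' n4 vlim.
have n40 : 0 < n - 4 by rewrite subr_gt0.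
have n20 : 0 < n - 2 by lra.
pose C1 := C0 / (n - 4).
have HC1 t : H t <= C1.
  have ew s : expR (w s) <= C0 by exact: gs_emden_bound n3 al2 S s.
  exact: relax_le n40 hH ew H_lim t.
have FC1 t : F t <= C1 / 2.
  have hv' : hasd (fun s => - v s - C1 / 2 * expR (- 2 * s))
     (fun s => expR (- 2 * s) * (C1 - H s)).
    move=> s; have hv := gs_v S; der; rewrite /H.
    have E : expR ((2 - n) * s) = expR (- 2 * s) * expR ((4 - n) * s).
      by rewrite -expRD; congr expR; ring.
    by rewrite E; field.
  (* As v comes arbitrarily close to 0, -v t is the integral over s >= t of the derivative e^(-2 s)
     H of v, hence at most C1 e^(-2 t) / 2. *)
  have key : - v t <= C1 / 2 * expR (- 2 * t).
    apply/ler_addgt0Pr => e e0; have [s vs] := vlim e e0.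
    pose r := Num.max s t.
    have vr : v s <= v r.
      have : s <= r by rewrite le_max lexx.
      by rewrite le_eqVlt => /predU1P[<-//|/(gs_v_incr S)/ltW].
    have : - v t - C1 / 2 * expR (- 2 * t) <= - v r - C1 / 2 * expR (- 2 * r).
      apply: (der_le hv'); last by rewrite le_max lexx orbT.
      by move=> q _ _; rewrite mulr_ge0 ?expR_ge0// subr_ge0.
    have : 0 <= C1 / 2 * expR (- 2 * r).
      by rewrite mulr_ge0 ?expR_ge0// !divr_ge0// ltW.
    by lra.
  rewrite /F -mulrN; apply: le_trans (_ : expR (2 * t) * (C1 / 2 * expR (- 2 * t)) <= _).
    by rewrite ler_wpM2l ?expR_ge0.
  by rewrite mulrCA -expRD mulNr addrN expR0 mulr1.
have pC1 t : p t <= C1 / 2 / (n - 2) by apply: relax_le n20 hp FC1 p_lim t.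
pose kp := 2 * (n - 2) * (n - 4).
have kp0 : 0 < kp by rewrite !mulr_gt0.
pose Q t := H t - (n - 4) * F t + 2 * (n - 4) * p t.
pose M0 := C1 + (n - 4) * (C1 / 2) + 2 * (n - 4) * (C1 / 2 / (n - 2)).
have QM t : - M0 <= Q t /\ Q t <= M0.
  have h1 := HC1 t; have h2 := FC1 t; have h3 := pC1 t.
  have g1 := H_gt0 t; have g2 := F_gt0 t; have g3 := p_gt0 t.
  have i1 : (n - 4) * F t <= (n - 4) * (C1 / 2) by rewrite ler_wpM2l// ltW.
  have i2 : 2 * (n - 4) * p t <= 2 * (n - 4) * (C1 / 2 / (n - 2)).
    by rewrite ler_wpM2l// mulr_ge0// ltW.
  have j1 : 0 < (n - 4) * F t by rewrite mulr_gt0.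
  have j2 : 0 < 2 * (n - 4) * p t by rewrite !mulr_gt0.
  by rewrite /Q /M0; split; lra.
pose Psi t := Q t - kp * w t.
have CsE : 2 * (4 + al) * (n - 2) * (n - 4) = kp * (4 + al) by rewrite /kp; ring.
rewrite CsE; set Cs := kp * (4 + al).
have Cs0 : 0 < Cs by rewrite mulr_gt0//; lra.
have hPsi : hasd Psi (fun t => expR (w t) - Cs).
  by move=> t; rewrite /Psi /Q; der; rewrite /Cs /kp; ring.
(* Above M0 - kp ln Cs the bound on Q forces w < ln Cs, so Psi decreases there and L is a barrier.
   This is expressed by differentiating the squared positive part of Psi - L. *)
pose L := Num.max (M0 - kp * ln Cs) (Psi 0).
have PL t : 0 <= t -> Psi t <= L.
  move=> t0; have h : hasd (fun t => - pos (Psi t - L) ^+ 2)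
      (fun t => (2 * pos (Psi t - L)) * (Cs - expR (w t))).
    have hPL : hasd (fun s => Psi s - L) (fun s => expR (w s) - Cs).
      by move=> r; der; ring.
    have hP2 : hasd (fun s => pos (Psi s - L) ^+ 2)
        (fun s => 2 * pos (Psi s - L) * (expR (w s) - Cs)).
      by move=> s; apply: (isd_outer (k := fun r => pos r ^+ 2)) => //; exact: hasd_pos2.
    by move=> s; der; ring.
  have : - pos (Psi 0 - L) ^+ 2 <= - pos (Psi t - L) ^+ 2.
    apply: (der_le h) => // s _ _.
    have [le|lt] := leP (Psi s - L) 0; first by rewrite (pos_le0E le) mulr0 mul0r.
    apply: mulr_ge0; first by rewrite mulr_ge0 ?pos_ge0.
    have : M0 - kp * ln Cs < Psi s.
      by move: lt; rewrite subr_gt0; apply: le_lt_trans; rewrite le_max lexx.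
    rewrite /Psi => h1; have [_ h2] := QM s.
    have : kp * w s < kp * ln Cs by lra.
    rewrite ltr_pM2l// => h3; rewrite subr_ge0 -[leRHS]lnK ?posrE//.
    by rewrite ler_expR ltW.
  have -> : pos (Psi 0 - L) = 0 by apply: pos_le0E; rewrite subr_le0 le_max lexx orbT.
  rewrite expr0n oppr0 oppr_ge0 => h1.
  rewrite leNgt; apply/negP => lt.
  move: h1; rewrite leNgt => /negP; apply; rewrite exprn_gt0// pos_gt0E ?subr_gt0//.
pose B := `|L| + (M0 + kp * `|ln C0|).
exists Psi, B => // t t0.
have [h1 _] := QM t; have h2 := PL t t0; have h3 := ler_norm L; have h4 := normr_ge0 L.
have h5 : kp * w t <= kp * `|ln C0|.
  by rewrite ler_wpM2l ?(ltW kp0)//; apply: le_trans (w_le t) (ler_norm _).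
have h6 : 0 <= M0 by have [] := QM t; lra.
have h7 : 0 <= kp * `|ln C0| by rewrite mulr_ge0// ltW.
by rewrite /B; split; rewrite /Psi; [lra|move: h2; rewrite /Psi; lra].
Qed.

Lemma gs_u_le_of_v_le c : (forall t, v t <= - c) ->
  forall t, u t <= - (c / (2 * n)) * expR (2 * t).
Proof.
move: (n3) => n3' vc; have n0 : 0 < n by lra.
have lexp (k : R) : 0 < k -> forall d : R, limNy (fun t => d * expR (k * t)) 0.
  by move=> k0 d; rewrite -(mulr0 d); apply: limNyM (limNy_cst _) (limNy_expR k0).
have b_le t : b t <= - (c / n) * expR (n * t).
  have h : hasd (fun t => b t - - (c / n) * expR (n * t)) (fun t => expR (n * t) * (v t + c)).
    by move=> s; have hb := gs_b S; der; field; rewrite gt_eqF.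
  rewrite -subr_le0; apply: (der_le_lim h) => [s _|].
    by rewrite mulr_ge0_le0 ?expR_ge0//; have := vc s; lra.
  by have := limNyB (gl_b S) (lexp n n0 (- (c / n))); rewrite subr0; exact.
move=> t.
have h : hasd (fun t => u t - - (c / (2 * n)) * expR (2 * t))
    (fun t => expR ((2 - n) * t) * (b t - - (c / n) * expR (n * t))).
  move=> s; have hu := gs_u S; der.
  have E : expR (2 * s) = expR ((2 - n) * s) * expR (n * s).
    by rewrite -expRD; congr expR; ring.
  by rewrite E; field; rewrite gt_eqF.
rewrite -subr_le0; apply: (der_le_lim h) => [s _|].
  by rewrite mulr_ge0_le0 ?expR_ge0// subr_le0.
have l2 := lexp 2 (ltr0Sn R 1) (- (c / (2 * n))).
by have := limNyB (gl_u S) l2; rewrite subr0; exact.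
Qed.

Lemma gs_decay_of_quadratic c : 0 < c -> (forall t, u t <= - c * expR (2 * t)) ->
  exists C, forall t, 0 <= t -> u t + (4 + al) * t <= C - 1 * t.
Proof.
move=> c0 uc; exists ((5 + al) ^+ 2 / (4 * c)) => t t0.
have h : c * (1 + t) ^+ 2 <= c * expR (2 * t).
  have -> : expR (2 * t) = expR t ^+ 2 by rewrite -expRM_natl.
  by rewrite ler_wpM2l ?(ltW c0)// ler_pXn2r ?nnegrE ?expR_ge0 ?addr_ge0// expR_ge1Dx.
have h2 : 0 <= c * (t - (5 + al) / (2 * c)) ^+ 2 by rewrite mulr_ge0 ?sqr_ge0// ltW.
have E : c * (t - (5 + al) / (2 * c)) ^+ 2 =
   c * t ^+ 2 - (5 + al) * t + (5 + al) ^+ 2 / (4 * c) by field; rewrite gt_eqF.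
have h3 : c * t ^+ 2 <= c * (1 + t) ^+ 2.
  by rewrite ler_wpM2l ?(ltW c0)// ler_pXn2r ?nnegrE ?addr_ge0// lerDr.
have := uc t; rewrite E in h2; lra.
Qed.

End EmdenFowler.

(** * Bootstrap from -oo and solution of the linear system *)

Section Calculus.
Context {R : realType}.
Implicit Types (t s k c l C : R) (f g F dF G dG : R -> R).

(** The infimum of the points with f >= 0 would contradict continuity, since there f <= 0 improves
    itself to f < 0. *)
Lemma continuation_neg f : continuous f -> (exists T, forall t, t <= T -> f t < 0) ->
  (forall t, (forall s, s <= t -> f s <= 0) -> f t < 0) -> forall t, f t < 0.
Proof.
move=> cf [T hT] step t1; rewrite ltNge; apply/negP => f1.
pose A := [set s | 0 <= f s].
have lA : lbound A T.
  by move=> s As; rewrite leNgt; apply/negP => /ltW/hT; rewrite ltNge As.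
have iA : has_inf A by split; [exists t1|exists T].
set tau := inf A.
have below s : s < tau -> f s < 0.
  move=> st; rewrite ltNge; apply/negP => fs.
  by move: st; rewrite ltNge => /negP; apply; apply: ge_inf => //; exact: iA.2.
have ftau : f tau < 0.
  apply: step => s; rewrite le_eqVlt => /predU1P[->|/below/ltW//].
  rewrite leNgt; apply/negP => f0.
  have h0 : \forall s \near tau, 0 < f s by exact: (cvgr_gt _ (cf tau) _ f0).
  case: (iffLR (nbhs_normP _ _) h0) => e /= e0 he.
  have : 0 < f (tau - e / 2).
    apply: he; rewrite /= opprB addrC subrK gtr0_norm; last by rewrite divr_gt0.
    by lra.
  by have := below (tau - e / 2); lra.
have h0 : \forall s \near tau, f s < 0 by exact: (cvgr_lt _ (cf tau) _ ftau).
case: (iffLR (nbhs_normP _ _) h0) => e /= e0 he.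
have [s As sle] := inf_adherent e0 iA.
have ts : tau <= s by apply: ge_inf => //; exact: iA.2.
have : f s < 0.
  by apply: he; rewrite /= distrC ger0_norm ?subr_ge0//; move: sle; rewrite -/tau; lra.
by rewrite ltNge As.
Qed.

Lemma solve_linear f c k C : continuous f -> 0 < c + k ->
  (forall t, t <= 0 -> `|f t| <= C * expR (k * t)) ->
  exists F, [/\ hasd F (fun t => expR (c * t) * f t), limNy F 0 &
    forall t, t <= 0 -> `|F t| <= C / (c + k) * expR ((c + k) * t)].
Proof.
move=> cf cg fC.
have E t : expR ((c + k) * t) = expR (c * t) * expR (k * t).
  by rewrite -expRD mulrDl.
have hb t : t <= 0 -> `|expR (c * t) * f t| <= C * expR ((c + k) * t).
  move=> t0; rewrite normrM (ger0_norm (expR_ge0 _)) E mulrCA.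
  by rewrite ler_wpM2l ?expR_ge0// fC.
have ch : continuous (fun t : R => expR (c * t) * f t) by cont.
have [F hF lF] := primitive_limNy ch cg hb.
exists F; split=> // t t0.
have hG : hasd (fun t => C / (c + k) * expR ((c + k) * t)) (fun t => C * expR ((c + k) * t)).
  by move=> s; der; field; rewrite gt_eqF.
have hG' : hasd (fun t => - (C / (c + k) * expR ((c + k) * t))) (fun t => - (C * expR ((c + k) * t))).
  by move=> s; der.
have lG := limNy_cexp (C / (c + k)) cg.
have := lim_cmp (t := t) hF hG _ lF lG; rewrite !subr0 => A.
have := lim_cmp (t := t) hG' hF _ (limNyN lG) lF; rewrite !oppr0 !addr0 => B.
rewrite ler_norml; apply/andP; split; [apply: B|apply: A] => s st;
  by have := hb s (le_trans st t0); rewrite ler_norml => /andP[].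
Qed.

End Calculus.

Section Solve.
Context {R : realType}.

(** With [a] prescribed the system is triangular: m, v, b and u follow by four primitives from -oo,
    and the exponential bound on each ensures the convergence of the next. *)
Lemma gs_solve (n al be : R) (a : R -> R) : 3 <= n -> -2 < al -> continuous a ->
  (forall t, a t <= 0) -> exists u b v m, gsys n al be a u b v m.
Proof.
move=> n3 al2 ca a0.
have c1 : 0 < (n + al) + 0 by lra.
have cea : continuous (fun t : R => expR (a t)) by cont.
have [|m [hm lm mb]] := solve_linear (C := 1) cea c1.
  move=> t _; rewrite mul0r expR0 mulr1 ger0_norm ?expR_ge0//.
  by rewrite -[leRHS]expR0 ler_expR.
have cm := hasd_cont hm.
have c2 : 0 < (2 - n) + (n + al) by lra.
have [|v0 [hv0 lv0 vb]] := solve_linear (C := 1 / (n + al + 0)) cm c2.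
  by move=> t t0; have := mb t t0; rewrite addr0.
pose v t := be + v0 t.
have cv0 := hasd_cont hv0.
have cv : continuous v by rewrite /v; cont.
have c3 : 0 < n + 0 by lra.
pose C3 := `|be| + 1 / (n + al + 0) / (2 - n + (n + al)).
have [|b [hb lb bb]] := solve_linear (C := C3) cv c3.
  move=> t t0; rewrite mul0r expR0 mulr1 (le_trans (ler_normD _ _))// lerD2l.
  apply: le_trans (vb t t0) _; rewrite -[leRHS]mulr1 ler_wpM2l//.
    by rewrite !divr_ge0// ltW.
  by rewrite -[leRHS]expR0 ler_expR mulr_ge0_le0// ltW.
have cb := hasd_cont hb.
have c4 : 0 < (2 - n) + (n + 0) by lra.
have [|u [hu lu _]] := solve_linear (C := C3 / (n + 0)) cb c4.
  by [].
exists u, b, v, m; split=> //.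
- by move=> t; rewrite /v; der; rewrite add0r.
- by move=> t; rewrite expRD.
- have := limNyD (limNy_cst be) lv0; rewrite addr0; exact.
Qed.

End Solve.

(** * Comparison and ordering of solutions *)

Section Comparison.
Context {R : realType}.
Variables (n al be be' : R) (a u b v m a' u' b' v' m' : R -> R).
Hypotheses (n3 : 3 <= n) (al2 : -2 < al).
Hypotheses (S : gsys n al be a u b v m) (S' : gsys n al be' a' u' b' v' m').
Implicit Types (t s : R).

Let n0 : 0 < n. Proof. by move: (n3); lra. Qed.
Let hD F dF G dG : hasd F dF -> hasd G dG -> hasd (fun t : R => F t - G t) (fun t => dF t - dG t).
Proof. by move=> hF hG t; der. Qed.

Let hu := hD (gs_u S') (gs_u S).
Let hb := hD (gs_b S') (gs_b S).
Let hv := hD (gs_v S') (gs_v S).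
Let hm := hD (gs_m S') (gs_m S).
Let lu := limNyB (gl_u S') (gl_u S).
Let lb := limNyB (gl_b S') (gl_b S).
Let lv := limNyB (gl_v S') (gl_v S).
Let lm := limNyB (gl_m S') (gl_m S).

Section UpTo.
Variable t0 : R.

Lemma gs_le_bu (K : R) : (forall s, s <= t0 -> K <= v' s - v s) -> forall t, t <= t0 ->
  K / n * expR (n * t) <= b' t - b t /\ K / (2 * n) * expR (2 * t) <= u' t - u t.
Proof.
move=> Kv; have B t : t <= t0 -> K / n * expR (n * t) <= b' t - b t.
  move=> tt.
  have h : hasd (fun t => K / n * expR (n * t)) (fun t => K * expR (n * t)).
    by move=> s; der; field; rewrite gt_eqF.
  have := lim_cmp (t := t) h hb _ (limNy_cexp _ n0) lb; rewrite !subr0; apply.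
  move=> s st; rewrite -mulrBr mulrC ler_wpM2l ?expR_ge0// Kv//.
  exact: le_trans tt.
move=> t tt; split; first exact: B.
have h : hasd (fun t => K / (2 * n) * expR (2 * t)) (fun t => K / n * expR (2 * t)).
  by move=> s; der; field; rewrite gt_eqF.
have := lim_cmp (t := t) h hu _ (limNy_cexp _ (ltr0Sn R 1)) lu; rewrite !subr0; apply.
move=> s st; have -> : expR (2 * s) = expR ((2 - n) * s) * expR (n * s).
  by rewrite -expRD; congr expR; ring.
by rewrite -mulrBr mulrCA ler_wpM2l ?expR_ge0// B// (le_trans st).
Qed.

Lemma gs_le_mv : (forall s, s <= t0 -> a s <= a' s) -> forall t, t <= t0 ->
  m t <= m' t /\ be' - be <= v' t - v t.
Proof.
move=> aa; have M t : t <= t0 -> m t <= m' t.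
  move=> tt; have := der_ge_lim (t := t) hm _ lm; rewrite subr0 subr_ge0; apply.
  by move=> s st; rewrite subr_ge0 ler_expR lerD2l aa// (le_trans st).
move=> t tt; split; first exact: M.
apply: (der_ge_lim (t := t) hv _ lv) => s st.
by rewrite -mulrBr mulr_ge0 ?expR_ge0// subr_ge0 M// (le_trans st).
Qed.

Variables (K : R) (g dg G : R -> R).
Hypotheses (K0 : 0 <= K) (hg : hasd g dg) (lg : limNy g 1) (dg0 : forall t, 0 <= dg t).

(** Comparison with a profile g that increases from 1. Multiples of e^(n t) g and e^(2 t) g serve as
    upper barriers for the differences of b and u, because their derivatives contain the wanted term
    plus a nonnegative one in [dg]. *)
Lemma gs_up_bu : (forall s, s <= t0 -> v' s - v s <= K * g s) -> forall t, t <= t0 ->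
  u' t - u t <= K / (2 * n) * (expR (2 * t) * g t).
Proof.
move=> vK; have B t : t <= t0 -> b' t - b t <= K / n * (expR (n * t) * g t).
  move=> tt.
  have h : hasd (fun t => K / n * (expR (n * t) * g t))
     (fun t => K * (expR (n * t) * g t) + K / n * (expR (n * t) * dg t)).
    by move=> s; der; field; rewrite gt_eqF.
  have l : limNy (fun t => K / n * (expR (n * t) * g t)) (K / n * (0 * 1)).
    by apply: limNyM (limNy_cst _) _; apply: limNyM (limNy_expR n0) lg.
  have := lim_cmp (t := t) hb h _ lb l; rewrite mul0r mulr0 !subr0; apply.
  move=> s st; rewrite -mulrBr.
  have : expR (n * s) * (v' s - v s) <= expR (n * s) * (K * g s).
    by rewrite ler_wpM2l ?expR_ge0// vK// (le_trans st).
  have : 0 <= K / n * (expR (n * s) * dg s).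
    by rewrite mulr_ge0 ?divr_ge0 ?(ltW n0)// mulr_ge0 ?expR_ge0.
  by lra.
move=> t tt.
have h : hasd (fun t => K / (2 * n) * (expR (2 * t) * g t))
   (fun t => K / n * (expR (2 * t) * g t) + K / (2 * n) * (expR (2 * t) * dg t)).
  by move=> s; der; field; rewrite gt_eqF.
have l : limNy (fun t => K / (2 * n) * (expR (2 * t) * g t)) (K / (2 * n) * (0 * 1)).
  by apply: limNyM (limNy_cst _) _; apply: limNyM (limNy_expR (ltr0Sn R 1)) lg.
have := lim_cmp (t := t) hu h _ lu l; rewrite mul0r mulr0 !subr0; apply.
move=> s st; rewrite -mulrBr.
have : expR ((2 - n) * s) * (b' s - b s) <= expR ((2 - n) * s) * (K / n * (expR (n * s) * g s)).
  by rewrite ler_wpM2l ?expR_ge0// B// (le_trans st).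
have -> : expR ((2 - n) * s) * (K / n * (expR (n * s) * g s)) = K / n * (expR (2 * s) * g s).
  have -> : expR (2 * s) = expR ((2 - n) * s) * expR (n * s).
    by rewrite -expRD; congr expR; ring.
  by ring.
have : 0 <= K / (2 * n) * (expR (2 * s) * dg s).
  by rewrite mulr_ge0 ?divr_ge0 ?mulr_ge0 ?expR_ge0 ?(ltW n0).
by lra.
Qed.

Hypotheses (hG : hasd (fun t => expR ((n - 2) * t) * dg t) G)
  (lG : limNy (fun t => expR ((n - 2) * t) * dg t) 0).

(** [G] is e^(n t) times the radial Laplacian of g, so the hypothesis compares the difference of the
    sources with K Delta g. With [gs_up_bu] this closes the loop from v through u back to v. *)
Lemma gs_up_mv :
  (forall s, s <= t0 -> expR ((n + al) * s) * (expR (a' s) - expR (a s)) <= K * G s) ->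
  forall t, t <= t0 -> v' t - v t <= be' - be + K * (g t - 1).
Proof.
move=> GK; have M t : t <= t0 -> m' t - m t <= K * (expR ((n - 2) * t) * dg t).
  move=> tt.
  have h : hasd (fun t => K * (expR ((n - 2) * t) * dg t)) (fun t => K * G t).
    by move=> s; pose e t := expR ((n - 2) * t) * dg t; have he : hasd e G := hG;
      have : isd s 1 (fun t => K * e t) (K * G s); [der; ring|].
  have := lim_cmp (t := t) hm h _ lm (limNyM (limNy_cst K) lG).
  rewrite mulr0 !subr0; apply => s st; rewrite !expRD -mulrBr.
  by apply: GK; rewrite (le_trans st).
move=> t tt.
have h : hasd (fun t => K * (g t - 1)) (fun t => K * dg t) by move=> s; der; ring.
have l : limNy (fun t => K * (g t - 1)) (K * (1 - 1)).
  exact: limNyM (limNy_cst _) (limNyB lg (limNy_cst _)).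
have := lim_cmp (t := t) hv h _ lv l; rewrite subrr mulr0 subr0 lerBlDl; apply.
move=> s st; rewrite -mulrBr.
have := M s (le_trans st tt); rewrite -(ler_pM2l (expR_gt0 ((2 - n) * s))).
have E : expR ((2 - n) * s) * expR ((n - 2) * s) = 1.
  by rewrite -expRD -mulrDl addrA subrK subrr mul0r expR0.
have -> : expR ((2 - n) * s) * (K * (expR ((n - 2) * s) * dg s)) =
  expR ((2 - n) * s) * expR ((n - 2) * s) * (K * dg s) by ring.
by rewrite E mul1r.
Qed.

End UpTo.
End Comparison.

Section Order.
Context {R : realType}.
Variables (n al be be' : R) (u b v m u' b' v' m' : R -> R).
Hypotheses (n3 : 3 <= n) (al2 : -2 < al) (bb : be < be').
Hypotheses (S : gsys n al be u u b v m) (S' : gsys n al be' u' u' b' v' m').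

(** As long as u <= [u'] on (-oo, t], the sources are ordered and the gap of the Laplacians stays at
    least [be' - be]; two integrations turn this into a strict inequality. Near -oo half of the gap
    starts the bootstrap. *)
Lemma gs_lt t : u t - u' t < 0.
Proof.
move: t; have n0 : 0 < n by move: (n3); lra.
have cu := hasd_cont (gs_u S); have cu' := hasd_cont (gs_u S').
have gap (K t0 : R) : 0 < K -> (forall s, s <= t0 -> K <= v' s - v s) -> u t0 - u' t0 < 0.
  move=> K0 Kv; have [_] := gs_le_bu n3 S S' Kv (lexx t0).
  have : 0 < K / (2 * n) * expR (2 * t0) by rewrite mulr_gt0 ?expR_gt0// divr_gt0 ?mulr_gt0.
  by lra.
have d0 : 0 < be' - be by rewrite subr_gt0.
apply: continuation_neg; first by cont.
  have lv := limNyB (gl_v S') (gl_v S).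
  have [T hT] := lv ((be' - be) / 2) (divr_gt0 d0 (ltr0Sn R 1)).
  exists T => t tT; apply: (gap ((be' - be) / 2)); first by rewrite divr_gt0.
  move=> s st; have := hT s (le_trans st tT).
  by rewrite ler_norml => /andP[]; lra.
move=> t le; apply: (gap _ _ d0) => s st.
have aa r : r <= t -> u r <= u' r by move=> rt; rewrite -subr_le0 le.
by have [] := gs_le_mv S S' aa st.
Qed.

Lemma gs_gap t : (be' - be) / (2 * n) * expR (2 * t) <= u' t - u t.
Proof.
have aa r : r <= t -> u r <= u' r by move=> _; rewrite -subr_le0 ltW ?gs_lt.
have Kv s : s <= t -> be' - be <= v' s - v s.
  by move=> st; have [] := gs_le_mv S S' aa st.
by have [] := gs_le_bu n3 S S' Kv (lexx t).
Qed.

(** Continuous dependence on beta with the explicit profile g = exp (r^(4 + al)). Negative solutions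
    make the exponential 1-Lipschitz, and the factor 2 in K leaves the slack [be' - be] that makes
    the bootstrap strict. *)
Lemma gs_close t : u' t - u t <=
  2 * (be' - be) / (2 * n) * (expR (2 * t) * expR (expR ((4 + al) * t))).
Proof.
move: (n3) (al2) (bb) => n3' al2' bb'.
have n0 : 0 < n by lra.
pose ga := 4 + al; have ga0 : 0 < ga by rewrite /ga; lra.
pose e t := expR (ga * t); pose g t := expR (e t).
pose dg t := ga * (e t * g t).
pose K := 2 * (be' - be); have K0 : 0 < K by rewrite mulr_gt0// subr_gt0.
have he : hasd e (fun t => ga * e t) by move=> s; rewrite /e; der; ring.
have hg : hasd g dg by move=> s; rewrite /g; der; rewrite /dg /g; ring.
have le : limNy e 0 := limNy_expR ga0.
have lg : limNy g 1.
  rewrite -(@expR0 R) /g; apply/limNyP.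
  by apply: continuous_cvg; [exact: continuous_expR|apply/limNyP].
have g0 t' : 0 < g t' := expR_gt0 _.
have e0 t' : 0 < e t' := expR_gt0 _.
have dg0 t' : 0 <= dg t' by rewrite /dg mulr_ge0 ?(ltW ga0)// mulr_ge0// ltW.
pose G t := expR ((n - 2) * t) * (ga * (e t * g t * (n - 2 + ga + ga * e t))).
have hG : hasd (fun t => expR ((n - 2) * t) * dg t) G.
  by move=> s; rewrite /dg; der; rewrite /G /dg; ring.
have lG : limNy (fun t => expR ((n - 2) * t) * dg t) 0.
  have n20 : 0 < n - 2 by lra.
  have := limNyM (limNy_expR n20) (limNyM (limNy_cst ga) (limNyM le lg)).
  by rewrite mul0r; exact.
have cv := hasd_cont (gs_v S); have cv' := hasd_cont (gs_v S').
have cg := hasd_cont hg.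
have key : forall t, v' t - v t - K * g t < 0.
  apply: continuation_neg; first by cont.
    have d0 : 0 < be' - be by rewrite subr_gt0.
    have [T hT] := limNyB (gl_v S') (gl_v S) (divr_gt0 d0 (ltr0Sn R 1)).
    exists T => s sT; have := hT s sT; rewrite ler_norml => /andP[_ h].
    have : K * 1 <= K * g s by rewrite ler_wpM2l ?(ltW K0)// -[leLHS]expR0 ler_expR ltW.
    by rewrite /K in h *; lra.
  move=> t0 vK.
  have vK' s : s <= t0 -> v' s - v s <= K * g s by move=> /vK; rewrite subr_le0.
  have Ku := gs_up_bu n3 S S' (ltW K0) hg lg dg0 vK'.
  suff GK s : s <= t0 -> expR ((n + al) * s) * (expR (u' s) - expR (u s)) <= K * G s.
    have := gs_up_mv S S' hg lg hG lG GK (lexx t0).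
    by rewrite /K; lra.
  move=> st.
  have uu : u s <= u' s by rewrite -subr_le0 ltW// gs_lt.
  have e1 : expR (u' s) - expR (u s) <= u' s - u s.
    have E : expR (u s) = expR (u' s) * expR (u s - u' s) by rewrite -expRD addrC subrK.
    have h1 : 1 + (u s - u' s) <= expR (u s - u' s) := expR_ge1Dx _.
    have h2 : expR (u' s) <= 1 by rewrite -[leRHS]expR0 ler_expR ltW// (gs_u_lt0 n3 al2 S').
    have h3 : expR (u' s) * (1 + (u s - u' s)) <= expR (u s) by rewrite E ler_wpM2l ?expR_ge0.
    have : 0 <= (1 - expR (u' s)) * (u' s - u s) by rewrite mulr_ge0// subr_ge0.
    by lra.
  have h1 : expR ((n + al) * s) * (expR (u' s) - expR (u s)) <=
      expR ((n + al) * s) * (K / (2 * n) * (expR (2 * s) * g s)).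
    by rewrite ler_wpM2l ?expR_ge0// (le_trans e1)// Ku.
  apply: (le_trans h1).
  have E : expR ((n + al) * s) * expR (2 * s) = expR ((n - 2) * s) * e s.
    by rewrite /e -!expRD; congr expR; rewrite /ga; ring.
  have -> : expR ((n + al) * s) * (K / (2 * n) * (expR (2 * s) * g s)) =
     K * (expR ((n - 2) * s) * (e s * g s) * (1 / (2 * n))).
    have -> : expR ((n + al) * s) * (K / (2 * n) * (expR (2 * s) * g s)) =
     expR ((n + al) * s) * expR (2 * s) * (K / (2 * n) * g s) by ring.
    by rewrite E; field; rewrite gt_eqF.
  rewrite ler_wpM2l ?(ltW K0)//.
  have -> : G s = expR ((n - 2) * s) * (e s * g s) * (ga * (n - 2 + ga + ga * e s)).
    by rewrite /G; ring.
  rewrite ler_wpM2l ?mulr_ge0 ?expR_ge0 ?(ltW (e0 _)) ?(ltW (g0 _))//.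
  (* The number 1 separates the sides: 1 / (2 n) is below it, and 4 + al > 2 with n >= 3 puts the
     other side above. *)
  apply: (@le_trans _ _ 1).
    by rewrite ler_pdivrMr ?mulr_gt0//; lra.
  apply: (@le_trans _ _ (1 * 1)); first by rewrite mulr1.
  have ge0 : 0 < ga * e s by rewrite mulr_gt0.
  by rewrite ler_pM//; rewrite /ga in ge0 *; lra.
have vK s : s <= t -> v' s - v s <= K * g s by move=> _; rewrite -subr_le0 ltW.
exact: (gs_up_bu n3 S S' (ltW K0) hg lg dg0 vK (lexx t)).
Qed.

End Order.

(** * Pointwise limits of sequences of solutions *)

Section LimitOfDerivatives.
Context {R : realType}.

Lemma isd_of_quadratic (F : R -> R) (t d L : R) :
  (forall h, `|h| <= 1 -> `|F (t + h) - F t - h * d| <= L * h ^+ 2) -> isd t 1 F d.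
Proof.
move=> FL.
have L0 : 0 <= L.
  by have := FL 1; rewrite normr1 lexx expr1n mulr1 => /(_ isT); apply: le_trans.
have c : h^-1 *: ((F \o shift t) (h *: (1 : R)) - F t) @[h --> (0:R)^'] --> d.
  apply/cvgrPdist_le => e e0; near=> h.
  have h0 : h != 0 by near: h; exact: nbhs_dnbhs_neq.
  have h1 : `|h| <= 1 by near: h; exact: dnbhs0_le.
  have h2 : `|h| <= e / (L + 1).
    by near: h; apply: dnbhs0_le; rewrite divr_gt0// ltr_wpDl.
  rewrite /= [h *: 1]mulr1 [h + t]addrC.
  have -> : d - h^-1 *: (F (t + h) - F t) = - (h^-1 * (F (t + h) - F t - h * d)).
    by rewrite /GRing.scale/=; field.
  rewrite normrN normrM normfV ler_pdivrMl ?normr_gt0//.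
  apply: le_trans (FL h h1) _.
  have -> : h ^+ 2 = `|h| * `|h| by rewrite -expr2 real_normK ?num_real.
  rewrite mulrCA ler_wpM2l//.
  have : `|h| * (L + 1) <= e by rewrite -ler_pdivlMr// ltr_wpDl.
  by have := normr_ge0 h; lra.
split; first exact: cvgP c.
exact: (cvg_lim (@norm_hausdorff _ _) c).
Unshelve. all: by end_near. Qed.

Definition locbdd (f : nat -> R -> R) :=
  forall T, exists L, forall k t, `|t| <= T -> `|f k t| <= L.

Lemma locbddD f g : locbdd f -> locbdd g -> locbdd (fun k t => f k t + g k t).
Proof.
move=> hf hg T; have [L hL] := hf T; have [M hM] := hg T.
exists (L + M) => k t tT; apply: le_trans (ler_normD _ _) _.
by apply: lerD; [exact: hL|exact: hM].
Qed.

Lemma locbddM f g : locbdd f -> locbdd g -> locbdd (fun k t => f k t * g k t).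
Proof.
move=> hf hg T; have [L hL] := hf T; have [M hM] := hg T.
exists (L * M) => k t tT; rewrite normrM.
by apply: ler_pM => //; [exact: hL|exact: hM].
Qed.

Lemma locbdd_cst (c : nat -> R) K : (forall k, `|c k| <= K) -> locbdd (fun k _ => c k).
Proof. by move=> cK T; exists K. Qed.

Lemma locbdd_expR f : locbdd f -> locbdd (fun k t => expR (f k t)).
Proof.
move=> hf T; have [L hL] := hf T; exists (expR L) => k t tT.
by rewrite ger0_norm ?expR_ge0// ler_expR (le_trans (ler_norm _))// hL.
Qed.

Lemma locbdd_id : locbdd (fun _ t => t).
Proof. by move=> T; exists T. Qed.

Lemma locbdd_between lo hi f : locbdd lo -> locbdd hi ->
  (forall k t, lo k t <= f k t /\ f k t <= hi k t) -> locbdd f.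
Proof.
move=> hl hh p T; have [L hL] := hl T; have [M hM] := hh T.
exists (L + M) => k t tT; have [a b] := p k t.
have := hL k t tT; have := hM k t tT.
rewrite !ler_norml => /andP[? ?] /andP[? ?].
have L0 : 0 <= L by apply: le_trans (hL k t tT).
have M0 : 0 <= M by apply: le_trans (hM k t tT).
by apply/andP; split; lra.
Qed.

Lemma locbdd_const (c : R) : locbdd (fun _ _ => c).
Proof. by move=> T; exists `|c|. Qed.

(** A local bound on the second derivatives, uniform in k, gives first-order expansions with a
    common remainder L h^2, and these pass to pointwise limits. *)
Lemma hasd_limit (F G G1 : nat -> R -> R) (Fl Gl : R -> R) :
  (forall k, hasd (F k) (G k)) -> (forall k, hasd (G k) (G1 k)) -> locbdd G1 ->
  (forall t, F k t @[k --> \oo] --> Fl t) -> (forall t, G k t @[k --> \oo] --> Gl t) ->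
  hasd Fl Gl.
Proof.
move=> hF hG bG cF cG t; have [L hL] := bG (`|t| + 1).
have L0 : 0 <= L by apply: le_trans (hL 0%N t _); rewrite ?lerDl.
apply: (@isd_of_quadratic _ _ _ L) => h h1.
have est k : `|F k (t + h) - F k t - h * G k t| <= L * h ^+ 2.
  have lip s : `|s - t| <= `|h| -> `|G k s - G k t| <= L * `|h|.
    move=> st; have bnd r : `|r - t| <= `|h| -> `|G1 k r| <= L.
      move=> rt; apply: hL; rewrite -[r](subrK t) addrC (le_trans (ler_normD _ _))// lerD2l.
      exact: le_trans rt h1.
    apply: (@le_trans _ _ (L * `|s - t|)); last by rewrite ler_wpM2l.
    have [ts|ts|->] := ltgtP t s; last by rewrite !subrr normr0 mulr0.
    - have [c /andP[c1 c2] ->] := der_mvt (hG k) ts.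
      rewrite normrM ler_wpM2r// bnd// (le_trans _ st)//.
      by rewrite !ger0_norm ?subr_ge0 ?lerD2r ?ltW// (lt_trans c1).
    - have [c /andP[c1 c2] E] := der_mvt (hG k) ts.
      rewrite distrC E normrM [`|t - s|]distrC ler_wpM2r// bnd// (le_trans _ st)//.
      by rewrite distrC [`|s - t|]distrC !ger0_norm ?subr_ge0 ?lerD2l ?lerN2 ?ltW// (lt_trans c1).
  have -> : L * h ^+ 2 = `|h| * (L * `|h|).
    by rewrite -[h ^+ 2]real_normK ?num_real//; ring.
  have [h0|h0|<-] := ltgtP 0 h; last by rewrite addr0 mul0r subr0 subrr normr0 mul0r.
  - have th : t < t + h by rewrite ltrDl.
    have [c /andP[c1 c2] ->] := der_mvt (hF k) th.
    have -> : G k c * (t + h - t) - h * G k t = h * (G k c - G k t) by ring.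
    rewrite normrM ler_wpM2l// lip//.
    rewrite !ger0_norm ?(ltW h0) ?subr_ge0 ?(ltW c1)//; lra.
  - have th : t + h < t by rewrite gtrDl.
    have [c /andP[c1 c2] E] := der_mvt (hF k) th.
    have -> : F k (t + h) - F k t - h * G k t = h * (G k c - G k t).
      by rewrite -[F k (t + h) - F k t]opprB E; ring.
    rewrite normrM ler_wpM2l// lip//.
    rewrite distrC ger0_norm ?subr_ge0 ?(ltW c2)//.
    rewrite (ltr0_norm h0); lra.
apply: (cvgr_to_le (F := \oo) (f := fun k => `|F k (t + h) - F k t - h * G k t|)).
  apply: cvg_norm; apply: cvgB; first exact: cvgB.
  exact: cvgMr.
by near=> k; exact: est.
Unshelve. all: by end_near. Qed.

Lemma monotone_limit (f : nat -> R -> R) (hi : R -> R) :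
  (forall k t, f k t <= f k.+1 t) -> (forall k t, f k t <= hi t) ->
  exists fl : R -> R, (forall t, f k t @[k --> \oo] --> fl t) /\
    forall k t, f k t <= fl t.
Proof.
move=> inc bd; exists (fun t => limn (fun k => f k t)).
have nd t : nondecreasing_seq (fun k => f k t).
  by apply/nondecreasing_seqP => k; exact: inc.
have cv t : cvgn (fun k => f k t).
  by apply: nondecreasing_is_cvgn => //; exists (hi t) => _ [k _ <-].
split=> [t|k t]; first exact: cv.
exact: (nondecreasing_cvgn_le (nd t) (cv t) k).
Qed.

End LimitOfDerivatives.

Ltac locb := repeat match goal with
  | H : locbdd ?f |- locbdd ?f => exact: H
  | |- locbdd (fun k t => t) => exact: locbdd_id
  | |- locbdd (fun k t => ?c) => exact: locbdd_const
  | |- locbdd (fun k t => expR (@?f k t)) => apply: locbdd_expR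
  | |- locbdd (fun k t => @?f k t + @?g k t) => apply: locbddD
  | |- locbdd (fun k t => @?f k t * @?g k t) => apply: locbddM
  end.

Section LimitOfSystems.
Context {R : realType}.
Variables (n al be : R) (be_ : nat -> R) (A dA U B V M : nat -> R -> R).
Hypotheses (n3 : 3 <= n) (al2 : -2 < al).
Hypothesis S : forall k, gsys n al (be_ k) (A k) (U k) (B k) (V k) (M k).
Hypotheses (be_le : forall k, be_ k <= be_ k.+1) (be_cvg : be_ @ \oo --> be).
Hypotheses (A0 : forall k t, A k t <= 0) (AU : forall k t, A k t <= U k t)
  (UA : forall k t, U k t <= A k.+1 t).
Hypotheses (hA : forall k, hasd (A k) (dA k)) (bA : locbdd dA).

(** The interleaving A k <= U k <= A k.+1 covers both iterates, where A k.+1 = U k, and true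
    solutions, where A k = U k. The conditions at -oo survive because explicit bounds, with limits
    at -oo, squeeze the limit functions. *)
Lemma gs_limit : exists u b v m, gsys n al be u u b v m /\ forall k t, U k t <= u t.
Proof.
move: (n3) (al2) => n3' al2'; have n0 : 0 < n by lra.
have n20 : 0 < 2 * n by rewrite mulr_gt0.
have n2al : 0 < n + 2 + al by lra.
have nal : 0 < n + al by lra.
have al20 : 0 < 2 + al by lra.
have al40 : 0 < 4 + al by lra.
have be_nd : nondecreasing_seq be_ by apply/nondecreasing_seqP.
have be_lebe k : be_ k <= be.
  rewrite -(cvg_lim (@norm_hausdorff _ _) be_cvg).
  by apply: nondecreasing_cvgn_le => //; exact: cvgP be_cvg.
have be_ge k : be_ 0%N <= be_ k by exact: be_nd.
have bbe : forall k, `|be_ k| <= `|be| + `|be_ 0%N|.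
  move=> k; rewrite ler_norml; have := be_lebe k; have := be_ge k.
  have := ler_norm be; have := ler_norm (- be_ 0%N); rewrite normrN.
  by have := normr_ge0 be; have := normr_ge0 (be_ 0%N) => *; apply/andP; split; lra.
have A_inc k t : A k t <= A k.+1 t by exact: le_trans (AU k t) (UA k t).
have MV k t : M k t <= M k.+1 t /\ be_ k.+1 - be_ k <= V k.+1 t - V k t.
  exact: (gs_le_mv (S k) (S k.+1) (fun s _ => A_inc k s) (lexx t)).
have BU k t : B k t <= B k.+1 t /\ U k t <= U k.+1 t.
  have [b1 b2] := gs_le_bu n3 (S k) (S k.+1) (fun s (_ : s <= t) => (MV k s).2) (lexx t).
  have d0 : 0 <= be_ k.+1 - be_ k by rewrite subr_ge0.
  by rewrite -![_ k _ <= _]subr_ge0; split; [apply: le_trans b1|apply: le_trans b2];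
    rewrite mulr_ge0 ?expR_ge0 ?divr_ge0// ltW.
have V_inc k t : V k t <= V k.+1 t by have := (MV k t).2; have := be_le k; lra.
have mono c : 0 <= c -> forall k (t : R), be_ k * c * expR t <= be * c * expR t.
  by move=> c0 k t; rewrite ler_wpM2r ?expR_ge0// ler_wpM2r.
pose c1 := ((n + al) * (2 + al))^-1; pose c2 := c1 / (n + 2 + al); pose c3 := c2 / (4 + al).
have in0 : 0 <= n^-1 by rewrite invr_ge0 ltW.
have i2n0 : 0 <= (2 * n)^-1 by rewrite invr_ge0 ltW.
have upM k t : M k t <= (n + al)^-1 * expR ((n + al) * t).
  exact: gs_up_m n3 al2 (S k) (A0 k) t.
have upV k t : V k t <= be + c1 * expR ((2 + al) * t).
  by apply: le_trans (gs_up_v n3 al2 (S k) (A0 k) t) _; rewrite lerD2r.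
have upB k t : B k t <= be / n * expR (n * t) + c2 * expR ((n + 2 + al) * t).
  by apply: le_trans (gs_up_b n3 al2 (S k) (A0 k) t) _; rewrite lerD2r mono.
have upU k t : U k t <= be / (2 * n) * expR (2 * t) + c3 * expR ((4 + al) * t).
  by apply: le_trans (gs_up_u n3 al2 (S k) (A0 k) t) _; rewrite lerD2r mono.
have [u [cu Uu]] := monotone_limit (fun k t => (BU k t).2) upU.
have [b [cb _]] := monotone_limit (fun k t => (BU k t).1) upB.
have [v [cv _]] := monotone_limit V_inc upV.
have [m [cm _]] := monotone_limit (fun k t => (MV k t).1) upM.
have cA t : A k t @[k --> \oo] --> u t.
  rewrite -cvg_shiftS; apply: (squeeze_cvgr (f := fun k => U k t) (h := fun k => U k.+1 t)).
  - by near=> k; rewrite UA AU.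
  - exact: cu.
  - by rewrite (cvg_shiftS (fun k => U k t)); exact: cu.
have be_c c : be_ k * c @[k --> \oo] --> be * c by apply: cvgMl.
have lo (f : nat -> R) (fl c : R) : (forall k, be_ k * c <= f k) ->
    f k @[k --> \oo] --> fl -> be * c <= fl.
  by move=> le cf; apply: (ler_cvg_to (be_c c) cf); near=> k.
have up (f : nat -> R) (fl c : R) : (forall k, f k <= c) ->
    f k @[k --> \oo] --> fl -> fl <= c.
  by move=> le cf; apply: (cvgr_to_le cf); near=> k.
have bbe' := locbdd_cst bbe.
have bU : locbdd U.
  apply: (locbdd_between (lo := fun k t => be_ k / (2 * n) * expR (2 * t))
      (hi := fun _ t => be / (2 * n) * expR (2 * t) + c3 * expR ((4 + al) * t))).
  - by locb.
  - by locb.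
  - by move=> k t; split=> //; exact: gs_u_ge (S k) t.
have bB : locbdd B.
  apply: (locbdd_between (lo := fun k t => be_ k / n * expR (n * t))
      (hi := fun _ t => be / n * expR (n * t) + c2 * expR ((n + 2 + al) * t))).
  - by locb.
  - by locb.
  - by move=> k t; split=> //; exact: gs_b_ge n3 (S k) t.
have bV : locbdd V.
  apply: (locbdd_between (lo := fun k _ => be_ k)
      (hi := fun _ t => be + c1 * expR ((2 + al) * t))) => //.
  - by locb.
  - by move=> k t; split=> //; exact: gs_v_ge (S k) t.
have bM : locbdd M.
  apply: (locbdd_between (lo := fun _ _ => 0)
      (hi := fun _ t => (n + al)^-1 * expR ((n + al) * t))).
  - by locb.
  - by locb.
  - by move=> k t; split=> //; exact: ltW (gs_m_gt0 (S k) t).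
have bE : locbdd (fun k t => expR ((n + al) * t + A k t)).
  apply: (locbdd_between (lo := fun _ _ => 0) (hi := fun _ t => expR ((n + al) * t))).
  - by locb.
  - by locb.
  - by move=> k t; rewrite expR_ge0 ler_expR gerDl A0.
exists u, b, v, m; split=> //; split.
- apply: (hasd_limit (F := U) (G := fun k t => expR ((2 - n) * t) * B k t)
    (G1 := fun k t => expR ((2 - n) * t) * (expR (n * t) * V k t)
        + B k t * (expR ((2 - n) * t) * (2 - n)))).
  + by move=> k; exact: gs_u (S k).
  + by move=> k t; have hB := gs_b (S k); der; ring.
  + by locb.
  + exact: cu.
  + by move=> t; apply: cvgMr; exact: cb.
- apply: (hasd_limit (F := B) (G := fun k t => expR (n * t) * V k t)
    (G1 := fun k t => expR (n * t) * (expR ((2 - n) * t) * M k t)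
        + V k t * (expR (n * t) * n))).
  + by move=> k; exact: gs_b (S k).
  + by move=> k t; have hV := gs_v (S k); der; ring.
  + by locb.
  + exact: cb.
  + by move=> t; apply: cvgMr; exact: cv.
- apply: (hasd_limit (F := V) (G := fun k t => expR ((2 - n) * t) * M k t)
    (G1 := fun k t => expR ((2 - n) * t) * expR ((n + al) * t + A k t)
        + M k t * (expR ((2 - n) * t) * (2 - n)))).
  + by move=> k; exact: gs_v (S k).
  + by move=> k t; have hM := gs_m (S k); der; ring.
  + by locb.
  + exact: cv.
  + by move=> t; apply: cvgMr; exact: cm.
- apply: (hasd_limit (F := M) (G := fun k t => expR ((n + al) * t + A k t))
    (G1 := fun k t => expR ((n + al) * t + A k t) * (n + al + dA k t))).
  + by move=> k; exact: gs_m (S k).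
  + by move=> k t; have hAk := hA k; der; ring.
  + by locb.
  + exact: cm.
  + move=> t; apply: continuous_cvg; first exact: continuous_expR.
    by apply: cvgD; [exact: cvg_cst|exact: cA].
- apply: (limNy_squeeze (F := fun t => be / (2 * n) * expR (2 * t))
     (H := fun t => be / (2 * n) * expR (2 * t) + c3 * expR ((4 + al) * t))).
  + exact: limNy_cexp.
  + apply: limNy_eq; first by apply: limNyD; exact: limNy_cexp.
    by rewrite addr0.
  + exists 0 => t _; apply/andP; split; last exact: up (cu t).
    by rewrite -mulrA; apply: lo (cu t) => k; rewrite mulrA; exact: gs_u_ge (S k) t.
- apply: (limNy_squeeze (F := fun t => be / n * expR (n * t))
     (H := fun t => be / n * expR (n * t) + c2 * expR ((n + 2 + al) * t))).
  + exact: limNy_cexp.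
  + apply: limNy_eq; first by apply: limNyD; exact: limNy_cexp.
    by rewrite addr0.
  + exists 0 => t _; apply/andP; split; last exact: up (cb t).
    by rewrite -mulrA; apply: lo (cb t) => k; rewrite mulrA; exact: gs_b_ge n3 (S k) t.
- apply: (limNy_squeeze (F := fun t => be)
     (H := fun t => be + c1 * expR ((2 + al) * t))).
  + exact: limNy_cst.
  + apply: limNy_eq; first by apply: limNyD; [exact: limNy_cst|exact: limNy_cexp].
    by rewrite addr0.
  + exists 0 => t _; apply/andP; split; last exact: up (cv t).
    by rewrite -[be]mulr1; apply: lo (cv t) => k; rewrite mulr1; exact: gs_v_ge (S k) t.
- apply: (limNy_squeeze (F := fun t => 0) (H := fun t => (n + al)^-1 * expR ((n + al) * t))).
  + exact: limNy_cst.
  + exact: limNy_cexp.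
  + exists 0 => t _; apply/andP; split; last exact: up (cm t).
    by apply: (cvgr_to_ge (cm t)); near=> k; exact: ltW (gs_m_gt0 (S k) t).
Unshelve. all: by end_near. Qed.

End LimitOfSystems.


(** * Monotone iteration *)

Section Existence.
Context {R : realType}.
Variables (n al : R).
Hypotheses (n3 : 3 <= n) (al2 : -2 < al).

(* Monotone iteration between the subsolution [a0] and the supersolution [W]. *)
Lemma gs_iterate (be : R) (a0 da0 W : R -> R) :
  hasd a0 da0 -> locbdd (fun _ => da0) ->
  (forall t, W t <= 0) -> (forall t, a0 t <= W t) ->
  (forall u b v m, gsys n al be a0 u b v m -> forall t, a0 t <= u t) ->
  (forall a u b v m, gsys n al be a u b v m -> (forall t, a0 t <= a t) ->
     (forall t, a t <= W t) -> forall t, u t <= W t) ->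
  exists u b v m, gsys n al be u u b v m.
Proof.
move=> ha0 ba0 W0 a0W sub super.
(* Functions that are not continuous and nonpositive receive a dummy value, so that choice gives a
   total map to iterate. *)
have /choice[phi hphi] (a : R -> R) : exists s : (R -> R) * (R -> R) * (R -> R) * (R -> R),
    continuous a -> (forall t, a t <= 0) -> gsys n al be a s.1.1.1 s.1.1.2 s.1.2 s.2.
  have [[ca aneg]|H] := pselect (continuous a /\ forall t, a t <= 0).
    by have [u [b [v [m S]]]] := gs_solve be n3 al2 ca aneg; exists (u, b, v, m).
  by exists (a, a, a, a) => ca aneg; case: H.
pose A k := iter k (fun a => (phi a).1.1.1) a0.
have P k : [/\ continuous (A k), (forall t, a0 t <= A k t), (forall t, A k t <= W t) &
    forall t, A k t <= (phi (A k)).1.1.1 t].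
  elim: k => [|k [cA lA uA AU]].
    have c0 := hasd_cont ha0; split=> // t.
    by have := sub _ _ _ _ (hphi a0 c0 (fun t => le_trans (a0W t) (W0 t))) t.
  have S := hphi _ cA (fun t => le_trans (uA t) (W0 t)).
  have cA' : continuous (A k.+1) := hasd_cont (gs_u S).
  have uA' t : A k.+1 t <= W t := super _ _ _ _ _ S lA uA t.
  have S' := hphi _ cA' (fun t => le_trans (uA' t) (W0 t)).
  split=> // t; first exact: le_trans (lA t) (AU t).
  have Kv s : s <= t -> 0 <= (phi (A k.+1)).1.2 s - (phi (A k)).1.2 s.
    move=> st; have := (gs_le_mv S S' (fun r (_ : r <= t) => AU r) st).2.
    by rewrite subrr.
  have := (gs_le_bu n3 S S' Kv (lexx t)).2.
  by rewrite mul0r mul0r subr_ge0.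
have A0 k t : A k t <= 0 by have [_ _ h _] := P k; exact: le_trans (h t) (W0 t).
have S k : gsys n al be (A k) (A k.+1) (phi (A k)).1.1.2 (phi (A k)).1.2 (phi (A k)).2.
  by apply: hphi; [have [] := P k|exact: A0].
pose dA k t := if k is j.+1 then expR ((2 - n) * t) * (phi (A j)).1.1.2 t else da0 t.
have hA k : hasd (A k) (dA k) by case: k => [|k] //; exact: gs_u (S k).
have bB : locbdd (fun k => (phi (A k)).1.1.2).
  apply: (locbdd_between (lo := fun _ t => be / n * expR (n * t))
     (hi := fun _ t => be / n * expR (n * t)
        + ((n + al) * (2 + al))^-1 / (n + 2 + al) * expR ((n + 2 + al) * t))).
  - by locb.
  - by locb.
  - by move=> k t; split; [exact: gs_b_ge n3 (S k) t|exact: gs_up_b n3 al2 (S k) (A0 k) t].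
have bA : locbdd dA.
  have bB' : locbdd (fun k t => expR ((2 - n) * t) * (phi (A k)).1.1.2 t) by locb.
  move=> T; have [L hL] := bB' T; have [M hM] := ba0 T.
  exists (Num.max L M) => k t tT; rewrite le_max.
  by case: k => [|k]; apply/orP; [right; exact: (hM 0%N)|left; exact: (hL k)].
have AU k t : A k t <= A k.+1 t by have [_ _ _] := P k; apply.
have c0 : (fun _ : nat => be) @ \oo --> be by exact: cvg_cst.
have AS k t : A k.+1 t <= A k.+1 t by [].
have [u [b [v [m [Su _]]]]] := gs_limit n3 al2 S (fun _ => lexx be) c0 A0 AU AS hA bA.
by exists u, b, v, m.
Qed.

(** The quadratic be r^2 / (2 n) solves the problem with zero source and is a subsolution; the given
    solution with the larger parameter is the supersolution. *)
Lemma gs_exists_below (be be' : R) u b v m : be <= be' -> gsys n al be' u u b v m ->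
  exists u b v m, gsys n al be u u b v m.
Proof.
move=> bb S; have n20 : 0 < 2 * n by move: (n3); lra.
have h : hasd (fun t => be / (2 * n) * expR (2 * t)) (fun t => be / (2 * n) * (expR (2 * t) * 2)).
  by move=> t; der; ring.
apply: (gs_iterate (W := u) h) => [|t|t|u' b' v' m' S' t|a u' b' v' m' S' la ua t].
- by locb.
- exact: ltW (gs_u_lt0 n3 al2 S t).
- apply: le_trans (gs_u_ge n3 S t).
  by rewrite ler_wpM2r ?expR_ge0// ler_wpM2r ?invr_ge0// ltW.
- exact: gs_u_ge n3 S' t.
have Kv s : s <= t -> 0 <= v s - v' s.
  move=> st; have [_] := gs_le_mv S' S (fun r (_ : r <= t) => ua r) st.
  by apply: le_trans; rewrite subr_ge0.
have := (gs_le_bu n3 S' S Kv (lexx t)).2.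
by rewrite mul0r mul0r subr_ge0.
Qed.

(** Solutions with parameters be - 1/(k+1) increase with k and stay negative, so they converge to a
    solution. This is why the supremum [beta0] is attained. *)
Lemma gs_exists_sup (be : R) : (forall b0, b0 < be -> exists u b v m, gsys n al b0 u u b v m) ->
  exists u b v m, gsys n al be u u b v m.
Proof.
move=> ex; pose be_ (k : nat) := be - k.+1%:R^-1.
have /choice[phi S] (k : nat) : exists s : (R -> R) * (R -> R) * (R -> R) * (R -> R),
    gsys n al (be_ k) s.1.1.1 s.1.1.1 s.1.1.2 s.1.2 s.2.
  have [|u [b [v [m S]]]] := ex (be_ k); first by rewrite gtrBl invr_gt0.
  by exists (u, b, v, m).
have be_lt k : be_ k < be_ k.+1.
  by rewrite ltrD2l ltrN2 ltf_pV2 ?posrE// ltr_nat.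
pose U k := (phi k).1.1.1.
have U0 k t : U k t <= 0 := ltW (gs_u_lt0 n3 al2 (S k) t).
have UU k t : U k t <= U k.+1 t.
  by rewrite -subr_le0 ltW//; exact: (gs_lt n3 (be_lt k) (S k) (S k.+1) t).
have be_cvg : be_ @ \oo --> be.
  rewrite -[X in _ --> X]subr0; apply: cvgB; first exact: cvg_cst.
  exact: cvg_harmonic.
have be_abs k : `|be_ k| <= `|be| + 1.
  apply: le_trans (ler_normB _ _) _; rewrite lerD2l ger0_norm ?invr_ge0//.
  by rewrite invf_le1// ler1n.
have bb := locbdd_cst be_abs.
have bB : locbdd (fun k => (phi k).1.1.2).
  apply: (locbdd_between (lo := fun k t => be_ k / n * expR (n * t))
     (hi := fun k t => be_ k / n * expR (n * t)
        + ((n + al) * (2 + al))^-1 / (n + 2 + al) * expR ((n + 2 + al) * t))).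
  - by locb.
  - by locb.
  - by move=> k t; split; [exact: gs_b_ge n3 (S k) t|exact: gs_up_b n3 al2 (S k) (U0 k) t].
have bA : locbdd (fun k t => expR ((2 - n) * t) * (phi k).1.1.2 t) by locb.
have be_le k := ltW (be_lt k).
have [u [b [v [m [Su _]]]]] :=
  gs_limit n3 al2 S be_le be_cvg U0 (fun k t => lexx (U k t)) UU (fun k => gs_u (S k)) bA.
by exists u, b, v, m.
Qed.

(* The supersolution is W = u + delta e^(2 t) g / (2 n), where g = exp (A X) with
   X = e^(2 t) / (1 + e^(2 t)) is bounded and satisfies
   (e^((n-2) t) g')' >= e^((n+2+al) t + W) g / (2 n) for A large. *)
Lemma gs_exists_above (be c : R) u b v m : 4 < n -> 0 < c -> gsys n al be u u b v m ->
  (forall t, u t <= - c * expR (2 * t)) ->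
  exists2 be', be < be' & exists u b v m, gsys n al be' u u b v m.
Proof.
move: (n3) (al2) => n3' al2' n4 c0 S uc; have n0 : 0 < n by lra.
have n40 : 0 < n - 4 by lra.
have n20 : 0 < n - 2 by lra.
pose E (t : R) := expR (2 * t); have E0 t : 0 < E t := expR_gt0 _.
have hE : hasd E (fun t => 2 * E t) by move=> t; rewrite /E; der; ring.
(* The factor e^(-c r^2 / 2) beats every power of r at infinity, and 2 + al > 0 handles small r. Q
   measures the source against (1 + r^2)^(-2), the scale on which X must compensate it. *)
have [Q Q0 hQ] : exists2 Q, 0 <= Q &
    forall t, expR ((2 + al) * t - c / 2 * E t) * (1 + E t) ^+ 2 <= Q.
  pose q := (6 + al) ^+ 2 / (2 * c).
  have q0 : 0 <= q by rewrite divr_ge0 ?sqr_ge0 ?mulr_ge0// ltW.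
  exists (4 * expR q) => [|t]; first by rewrite mulr_ge0// expR_ge0.
  have cE : 0 < c / 2 * E t by rewrite !mulr_gt0 ?invr_gt0.
  have [t0|t0] := leP t 0.
    have E1 : E t <= 1 by rewrite /E -[leRHS]expR0 ler_expR; lra.
    rewrite mulrC; apply: ler_pM; rewrite ?sqr_ge0 ?expR_ge0//.
      have Et := E0 t; have -> : 4 = 2 ^+ 2 :> R by ring.
      by rewrite ler_pXn2r ?nnegrE//; lra.
    rewrite ler_expR; apply: le_trans q0.
    have : (2 + al) * t <= 0 by rewrite mulr_ge0_le0//; lra.
    by lra.
  have E1 : 1 <= E t by rewrite /E -[leLHS]expR0 ler_expR; lra.
  have h1 : (1 + E t) ^+ 2 <= 4 * expR (4 * t).
    have -> : 4 * expR (4 * t) = (2 * E t) ^+ 2.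
      rewrite exprMn; congr (_ * _); first by ring.
      by rewrite /E -expRM_natl; congr expR; ring.
    have Et := E0 t.
    by rewrite ler_pXn2r ?nnegrE//; lra.
  apply: (@le_trans _ _ (expR ((2 + al) * t - c / 2 * E t) * (4 * expR (4 * t)))).
    by rewrite ler_wpM2l ?expR_ge0.
  rewrite mulrCA -expRD ler_wpM2l// ler_expR.
  have h2 : (1 + t) ^+ 2 <= E t.
    rewrite /E expRM_natl ler_pXn2r ?nnegrE ?expR_ge0 ?addr_ge0 ?(ltW t0)//.
    exact: expR_ge1Dx.
  have h3 : c / 2 * (1 + t) ^+ 2 <= c / 2 * E t.
    by rewrite ler_wpM2l// divr_ge0// ltW.
  have h4 : 0 <= c / 2 * (t - (6 + al) / c) ^+ 2.
    by rewrite mulr_ge0 ?sqr_ge0// divr_ge0// ltW.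
  have e4 : c / 2 * (t - (6 + al) / c) ^+ 2 =
     c / 2 * t ^+ 2 - (6 + al) * t + q by rewrite /q; field; rewrite gt_eqF.
  have h5 : c / 2 * t ^+ 2 <= c / 2 * (1 + t) ^+ 2.
    by rewrite ler_wpM2l ?divr_ge0 ?(ltW c0)// ler_pXn2r ?nnegrE ?addr_ge0 ?(ltW t0)// lerDr.
  by rewrite e4 in h4; lra.
have nn : 0 < 4 * n * (n - 4) by rewrite !mulr_gt0.
pose A := Q / (4 * n * (n - 4)); have A0 : 0 <= A by rewrite divr_ge0// ltW.
have D0 t : 0 < 1 + E t by rewrite addr_gt0.
have Dn0 t : 1 + E t != 0 by rewrite gt_eqF.
pose X t := E t / (1 + E t).
pose X1 t := 2 * E t / (1 + E t) ^+ 2.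
pose X2 t := 4 * E t * (1 - E t) / (1 + E t) ^+ 3.
have hX : hasd X X1.
  by move=> t; rewrite /X; der; [exact: Dn0|rewrite /X1; field; exact: Dn0].
have hX1 : hasd X1 X2.
  move=> t; rewrite /X1; der; first by rewrite expf_neq0.
  by rewrite /X2; field; exact: Dn0.
have X10 t : 0 < X1 t by rewrite divr_gt0 ?exprn_gt0// mulr_gt0.
have Xle t : X t <= 1 by rewrite ler_pdivrMr// mul1r lerDr.
pose g t := expR (A * X t); pose dg t := A * X1 t * g t.
pose G t := A * (expR ((n - 2) * t) * g t) * ((n - 2) * X1 t + X2 t + A * X1 t ^+ 2).
have hg : hasd g dg by move=> t; rewrite /g; der; rewrite /dg /g; ring.
have hG : hasd (fun t => expR ((n - 2) * t) * dg t) G.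
  by move=> t; rewrite /dg; der; rewrite /G /dg; ring.
have lE : limNy E 0 := limNy_expR (ltr0Sn R 1).
have lX : limNy X 0.
  apply: (limNy_squeeze (limNy_cst 0) lE); exists 0 => t _.
  rewrite divr_ge0 ?(ltW (E0 t)) ?(ltW (D0 t))//= ler_pdivrMr//.
  by rewrite ler_peMr ?(ltW (E0 t))// lerDl ltW.
have lX1 : limNy X1 0.
  have l2 := limNyM (limNy_cst 2) lE; rewrite mulr0 in l2.
  apply: (limNy_squeeze (limNy_cst 0) l2); exists 0 => t _; rewrite (ltW (X10 t))/=.
  rewrite ler_pdivrMr ?exprn_gt0// ler_peMr//; first by rewrite mulr_ge0// ltW.
  by rewrite -[leLHS](expr1n _ 2) ler_pXn2r ?nnegrE ?(ltW (D0 t))// lerDl ltW.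
have lg : limNy g 1.
  have l0 : limNy (fun t => A * X t) 0.
    by have := limNyM (limNy_cst A) lX; rewrite mulr0; exact.
  rewrite -(@expR0 R) /g; apply/limNyP.
  by apply: continuous_cvg; [exact: continuous_expR|apply/limNyP].
have lG : limNy (fun t => expR ((n - 2) * t) * dg t) 0.
  have := limNyM (limNy_expR n20) (limNyM (limNyM (limNy_cst A) lX1) lg).
  by rewrite mul0r; exact.
have dg0 t : 0 <= dg t by rewrite /dg mulr_ge0 ?expR_ge0// mulr_ge0// ltW.
pose eA := expR A; have eA0 : 0 < eA := expR_gt0 _.
have gA t : g t <= eA by rewrite ler_expR -[leRHS]mulr1 ler_wpM2l.
(* Chosen so that the increment of W over u is at most (c / 2) r^2; half of the decay of u remains
   in W. *)
pose de := n * c / eA; have de0 : 0 < de by rewrite divr_gt0// mulr_gt0.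
pose W t := u t + de / (2 * n) * (E t * g t).
have dn : 0 <= de / (2 * n) by rewrite divr_ge0 ?(ltW de0)// mulr_ge0// ltW.
have Eg t : 0 <= E t * g t by rewrite mulr_ge0 ?expR_ge0.
have WE t : W t <= - (c / 2) * E t.
  have : de / (2 * n) * (E t * g t) <= de / (2 * n) * (E t * eA).
    by rewrite (ler_wpM2l dn)// ler_wpM2l// ltW.
  have -> : de / (2 * n) * (E t * eA) = c / 2 * E t.
    by rewrite /de; field; rewrite !gt_eqF.
  have := uc t; rewrite -/(E t) /W; lra.
have W0 t : W t <= 0.
  by apply: le_trans (WE t) _; rewrite mulNr oppr_le0 mulr_ge0 ?divr_ge0 ?(ltW c0)// ltW.
have inc t : 0 <= de / (2 * n) * (E t * g t).
  by rewrite mulr_ge0.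
exists (be + de); first by rewrite ltrDl.
apply: (gs_iterate (W := W) (gs_u S)) => //.
- have bB : locbdd (fun _ : nat => b).
    have u0 t : u t <= 0 := ltW (gs_u_lt0 n3 al2 S t).
    apply: (locbdd_between (lo := fun _ t => be / n * expR (n * t))
     (hi := fun _ t => be / n * expR (n * t)
        + ((n + al) * (2 + al))^-1 / (n + 2 + al) * expR ((n + 2 + al) * t))).
    + by locb.
    + by locb.
    + by move=> k t; split; [exact: gs_b_ge n3 S t|exact: gs_up_b n3 al2 S u0 t].
  by locb.
- by move=> t; rewrite lerDl.
- move=> u' b' v' m' S' t.
  have Kv s : s <= t -> 0 <= v' s - v s.
    move=> st; have [_] := gs_le_mv S S' (fun r (_ : r <= t) => lexx (u r)) st.
    by apply: le_trans; rewrite addrAC subrr add0r ltW.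
  by have := (gs_le_bu n3 S S' Kv (lexx t)).2; rewrite mul0r mul0r subr_ge0.
move=> a u' b' v' m' S' la ua t.
suff GK s : s <= t -> expR ((n + al) * s) * (expR (a s) - expR (u s)) <= de * G s.
  have vK s : s <= t -> v' s - v s <= de * g s.
    move=> st; have := gs_up_mv S S' hg lg hG lG GK st; lra.
  have := gs_up_bu n3 S S' (ltW de0) hg lg dg0 vK (lexx t).
  by rewrite /W /E; lra.
move=> _.
have e1 : expR (a s) - expR (u s) <= expR (W s) * (W s - u s).
  have Ee : expR (u s) = expR (W s) * expR (u s - W s) by rewrite -expRD addrC subrK.
  have h1 : 1 + (u s - W s) <= expR (u s - W s) := expR_ge1Dx _.
  have h3 : expR (W s) * (1 + (u s - W s)) <= expR (u s) by rewrite Ee ler_wpM2l ?expR_ge0.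
  have : expR (a s) <= expR (W s) by rewrite ler_expR.
  by lra.
have e2 : expR (a s) - expR (u s) <= expR (- (c / 2) * E s) * (de / (2 * n) * (E s * g s)).
  apply: le_trans e1 _; have -> : W s - u s = de / (2 * n) * (E s * g s).
    by rewrite /W; ring.
  by rewrite ler_wpM2r// ler_expR.
apply: (@le_trans _ _ (expR ((n + al) * s) * (expR (- (c / 2) * E s) * (de / (2 * n) * (E s * g s))))).
  by rewrite ler_wpM2l ?expR_ge0.
pose P := expR ((2 + al) * s - c / 2 * E s).
have EP : expR ((n + al) * s) * expR (- (c / 2) * E s) = expR ((n - 2) * s) * P.
  by rewrite /P -!expRD; congr expR; ring.
have -> : expR ((n + al) * s) * (expR (- (c / 2) * E s) * (de / (2 * n) * (E s * g s))) =
  de * (expR ((n - 2) * s) * g s) * (P * E s / (2 * n)).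
  have -> : expR ((n + al) * s) * (expR (- (c / 2) * E s) * (de / (2 * n) * (E s * g s))) =
    expR ((n + al) * s) * expR (- (c / 2) * E s) * (de / (2 * n) * (E s * g s)) by ring.
  by rewrite EP; field; rewrite gt_eqF.
have -> : de * G s = de * (expR ((n - 2) * s) * g s) *
   (A * ((n - 2) * X1 s + X2 s + A * X1 s ^+ 2)) by rewrite /G; ring.
rewrite ler_wpM2l//; first by rewrite (mulr_ge0 (ltW de0))// mulr_ge0 ?expR_ge0.
(* Here n > 4 enters: (n - 2) X1 + X2 equals 2 (n - 4) E / (1 + E)^2 plus a positive term. *)
have XX : 2 * (n - 4) * E s / (1 + E s) ^+ 2 <= (n - 2) * X1 s + X2 s + A * X1 s ^+ 2.
  have : 0 <= A * X1 s ^+ 2 by rewrite mulr_ge0 ?sqr_ge0.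
  have : 0 <= 8 * E s / (1 + E s) ^+ 3.
    by rewrite divr_ge0 ?mulr_ge0 ?exprn_ge0 ?(ltW (D0 s)) ?(ltW (E0 s)).
  have -> : (n - 2) * X1 s + X2 s = 2 * (n - 4) * E s / (1 + E s) ^+ 2 + 8 * E s / (1 + E s) ^+ 3.
    by rewrite /X1 /X2; field.
  by lra.
apply: le_trans (ler_wpM2l A0 XX).
have -> : A * (2 * (n - 4) * E s / (1 + E s) ^+ 2) = (Q / (1 + E s) ^+ 2) * E s / (2 * n).
  by rewrite /A; field; rewrite !gt_eqF.
rewrite ler_wpM2r ?invr_ge0 ?mulr_ge0 ?(ltW n0)// ler_wpM2r ?(ltW (E0 s))//.
by rewrite ler_pdivlMr ?exprn_gt0//; exact: hQ.
Qed.

End Existence.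

(** * Passage between the radial variable r and t = ln r *)

Section RadialVariable.
Context {R : realType}.
Implicit Types (f F G L u : R -> R) (r t : R) (N : nat).

Lemma isd_derive1 F r : derivable F r 1 -> isd r 1 F (derive1 F r).
Proof. by move=> /derivableP; rewrite derive1E. Qed.

Lemma derive1_isd F r d : isd r 1 F d -> derive1 F r = d.
Proof. by move=> [_ <-]; rewrite derive1E. Qed.

Lemma near_gt0 r : 0 < r -> \forall s \near r, 0 < s.
Proof. by move=> r0; exact: (cvgr_gt r (cvg_id : _ --> r) _ r0). Qed.

Lemma isd_pos F G r d : 0 < r -> (forall s, 0 < s -> F s = G s) ->
  isd r 1 F d -> isd r 1 G d.
Proof.
move=> r0 FG; apply: isd_near.
by apply: filterS (near_gt0 r0) => s; exact: FG.
Qed.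

Lemma predn_natr N : (0 < N)%N -> N.-1%:R = N%:R - 1 :> R.
Proof. by move=> N0; rewrite -subn1 natrB. Qed.

Lemma cvg0_limNy F l : (F r @[r --> 0^'+] --> l) <-> limNy (fun t => F (expR t)) l.
Proof.
split=> [/cvgrPdist_le h e e0|h].
  have h' : \forall r \near (0 : R), 0 < r -> `|l - F r| <= e := h e e0.
  case: (iffLR (nbhs_normP _ _) h') => d /= d0 hd.
  exists (ln (d / 2)) => t td.
  have t0 := expR_gt0 t.
  have : expR t <= d / 2 by rewrite -[leRHS]lnK ?ler_expR// posrE divr_gt0.
  move=> td'; rewrite distrC; apply: hd => //=.
  by rewrite sub0r normrN gtr0_norm//; lra.
apply/cvgrPdist_le => e e0; have [T hT] := h e e0.
near=> r.
have r0 : 0 < r by near: r; exact: nbhs_right_gt.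
have rT : r < expR T by near: r; apply: nbhs_right_lt; exact: expR_gt0.
rewrite distrC -(lnK (r0 : r \is Num.pos)); apply: hT.
by rewrite -ler_expR lnK ?posrE// ltW.
Unshelve. all: by end_near. Qed.

Lemma isd_inv r : r != 0 -> isd r 1 (@GRing.inv R) (- r ^- 2).
Proof. by move=> r0; have := isdV r0 (isd_id r); rewrite mulr1. Qed.

Section Forward.
Variable N : nat.
Hypothesis N0 : (0 < N)%N.
Let n : R := N%:R.

(** The flux r^(N-1) L'(r) at r = e^t: it is b for L = u and m for L = Delta u. *)
Definition logder L t := expR ((N%:R - 1) * t) * derive1 L (expR t).

Let he : hasd expR (expR : R -> R).
Proof. by move=> s; have := isd_expR (isd_id s); rewrite mulr1. Qed.

Lemma hasd_log L : (forall r, 0 < r -> derivable L r 1) ->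
  hasd (fun t => L (expR t)) (fun t => expR ((2 - n) * t) * logder L t).
Proof.
move=> dL t; have hL := isd_derive1 (dL _ (expR_gt0 t)).
apply: isd_eq; first exact: isd_outer hL (he t).
rewrite /logder mulrA -expRD mulrC; congr (expR _ * _); rewrite /n; ring.
Qed.

Lemma hasd_logder L : (forall r, 0 < r -> derivable (derive1 L) r 1) ->
  hasd (logder L) (fun t => expR (n * t) * rlap N L (expR t)).
Proof.
move=> dL t; have hL := isd_derive1 (dL _ (expR_gt0 t)).
have h : isd t 1 (fun t => derive1 L (expR t)) (derive1 (derive1 L) (expR t) * expR t).
  exact: isd_outer hL (he t).
rewrite /logder; der.
rewrite /rlap predn_natr// -/n.
have -> : expR (n * t) = expR ((n - 1) * t) * expR t.
  by rewrite -expRD; congr expR; ring.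
by rewrite /derive1n/=; field; rewrite gt_eqF ?expR_gt0.
Qed.

Lemma entire_gsys alpha be u : (1 < N)%N -> entire_radial_sol N alpha be u ->
  gsys n alpha be (fun t => u (expR t)) (fun t => u (expR t)) (logder u)
    (fun t => rlap N u (expR t)) (logder (rlap N u)).
Proof.
move=> N1 [du ode [u0 lu] [lu1 llap] llap1].
(* Iterated derivatives are hidden behind [U], so that [der] treats them as unknown functions. *)
have [U UE] : exists U : nat -> R -> R, U = fun k => derive1n k u by eexists.
have D k r : (k < 4)%N -> 0 < r -> isd r 1 (U k) (U k.+1 r).
  by move=> k4 r0; rewrite UE; exact: isd_derive1 (du r r0 k k4).
have [c cE] : exists c : R, c = N.-1%:R by exists N.-1%:R.
pose L1 r := U 3%N r + c * (U 2%N r / r - U 1%N r / r ^+ 2).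
pose L2 r := U 4%N r + c * (U 3%N r / r - 2 * U 2%N r / r ^+ 2 + 2 * U 1%N r / r ^+ 3).
have hL r : 0 < r -> isd r 1 (rlap N u) (L1 r).
  move=> r0; have rn : r != 0 by rewrite gt_eqF.
  have h1 := D 1%N r isT r0; have h2 := D 2%N r isT r0; have hi := isd_inv rn.
  have -> : rlap N u = fun r => U 2%N r + c / r * U 1%N r by rewrite UE cE.
  clear - h1 h2 hi rn; der; rewrite /L1; move: (U 1%N r) (U 2%N r) (U 3%N r) => a1 a2 a3.
  by field.
have hL1 r : 0 < r -> isd r 1 (derive1 (rlap N u)) (L2 r).
  move=> r0; have rn : r != 0 by rewrite gt_eqF.
  apply: (@isd_pos L1) => // [s s0|]; first by rewrite (derive1_isd (hL s s0)).
  have h1 := D 1%N r isT r0; have h2 := D 2%N r isT r0; have h3 := D 3%N r isT r0; have hi := isd_inv rn.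
  clear - h1 h2 h3 hi rn; rewrite /L1; der; first by rewrite expf_neq0.
  rewrite /L2; move: (U 1%N r) (U 2%N r) (U 3%N r) (U 4%N r) => a1 a2 a3 a4.
  by field.
have d0 r : 0 < r -> derivable u r 1 by move=> r0; exact: du r r0 0%N isT.
have d1 r : 0 < r -> derivable (derive1 u) r 1 by move=> r0; exact: du r r0 1%N isT.
have dL r : 0 < r -> derivable (rlap N u) r 1 by move=> /hL[].
have dL1 r : 0 < r -> derivable (derive1 (rlap N u)) r 1 by move=> /hL1[].
split.
- exact: hasd_log d0.
- exact: hasd_logder d1.
- exact: hasd_log dL.
- move=> t; apply: isd_eq (hasd_logder dL1 t) _.
  rewrite ode ?expR_gt0//.
  have -> : expR t `^ alpha = expR (alpha * t).
    by rewrite /powR gt_eqF ?expR_gt0// expRK.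
  by rewrite -!expRD; congr expR; ring.
- exact/cvg0_limNy.
- have l1 : limNy (fun t => derive1 u (expR t)) 0 by exact/cvg0_limNy.
  have n1 : 0 < n - 1 by rewrite subr_gt0 ltr1n.
  by have := limNyM (limNy_expR n1) l1; rewrite mulr0; exact.
- exact/cvg0_limNy.
- have := llap1 => /cvg0_limNy; congr limNy; apply/funext => t.
  by rewrite /logder -expRM_natl predn_natr.
Qed.

End Forward.

Section Backward.
Variable N : nat.
Hypothesis N0 : (0 < N)%N.
Let n : R := N%:R.

Lemma hasd_ln F f df r : 0 < r -> (forall s, 0 < s -> F s = f (ln s)) -> hasd f df ->
  isd r 1 F (expR (- ln r) * df (ln r)).
Proof.
move=> r0 Ff hf; apply: (@isd_pos (fun s => f (ln s))) => // [s /Ff->//|].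
apply: isd_eq; first exact: isd_outer (hf (ln r)) (isd_ln r0 (isd_id r)).
by rewrite expRN lnK ?posrE// mulr1 mulrC.
Qed.

Lemma derive1_ln F f g r : 0 < r -> (forall s, 0 < s -> F s = f (ln s)) ->
  hasd f (fun t => expR ((2 - n) * t) * g t) ->
  derive1 F r = expR ((1 - n) * ln r) * g (ln r).
Proof.
move=> r0 Ff hf; rewrite (derive1_isd (hasd_ln r0 Ff hf)) mulrA -expRD.
by congr (expR _ * _); ring.
Qed.

Lemma rlap_ln F f g dg r : 0 < r -> (forall s, 0 < s -> F s = f (ln s)) ->
  hasd f (fun t => expR ((2 - n) * t) * g t) -> hasd g dg ->
  rlap N F r = expR (- n * ln r) * dg (ln r).
Proof.
move=> r0 Ff hf hg; rewrite /rlap predn_natr// -/n (derive1_ln r0 Ff hf).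
have h : hasd (fun t => expR ((1 - n) * t) * g t)
    (fun t => expR ((1 - n) * t) * (dg t - (n - 1) * g t)).
  by move=> t; der; ring.
have D s : 0 < s -> derive1 F s = expR ((1 - n) * ln s) * g (ln s).
  by move=> s0; exact: derive1_ln s0 Ff hf.
rewrite -[derive1n 2 F r]/(derive1 (derive1 F) r) (derive1_isd (hasd_ln r0 D h)) mulrA -expRD.
have -> : (n - 1) / r * (expR ((1 - n) * ln r) * g (ln r)) =
   expR (- n * ln r) * ((n - 1) * g (ln r)).
  have -> : expR ((1 - n) * ln r) = expR (- n * ln r) * r.
    by rewrite -[in RHS](lnK (r0 : r \is Num.pos)) -expRD expRK; congr expR; ring.
  by field; rewrite gt_eqF.
have -> : - ln r + (1 - n) * ln r = - n * ln r by ring.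
by ring.
Qed.

Lemma gsys_entire alpha be u b v m : 3 <= n -> - 2 < alpha ->
  gsys n alpha be u u b v m ->
  entire_radial_sol N alpha be (fun r => if r <= 0 then 0 else u (ln r)).
Proof.
move=> n3 al2 S; set U := (fun r : R => _).
have U0 s : 0 < s -> U s = u (ln s) by move=> s0; rewrite /U leNgt s0.
have UL s : 0 < s -> rlap N U s = v (ln s).
  move=> s0; rewrite (rlap_ln s0 U0 (gs_u S) (gs_b S)) mulrA -expRD mulNr addNr expR0 mul1r.
  by [].
have D1 s : 0 < s -> derive1 U s = expR ((1 - n) * ln s) * b (ln s).
  by move=> s0; exact: derive1_ln s0 U0 (gs_u S).
pose f1 t := expR ((1 - n) * t) * b t.
pose df1 t := expR ((1 - n) * t) * (expR (n * t) * v t - (n - 1) * b t).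
have hf1 : hasd f1 df1 by move=> t; have hb := gs_b S; rewrite /f1 /df1; der; ring.
pose f2 t := expR (- n * t) * (expR (n * t) * v t - (n - 1) * b t).
have D2 s : 0 < s -> derive1 (derive1 U) s = f2 (ln s).
  move=> s0; rewrite (derive1_isd (hasd_ln s0 D1 hf1)) /df1 /f2 mulrA -expRD.
  by congr (expR _ * _); ring.
have [df2 hf2 [df3 hdf2]] : exists2 df2, hasd f2 df2 & exists df3, hasd df2 df3.
  exists (fun t => expR (- n * t) * (- n * (expR (n * t) * v t - (n - 1) * b t)
     + n * (expR (n * t) * v t) + expR (n * t) * (expR ((2 - n) * t) * m t)
     - (n - 1) * (expR (n * t) * v t))).
    by move=> t; have hb := gs_b S; have hv := gs_v S; rewrite /f2; der; ring.
  eexists => t; have hb := gs_b S; have hv := gs_v S; have hm := gs_m S.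
  der; reflexivity.
pose f3 t := expR (- t) * df2 t.
have D3 s : 0 < s -> derive1 (derive1 (derive1 U)) s = f3 (ln s).
  by move=> s0; rewrite (derive1_isd (hasd_ln s0 D2 hf2)).
have [df3' hf3] : exists df3', hasd f3 df3'.
  by eexists => t; rewrite /f3; der; reflexivity.
split.
- move=> r r0 [|[|[|[|//]]]] _.
  + by case: (hasd_ln r0 U0 (gs_u S)).
  + by case: (hasd_ln r0 D1 hf1).
  + by case: (hasd_ln r0 D2 hf2).
  + by case: (hasd_ln r0 D3 hf3).
- move=> r r0; rewrite (rlap_ln r0 UL (gs_v S) (gs_m S)) -expRD (U0 r r0).
  rewrite /powR gt_eqF// -expRD; congr expR; ring.
- split; first by rewrite /U lexx.
  apply/cvg0_limNy; have := gl_u S; congr limNy; apply/funext => t.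
  by rewrite U0 ?expR_gt0// expRK.
- split; apply/cvg0_limNy.
    (* The limit of b alone does not control u' = e^((1 - n) t) b. The explicit bounds place u'
       between be r / n and that plus a multiple of r^(3 + alpha), both tending to 0. *)
    have u0 t : u t <= 0 := ltW (gs_u_lt0 n3 al2 S t).
    have a3 : 0 < 3 + alpha by lra.
    pose k := ((n + alpha) * (2 + alpha))^-1 / (n + 2 + alpha).
    have l1 : limNy (fun t => be / n * expR t) 0.
      by have := limNy_cexp (be / n) (@ltr01 R); congr limNy; apply/funext => t; rewrite mul1r.
    apply: (limNy_squeeze (F := fun t => be / n * expR t)
       (H := fun t => be / n * expR t + k * expR ((3 + alpha) * t))) => //.
      by have := limNyD l1 (limNy_cexp k a3); rewrite addr0; exact.
    exists 0 => t _; rewrite D1 ?expR_gt0// expRK.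
    have -> : expR t = expR ((1 - n) * t) * expR (n * t).
      by rewrite -expRD; congr expR; ring.
    have -> : expR ((3 + alpha) * t) = expR ((1 - n) * t) * expR ((n + 2 + alpha) * t).
      by rewrite -expRD; congr expR; ring.
    have := gs_b_ge n3 S t; rewrite -(ler_pM2l (expR_gt0 ((1 - n) * t))) => h1.
    have := gs_up_b n3 al2 S u0 t; rewrite -(ler_pM2l (expR_gt0 ((1 - n) * t))) => h2.
    by apply/andP; split; rewrite /k; lra.
  have := gl_v S; congr limNy; apply/funext => t.
  by rewrite UL ?expR_gt0// expRK.
- apply/cvg0_limNy; have := gl_m S; congr limNy; apply/funext => t.
  rewrite (derive1_ln (expR_gt0 t) UL (gs_v S)) expRK -expRM_natl predn_natr//.
  by rewrite mulrA -expRD -/n -mulrDl addrA subrK subrr mul0r expR0 mul1r.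
Qed.

End Backward.
End RadialVariable.

(** * Stability of entire radial solutions *)

Section Perturbation.
Context {R : realType} {N : nat}.
Notation V := 'rV[R]_N.
Implicit Types (phi U : V -> R) (x : V) (Omega : set V) (alpha c : R).

Lemma pderiv_scale phi c (i : 'I_N) x : derivable phi x (evec R i) ->
  isd x (evec R i) (fun y => c * phi y) (c * pderiv i phi x).
Proof.
move=> d; have h : isd x (evec R i) phi (pderiv i phi x) := derivableP d.
by der; ring.
Qed.

Lemma C2_scale phi c : C2 phi -> C2 (fun x => c * phi x) /\
  laplacian (fun x => c * phi x) = fun x => c * laplacian phi x.
Proof.
move=> [p0 p1 p2 p3 p4].
have d1 i : pderiv i (fun x => c * phi x) = fun x => c * pderiv i phi x.
  by apply/funext => x; have [_ <-] := pderiv_scale c (p1 i x).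
have d2 i j : pderiv j (fun x => c * pderiv i phi x) = fun x => c * pderiv j (pderiv i phi) x.
  by apply/funext => x; have [_ <-] := pderiv_scale c (p3 i j x).
split; last first.
  apply/funext => x; rewrite /laplacian mulr_sumr; apply: eq_bigr => i _.
  by rewrite d1 d2.
split=> [|i x|i|i j x|i j].
- by cont.
- by have [] := pderiv_scale c (p1 i x).
- by rewrite d1; have := p2 i => ?; cont.
- by rewrite d1; have [] := pderiv_scale c (p3 i j x).
- by rewrite d1 d2; have := p4 i j => ?; cont.
Qed.

Lemma C2c_scale Omega phi c : c != 0 -> C2c Omega phi -> C2c Omega (fun x => c * phi x).
Proof.
move=> c0 [/(C2_scale c)[C2p _] cs sO].
by split=> //; rewrite (_ : [set x | c * phi x != 0] = [set x | phi x != 0])//;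
  apply/funext => x /=; rewrite mulf_eq0 (negbTE c0).
Qed.

(** On the support of phi, e^U is at most lam e^([U']) with lam slightly above 1. Testing the
    stability of [U'] with sqrt(lam) phi absorbs this factor and costs only (lam - 1) times the
    Laplacian term. *)
Lemma stable_on_limit alpha U Omega :
  (forall eps rho : R, 0 < eps -> exists2 U', stable_on alpha U' Omega &
     forall x, sq x <= rho -> U x <= U' x + eps) ->
  stable_on alpha U Omega.
Proof.
move=> h; apply/stable_onP => phi cphi.
have [M sM _] := C2c_supp cphi; have [C2p _ _] := cphi.
have cl := lap_Cc C2p sM; set J := Iv _.
have J0 : 0 <= J by apply: Iv_ge0 => // x; exact: sqr_ge0.
apply/lee_addgt0Pr => e e0.
pose lam := 1 + e / (J + 1); have J1 : 0 < J + 1 by lra.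
have lam1 : 1 < lam by rewrite ltrDl divr_gt0.
have lam0 : 0 < lam by lra.
have [U' sU' UU'] := h (ln lam) (N%:R * M ^+ 2) (ln_gt0 lam1).
pose c := Num.sqrt lam; have c0 : c != 0 by rewrite gt_eqF// sqrtr_gt0.
have c2 : c ^+ 2 = lam by rewrite sqr_sqrtr// ltW.
have /stable_onP/(_ _ (C2c_scale c0 cphi)) := sU'.
rewrite (C2_scale c C2p).2.
have -> : (fun x => (c * laplacian phi x) ^+ 2) = fun x => lam * laplacian phi x ^+ 2.
  by apply/funext => x; rewrite exprMn c2.
rewrite (IvZ lam cl) -/J => h1.
have lJ : lam * J <= J + e.
  rewrite /lam mulrDl mul1r lerD2l mulrAC ler_pdivrMr// ler_wpM2l ?(ltW e0)//; lra.
apply: (@le_trans _ _ (lam * J)%:E); last by rewrite -EFinD lee_fin.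
apply: le_trans h1.
have [] // := @integral_RN_le R N (fun x => (weight alpha U x * phi x ^+ 2)%:E)
  (fun x => (weight alpha U' x * (c * phi x) ^+ 2)%:E).
  by move=> x; rewrite lee_fin weight_ge0.
move=> x; rewrite lee_fin exprMn c2.
have [->|p0] := eqVneq (phi x) 0; first by rewrite expr0n !mulr0.
have sx : sq x <= N%:R * M ^+ 2.
  have -> : N%:R * M ^+ 2 = \sum_(i < N) M ^+ 2 by rewrite sumr_const card_ord mulr_natl.
  apply: ler_sum => i _; have xM : `|x ord0 i| <= M.
    by rewrite leNgt; apply: contra p0 => /sM ->.
  by rewrite -[leLHS]real_normK ?num_real// ler_pXn2r ?nnegrE// (le_trans _ xM).
rewrite [leRHS]mulrA ler_wpM2r ?sqr_ge0// /weight -mulrA ler_wpM2l ?powR_ge0//.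
by rewrite -[X in _ * X]lnK ?posrE// -expRD ler_expR UU'.
Qed.

End Perturbation.

(** * The critical dimension [N_alpha] *)

Section Threshold.
Context {R : realType}.
Implicit Types (x y K alpha : R).

(** Divided by (x - 4) / 16, the equation of [N_alpha] reads x^2 (x - 4) = K (x - 2) with K = 32 (4
    + alpha), and x^2 (x - 4) / (x - 2) is increasing for x > 4. *)
Lemma threshold_incr K x y : 0 < K -> 4 < x -> x < y ->
  K * (x - 2) <= x ^+ 2 * (x - 4) -> K * (y - 2) < y ^+ 2 * (y - 4).
Proof.
move=> K0 x4 xy h.
have x20 : 0 < x - 2 by lra.
have y20 : 0 < y - 2 by lra.
have h1 : K * (x - 2) * (y - 2) <= x ^+ 2 * (x - 4) * (y - 2) by rewrite ler_wpM2r// ltW.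
have h2 : (x - 4) * (y - 2) < (y - 4) * (x - 2) by lra.
have h3 : x ^+ 2 * ((x - 4) * (y - 2)) < x ^+ 2 * ((y - 4) * (x - 2)).
  by rewrite ltr_pM2l// exprn_gt0//; lra.
have h4 : x ^+ 2 * ((y - 4) * (x - 2)) <= y ^+ 2 * ((y - 4) * (x - 2)).
  rewrite ler_wpM2r ?mulr_ge0//; try lra.
  by rewrite ler_pXn2r ?nnegrE//; lra.
by rewrite -(ltr_pM2r x20); lra.
Qed.

(** The intermediate value theorem on [5, K + 6] gives a root, the value at 5 being 25 - 3 K < 0;
    hence [xget] returns a root and not its default 0. *)
Lemma N_alphaP alpha : -2 < alpha -> 5 < N_alpha alpha /\
  N_alpha alpha ^+ 2 * (N_alpha alpha - 4) = 32 * (4 + alpha) * (N_alpha alpha - 2).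
Proof.
move=> al2; pose K := 32 * (4 + alpha); have K64 : 64 < K by rewrite /K; lra.
pose f x := x ^+ 2 * (x - 4) - K * (x - 2).
have cf : continuous f by rewrite /f; cont.
have [x xI fx] : exists2 x, x \in `[5, K + 6] & f x = 0.
  apply: IVT; first by lra.
    exact: continuous_subspaceT.
  rewrite ge_min le_max; apply/andP; split; apply/orP; [left|right].
    by rewrite /f; lra.
  have h : (K + 6) ^+ 2 * K <= (K + 6) ^+ 2 * (K + 6 - 4).
    by rewrite ler_wpM2l ?sqr_ge0//; lra.
  have h2 : K * (K + 6 - 2) <= K * (K + 6) ^+ 2.
    by rewrite ler_wpM2l//; [lra|rewrite expr2; nra].
  by rewrite /f; lra.
move: xI; rewrite in_itv/= => /andP[xI _].
have x5 : 5 < x.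
  rewrite lt_neqAle xI andbT; apply: contra_eqN fx => /eqP <-.
  by rewrite /f lt_eqF//; lra.
have ex : exists y, 5 < y /\ y ^+ 2 * (y - 4) ^+ 2 / 16 = 2 * (4 + alpha) * (y - 2) * (y - 4).
  exists x; split=> //; move/eqP: fx; rewrite subr_eq0 => /eqP fx.
  have -> : x ^+ 2 * (x - 4) ^+ 2 / 16 = x ^+ 2 * (x - 4) * ((x - 4) / 16) by ring.
  by rewrite fx /K; field.
have [N5 NE] := xgetPex 0 ex; rewrite -/(N_alpha alpha) in N5 NE; split=> //.
apply: (@mulIf _ ((N_alpha alpha - 4) / 16)); first by rewrite gt_eqF// divr_gt0//; lra.
by rewrite (_ : _ * ((_ - 4) / 16) = N_alpha alpha ^+ 2 * (N_alpha alpha - 4) ^+ 2 / 16);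
  [rewrite NE; field|ring].
Qed.

Lemma N_alpha_sub alpha x : -2 < alpha -> 5 <= x -> x < N_alpha alpha ->
  (x * (x - 4) / 4) ^+ 2 < 2 * (4 + alpha) * (x - 2) * (x - 4).
Proof.
move=> al2 x5 xN; have [N5 NE] := N_alphaP al2.
have K0 : 0 < 32 * (4 + alpha) by rewrite mulr_gt0//; lra.
have h : x ^+ 2 * (x - 4) < 32 * (4 + alpha) * (x - 2).
  have x4 : 4 < x by lra.
  by rewrite ltNge; apply/negP => /(threshold_incr K0 x4 xN); rewrite NE ltxx.
have x4 : 0 < (x - 4) / 16 by rewrite divr_gt0//; lra.
have := h; rewrite -(ltr_pM2r x4); lra.
Qed.

Lemma N_alpha_super alpha x : -2 < alpha -> N_alpha alpha <= x -> 5 < x /\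
  2 * (4 + alpha) * (x - 2) * (x - 4) <= (x * (x - 4) / 4) ^+ 2.
Proof.
move=> al2 xN; have [N5 NE] := N_alphaP al2.
have K0 : 0 < 32 * (4 + alpha) by rewrite mulr_gt0//; lra.
have x5 : 5 < x by exact: lt_le_trans xN.
split=> //.
have h : 32 * (4 + alpha) * (x - 2) <= x ^+ 2 * (x - 4).
  move: xN; rewrite le_eqVlt => /predU1P[<-|xN]; first by rewrite NE.
  have N4 : 4 < N_alpha alpha by lra.
  by apply/ltW/(threshold_incr K0 N4 xN); rewrite NE.
have x4 : 0 < (x - 4) / 16 by rewrite divr_gt0//; lra.
have := h; rewrite -(ler_pM2r x4); lra.
Qed.

End Threshold.

(** * Stability as the parameter beta varies *)

Section EntireRadialSolutions.
Context {R : realType}.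
Variables (N : nat) (alpha : R).
Hypotheses (N3 : (3 <= N)%N) (al2 : -2 < alpha).
Implicit Types (be : R) (u : R -> R) (Omega : set 'rV[R]_N).
Local Notation ent := (entire_radial_sol N alpha).
Local Notation n := (N%:R : R).

Let n3 : 3 <= n. Proof. by rewrite ler_nat. Qed.

Lemma ent_gsys be u : ent be u -> exists b v m,
  gsys n alpha be (fun t => u (expR t)) (fun t => u (expR t)) b v m.
Proof. by move=> /entire_gsys S; do 3!eexists; apply: S; exact: leq_trans N3. Qed.

Lemma gsys_ent be : (exists u b v m, gsys n alpha be u u b v m) -> exists u, ent be u.
Proof.
move=> [u [b [v [m S]]]]; eexists.
by apply: gsys_entire S => //; exact: leq_trans N3.
Qed.

Lemma ent_below be be' u' : be <= be' -> ent be' u' -> exists u, ent be u.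
Proof.
by move=> bb /ent_gsys[b [v [m S]]]; exact/gsys_ent/(gs_exists_below n3 al2 bb S).
Qed.

Lemma ent_lt0 be u : ent be u -> be < 0.
Proof. by move=> /ent_gsys[b [v [m S]]]; exact: gs_be_lt0 n3 al2 S. Qed.

Lemma ent_le_beta0 be u : ent be u -> be <= beta0 N alpha.
Proof.
move=> h; apply: ub_le_sup; last by exists u.
by exists 0 => b [u' /ent_lt0/ltW].
Qed.

Lemma ent_gt be u : ent be u -> forall c, c < beta0 N alpha ->
  exists2 be', c < be' & exists u', ent be' u'.
Proof.
move=> h c cb; have sS : has_sup [set b | exists u, ent b u].
  by split; [exists be, u|exists 0 => b [u' /ent_lt0/ltW]].
by have [be' h' cbe'] := sup_gt sS.1 cb; exists be'.
Qed.

Lemma ent_beta0 be u : ent be u -> exists u0, ent (beta0 N alpha) u0.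
Proof.
move=> h; apply: gsys_ent; apply: (gs_exists_sup n3 al2) => c /(ent_gt h)[be' cb [u' hu']].
by have [b [v [m S]]] := ent_gsys hu'; exact: (gs_exists_below n3 al2 (ltW cb) S).
Qed.

Lemma ent_gap be be' u u' : be < be' -> ent be u -> ent be' u' -> forall t,
  (be' - be) / (2 * n) * expR (2 * t) <= u' (expR t) - u (expR t).
Proof.
move=> bb /ent_gsys[b [v [m S]]] /ent_gsys[b' [v' [m' S']]].
exact: gs_gap n3 bb S S'.
Qed.

Lemma ent_le be be' u u' : be < be' -> ent be u -> ent be' u' ->
  forall x, radial N u x <= radial N u' x.
Proof.
move=> bb h h' x; rewrite /radial.
have := sqrtr_ge0 (\sum_(i < N) x ord0 i ^+ 2); rewrite -/(enorm x) le_eqVlt.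
case/predU1P => [<-|e0].
  by have [_ _ [-> _] _ _] := h; have [_ _ [-> _] _ _] := h'.
rewrite -(lnK (e0 : enorm x \is Num.pos)).
have := ent_gap bb h h' (ln (enorm x)).
have : 0 <= (be' - be) / (2 * n) * expR (2 * ln (enorm x)).
  by rewrite mulr_ge0 ?expR_ge0// divr_ge0 ?subr_ge0 ?(ltW bb)// mulr_ge0// (le_trans _ n3).
by lra.
Qed.

Lemma ent_stable_le be be' u u' Omega : be < be' -> ent be u -> ent be' u' ->
  stable_on alpha (radial N u') Omega -> stable_on alpha (radial N u) Omega.
Proof. by move=> bb h h'; apply: stable_on_le; exact: ent_le bb h h'. Qed.

Lemma ent_continuous be u : ent be u -> continuous (emden alpha u).
Proof.
move=> /ent_gsys[b [v [m S]]]; have cu := hasd_cont (gs_u S).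
by rewrite /emden; cont.
Qed.

Lemma ent_unstable34 be u : (N = 3 \/ N = 4)%N -> ent be u -> ~ stable alpha (radial N u).
Proof. by move=> N34 h; exact: cutoff_unstable N34 (ent_continuous h). Qed.

Lemma ent_stable_at_infinity34 be u : (N = 3 \/ N = 4)%N -> ent be u ->
  stable_at_infinity alpha (radial N u).
Proof.
move=> N34 /ent_gsys[b [v [m S]]].
have [C [c c0 [T hT]]] : exists C, exists2 c, 0 < c & exists T, forall t, T <= t ->
    emden alpha u t <= C - c * t.
  case: N34 => NE; first by apply: (gs_decay3 n3 al2 S); rewrite NE.
  by apply: (gs_decay4 n3 al2 S); rewrite NE.
have [a a0 Na] : exists2 a : R, - (2^-1) <= a & n = 4 + 2 * a.
  by exists ((n - 4) / 2); [move: n3 => n3'; lra|field].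
exact: emden_stable_at_infinity a0 Na c0 hT.
Qed.

Lemma ent_stable_at_infinity be u : ent be u -> be < beta0 N alpha ->
  stable_at_infinity alpha (radial N u).
Proof.
move=> h bb; have [be' bbe' [u' h']] := ent_gt h bb.
have [b [v [m S]]] := ent_gsys h; have [b' [v' [m' S']]] := ent_gsys h'.
have n20 : 0 < 2 * n by move: n3 => n3'; lra.
pose c := (be' - be) / (2 * n); have c0 : 0 < c by rewrite divr_gt0// subr_gt0.
have uc t : u (expR t) <= - c * expR (2 * t).
  by have := ent_gap bbe' h h' t; have := gs_u_lt0 n3 al2 S' t; rewrite -/c; lra.
have [C hC] := gs_decay_of_quadratic alpha c0 uc.
have [a a0 Na] : exists2 a : R, - (2^-1) <= a & n = 4 + 2 * a.
  by exists ((n - 4) / 2); [move: n3 => n3'; lra|field].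
exact: emden_stable_at_infinity a0 Na ltr01 hC.
Qed.

Lemma ent_beta0_unstable u : (5 <= N)%N -> n < N_alpha alpha ->
  ent (beta0 N alpha) u -> forall K : set 'rV[R]_N, compact K ->
  ~ stable_on alpha (radial N u) (~` K).
Proof.
move=> N5 Na h; have [b [v [m S]]] := ent_gsys h.
have n5 : 5 <= n by rewrite ler_nat.
have n4 : 4 < n by lra.
have n20 : 0 < 2 * n by lra.
have [|Psi [B hPsi bPsi]] := gs_psi_bounded n3 al2 S n4.
  move=> c c0; apply: contrapT => /forallNP H.
  have vc t : v t <= - c by rewrite leNgt; apply/negP; exact: H.
  have uc := gs_u_le_of_v_le n3 S vc.
  have c20 : 0 < c / (2 * n) by rewrite divr_gt0.
  have [be' bbe' ex] := gs_exists_above n3 al2 n4 c20 S uc.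
  have [u' /ent_le_beta0] := gsys_ent ex.
  by rewrite leNgt bbe'.
pose a := (n - 4) / 2; have nE : n = 4 + 2 * a by rewrite /a; field.
have a0 : 0 <= a by rewrite divr_ge0//; lra.
apply: (exterior_unstable _ a0 nE _ (ent_continuous h) hPsi bPsi).
  exact: leq_trans N3.
rewrite (_ : a * (a + 2) = n * (n - 4) / 4); last by rewrite /a; field.
exact: N_alpha_sub.
Qed.

Lemma ent_stable_super be u : N_alpha alpha <= n -> ent be u -> stable alpha (radial N u).
Proof.
move=> /(N_alpha_super al2)[n5 CC] /ent_gsys[b [v [m S]]].
pose a := (n - 4) / 2; have nE : n = 4 + 2 * a by rewrite /a; field.
have a0 : 0 < a by rewrite divr_gt0//; lra.
have aE : a * (a + 2) = n * (n - 4) / 4 by rewrite /a; field.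
rewrite -aE in CC; apply: (emden_stable (Omega := setT) a0 nE) => t.
exact: le_trans (gs_emden_le n3 al2 S a0 nE CC t) CC.
Qed.

(** c is tuned so that the left side is largest at t = q / ga, where it equals q - ga / 2. *)
Lemma linear_minus_expR (ga q : R) : 0 < ga -> exists2 c, 0 < c &
  forall t, ga * t - c * expR (2 * t) <= q.
Proof.
move=> ga0; pose s := q / ga.
exists (ga / 2 * expR (- (2 * s))) => [|t]; first by rewrite mulr_gt0 ?expR_gt0// divr_gt0.
have : 1 + 2 * (t - s) <= expR (2 * (t - s)) := expR_ge1Dx _.
have g2 : 0 < ga / 2 by rewrite divr_gt0.
have -> : expR (2 * (t - s)) = expR (- (2 * s)) * expR (2 * t).
  by rewrite -expRD; congr expR; ring.
rewrite -(ler_pM2l g2).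
have : ga * s = q by rewrite /s mulrC divfK// gt_eqF.
by lra.
Qed.

(** The gap to a fixed negative solution is c r^2 with c at will, which pushes e^w below the Rellich
    constant everywhere. *)
Lemma ent_stable_small be0 u0 : 4 < n -> ent be0 u0 ->
  exists2 be, be < be0 & forall u, ent be u -> stable alpha (radial N u).
Proof.
move=> n4 h0; have [b0 [v0 [m0 S0]]] := ent_gsys h0.
pose a := (n - 4) / 2; have nE : n = 4 + 2 * a by rewrite /a; field.
have a0 : 0 < a by rewrite divr_gt0// subr_gt0.
have c20 : 0 < (a * (a + 2)) ^+ 2 by rewrite exprn_gt0// mulr_gt0// addr_gt0.
have ga0 : 0 < 4 + alpha by move: al2 => al2'; lra.
have n20 : 0 < 2 * n by rewrite mulr_gt0//; lra.
have [c c0 hc] := linear_minus_expR (ln ((a * (a + 2)) ^+ 2)) ga0.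
have be_lt : be0 - c * (2 * n) < be0 by rewrite gtrBl mulr_gt0.
exists (be0 - c * (2 * n)) => // u h; apply: (emden_stable (Omega := setT) a0 nE) => t.
have := ent_gap be_lt h h0 t; have := gs_u_lt0 n3 al2 S0 t.
have -> : (be0 - (be0 - c * (2 * n))) / (2 * n) = c by field; rewrite gt_eqF//; lra.
move=> h1 h2; rewrite -[leRHS]lnK ?posrE// ler_expR; apply: le_trans (hc t).
by rewrite /emden; lra.
Qed.

(** On each bounded set [gs_close] brings u within eps of a solution with a slightly smaller
    parameter, and [stable_on_limit] carries stability over. *)
Lemma ent_stable_closed be u Omega : ent be u ->
  (forall be' u', be' < be -> ent be' u' -> stable_on alpha (radial N u') Omega) ->
  stable_on alpha (radial N u) Omega.
Proof.
move=> h st; apply: stable_on_limit => eps rho eps0.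
have n0 : 0 < n by move: n3 => n3'; lra.
have ga0 : 0 < 4 + alpha by move: al2 => al2'; lra.
pose M := expR (2 * rho) * expR (expR ((4 + alpha) * rho)).
have M0 : 0 < M by rewrite mulr_gt0 ?expR_gt0.
(* With this d the bound of [gs_close] at t <= rho is at most (d / n) M = eps. *)
pose d := eps * n / M; have d0 : 0 < d by rewrite divr_gt0// mulr_gt0.
have bd : be - d < be by rewrite gtrBl.
have [u' h'] := ent_below (ltW bd) h.
exists (radial N u'); first exact: st bd h'.
move=> x sx; rewrite /radial.
have := sqrtr_ge0 (\sum_(i < N) x ord0 i ^+ 2); rewrite -/(enorm x) le_eqVlt.
case/predU1P => [<-|e0].
  by have [_ _ [-> _] _ _] := h; have [_ _ [-> _] _ _] := h'; rewrite add0r ltW.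
have [b [v [m S]]] := ent_gsys h; have [b' [v' [m' S']]] := ent_gsys h'.
rewrite -(lnK (e0 : enorm x \is Num.pos)); set t := ln _.
have t_rho : t <= rho.
  have : expR t ^+ 2 <= rho by rewrite /t lnK// sqr_sqrtr ?sq_ge0.
  rewrite -expRM_natl => h1.
  have h2 : 1 + 2 * t <= expR (2 * t) := expR_ge1Dx _.
  have h3 : 0 < expR (2 * t) := expR_gt0 _.
  by have := h1; lra.
have := gs_close n3 al2 bd S' S t.
have -> : 2 * (be - (be - d)) / (2 * n) = eps / M.
  by rewrite /d; field; rewrite !gt_eqF.
have : eps / M * (expR (2 * t) * expR (expR ((4 + alpha) * t))) <= eps / M * M.
  rewrite ler_wpM2l ?divr_ge0 ?(ltW eps0) ?(ltW M0)//.
  by apply: ler_pM; rewrite ?expR_ge0// !ler_expR ler_wpM2l// ltW.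
by rewrite divfK ?gt_eqF//; lra.
Qed.

Lemma ent_stability_threshold : (5 <= N)%N -> n < N_alpha alpha ->
  exists2 be1, be1 < beta0 N alpha & forall be u, be <= beta0 N alpha -> ent be u ->
    (stable alpha (radial N u) <-> be <= be1).
Proof.
move=> N5 Na; have n4 : 4 < n by rewrite ltr_nat.
have [[be00 [u00 h00]]|none] := pselect (exists be u, ent be u); last first.
  (* Without any entire solution the equivalence is vacuous, and any number below [beta0] serves. *)
  exists (beta0 N alpha - 1); first by rewrite gtrBl.
  by move=> be u _ h; case: none; exists be, u.
have [u0 h0] := ent_beta0 h00.
have unst : ~ stable alpha (radial N u0).
  have := ent_beta0_unstable N5 Na h0 (@compact0 _); rewrite setC0; exact.
pose T := [set be | be <= beta0 N alpha /\ forall u, ent be u -> stable alpha (radial N u)].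
have ex be : be <= beta0 N alpha -> exists u, ent be u by move=> bb; exact: ent_below bb h0.
have down be be' : be < be' -> T be' -> T be.
  move=> bb [b'0 st]; split; first by rewrite ltW// (lt_le_trans bb).
  by move=> u h; have [u' h'] := ex _ b'0; exact: ent_stable_le bb h h' (st u' h').
have [bs bs0 hbs] := ent_stable_small n4 h0.
have sT : has_sup T.
  by split; [exists bs; split=> //; exact: ltW|exists (beta0 N alpha) => be []].
have sup_le : sup T <= beta0 N alpha by apply: ge_sup => [|be []//]; exact: sT.1.
have lt_sup be : be < sup T -> T be.
  by move=> /(sup_gt sT.1)[be' Tb' bb]; exact: down bb Tb'.
have Tsup : T (sup T).
  split=> // u h; apply: (ent_stable_closed h) => be' u' bb h'.
  by have [_] := lt_sup be' bb; apply.
exists (sup T).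
  rewrite lt_neqAle sup_le andbT; apply/eqP => E.
  by apply: unst; have [_] := Tsup; rewrite E; apply.
move=> be u bb h; split=> [st|].
  rewrite leNgt; apply/negP => lt.
  (* The comparison of solutions requires strictly different parameters: stability of u at [be]
     reaches every solution at the midpoint, which then belongs to T although it exceeds its
     supremum. *)
  have [m1 m2] : sup T < (sup T + be) / 2 /\ (sup T + be) / 2 < be by split; lra.
  have Tm : T ((sup T + be) / 2).
    split; first by rewrite ltW// (lt_le_trans m2).
    by move=> u' h'; exact: ent_stable_le m2 h' h st.
  have : (sup T + be) / 2 <= sup T by apply: ub_le_sup => //; exact: sT.2.
  by rewrite leNgt m1.
rewrite le_eqVlt => /predU1P[E|/lt_sup[_ st]]; last exact: st.
by have [_] := Tsup; rewrite -E; apply.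
Qed.

End EntireRadialSolutions.

Unset Implicit Arguments.
Theorem theorem1p4 (R : realType) (N : nat) (alpha : R) :
  (3 <= N)%N -> -2 < alpha ->
  [/\
   (* (i) *)
   (N = 3 \/ N = 4)%N ->
     forall (beta : R) (u : R -> R), beta <= beta0 N alpha ->
       entire_radial_sol N alpha beta u ->
       ~ stable alpha (radial N u) /\ stable_at_infinity alpha (radial N u),
   (* (ii) *)
   (5 <= N)%N -> (N%:R < N_alpha alpha) ->
     [/\ (forall (beta : R) (u : R -> R), beta < beta0 N alpha ->
            entire_radial_sol N alpha beta u ->
            stable_at_infinity alpha (radial N u)),
         (forall u : R -> R, entire_radial_sol N alpha (beta0 N alpha) u ->
            forall K : set 'rV[R]_N, compact K ->
              ~ stable_on alpha (radial N u) (~` K)) &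
         (exists2 beta1 : R, beta1 < beta0 N alpha &
            forall (beta : R) (u : R -> R), beta <= beta0 N alpha ->
              entire_radial_sol N alpha beta u ->
              (stable alpha (radial N u) <-> beta <= beta1))] &
   (* (iii) *)
   N_alpha alpha <= N%:R ->
     forall (beta : R) (u : R -> R), beta <= beta0 N alpha ->
       entire_radial_sol N alpha beta u ->
       stable alpha (radial N u)].

Proof.
move=> N3 al2; split.
- move=> N34 beta u _ h; split; first exact (ent_unstable34 N3 N34 h).
  exact (ent_stable_at_infinity34 N3 al2 N34 h).
- move=> N5 Na; split.
  + by move=> beta u bb h; exact (ent_stable_at_infinity N3 al2 h bb).
  + by move=> u h; exact (ent_beta0_unstable N3 al2 N5 Na h).
  + exact (ent_stability_threshold N3 al2 N5 Na).
- by move=> Na beta u _ h; exact (ent_stable_super N3 al2 Na h).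
Qed.
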